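(* Let $E|F$ be a finite field extension, $\rho'$ an automorphism of $E$ with $\rho'^2=\mathrm{id}$ extending $\rho$, and $\lambda:E\to F$ a non-zero $F$-linear map with $\lambda\circ\rho'=\rho\circ\lambda$. Then $\mathrm{Tr}_{\lambda,\epsilon}(X_{\rho',\epsilon,E})=X_{\rho,\epsilon,F}$.
   Context: $F$ is a nonarchimedean local field of odd residual characteristic, $\rho$ an automorphism of $F$ with $\rho^2=\mathrm{id}$, $\epsilon\in\{\pm1\}$. For a field $K$ with involution $\tau$ ($\tau^2=\mathrm{id}$), a $(\tau,\epsilon)$-hermitian form on a finite-dimensional right $K$-space $W$ is a nondegenerate biadditive $b$ with $b(w_1x,w_2y)=\tau(x)\epsilon\tau(b(w_2,w_1))y$. The Witt group $W_{\tau,\epsilon}(K)$ is the set of classes of such forms, two forms being equivalent if their maximal anisotropic orthogonal summands are isometric, with group law induced by orthogonal sum; $\langle b\rangle$ denotes the class of $b$. There is a unique class in $W_{\tau,\epsilon}(K)$ of maximal anisotropic dimension, denoted $X_{\tau,\epsilon,K}$. For $E,\rho',\lambda$ as in the claim, $\mathrm{Tr}_{\lambda,\epsilon}:W_{\rho',\epsilon}(E)\to W_{\rho,\epsilon}(F)$ is the map $\langle\tilde h\rangle\mapsto\langle\lambda\circ\tilde h\rangle$, where $\lambda\circ\tilde h$ is regarded as a form on the underlying $F$-vector space. *)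

(* Defs.v *)
From HB Require Import structures.
From mathcomp Require Import all_boot all_order all_algebra all_field.
Set Implicit Arguments. Unset Strict Implicit. Unset Printing Implicit Defensive.
Import Order.TTheory GRing.Theory Num.Theory.
Local Open Scope ring_scope.

Section LocalField.
Variable F : fieldType.
Variable v : F -> int.   (* valuation of nonzero elements; value at 0 irrelevant *)

Definition is_discrete_valuation :=
  [/\ (forall x y : F, x != 0 -> y != 0 -> v (x * y) = v x + v y),
      (forall x y : F, x != 0 -> y != 0 -> x + y != 0 ->
         Num.min (v x) (v y) <= v (x + y))
    & (forall z : int, exists x : F, x != 0 /\ v x = z)].

Definition val_ge (N : int) (x : F) : bool := (x == 0) || (N <= v x).

Definition val_cauchy (u : nat -> F) :=
  forall N : int, exists M : nat, forall m k : nat,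
    (M <= m)%N -> (M <= k)%N -> val_ge N (u m - u k).

Definition val_converges (u : nat -> F) (l : F) :=
  forall N : int, exists M : nat, forall m : nat, (M <= m)%N -> val_ge N (u m - l).

Definition val_complete :=
  forall u : nat -> F, val_cauchy u -> exists l : F, val_converges u l.

Definition finite_residue_field :=
  exists r : seq F, all (val_ge 0) r /\
    forall x : F, val_ge 0 x -> exists2 y, y \in r & val_ge 1 (x - y).

Definition odd_residue_char := (2%:R : F) != 0 /\ v 2%:R = 0.
End LocalField.

Definition nonarch_local_field_odd_residue (F : fieldType) :=
  exists v : F -> int, [/\ is_discrete_valuation v, val_complete v,
                           finite_residue_field v & odd_residue_char v].

Section Forms.
Variable K : fieldType.
Variable tau : K -> K.
Variable s : bool.

Definition sgn : K := (-1) ^+ s.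

Definition form_eval n (H : 'M[K]_n) (u w : 'rV[K]_n) : K :=
  (map_mx tau u *m H *m w^T) 0 0.

(* nondegenerate (tau,eps)-hermitian Gram matrix: b(w1,w2) = eps tau(b(w2,w1)) *)
Definition is_herm n (H : 'M[K]_n) : Prop :=
  H = sgn *: (map_mx tau H)^T /\ H \in unitmx.

Definition anisotropic n (H : 'M[K]_n) : Prop :=
  forall u : 'rV[K]_n, form_eval H u u = 0 -> u = 0.

Definition isometric n (H1 H2 : 'M[K]_n) : Prop :=
  exists2 P : 'M[K]_n, P \in unitmx & map_mx tau P *m H1 *m P^T = H2.

Definition hyp_mx k : 'M[K]_(k + k) := block_mx 0 1%:M (sgn *: 1%:M) 0.

(* A is a maximal anisotropic orthogonal summand of H:
   H ~ A _|_ (hyperbolic)  (Witt decomposition) *)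
Definition aniso_kernel n (H : 'M[K]_n) m (A : 'M[K]_m) : Prop :=
  is_herm A /\ anisotropic A /\
  exists k (e : (m + (k + k))%N = n),
    isometric H (castmx (e, e) (block_mx A 0 0 (hyp_mx k))).

Definition witt_equiv n1 n2 (H1 : 'M[K]_n1) (H2 : 'M[K]_n2) : Prop :=
  exists m (A1 A2 : 'M[K]_m),
    [/\ aniso_kernel H1 A1, aniso_kernel H2 A2 & isometric A1 A2].

(* <H> = X_{tau,eps,K}: the class of H has maximal anisotropic dimension
   among all classes in W_{tau,eps}(K) *)
Definition in_X n (H : 'M[K]_n) : Prop :=
  is_herm H /\
  exists m (A : 'M[K]_m), aniso_kernel H A /\
    forall n' (H' : 'M[K]_n'), is_herm H' ->
      forall m' (A' : 'M[K]_m'), aniso_kernel H' A' -> (m' <= m)%N.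
End Forms.

(* Gram matrix of lambda o h in the F-basis (e_i * w_t) of E^n, where
   w = vbasis {:E} is an F-basis of E. *)
Definition trace_form (F : fieldType) (E : fieldExtType F) (rho' : E -> E)
    (lam : E -> F) n (H : 'M[E]_n)
  : 'M[F]_(#|{: 'I_n * 'I_(\dim {:E})}|) :=
  let w := vbasis {:E} in
  \matrix_(k, l)
     lam (rho' (tnth w (enum_val k).2) * H (enum_val k).1 (enum_val l).1
          * tnth w (enum_val l).2).

(* Main.v *)
(** Let K0 be the fixed field of an involution tau of K.  If tau theta = eps theta, then
x |-> theta h(x, x) is a quadratic form over K0, anisotropic exactly when h is.  Over a
local field with odd residue characteristic an anisotropic quadratic form has dimension
at most 4, with equality if it is universal, and a 4-dimensional one is isometric to
<1, -u, pi, -u pi>, where u is a nonsquare unit and pi a uniformizer.  A maximal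
anisotropic h is universal, so with E0 and F0 the fixed fields of rho' and rho and B the
4-dimensional form over E0, everything reduces to showing that the anisotropic kernel of
lam o B over F0 is universal.

Since cB is isometric to B for every c in F0, this holds once the kernel is nonzero, that
is, once lam o B has no Lagrangian.  Scale lam so that it maps O_E0 into O_F0 and p_E0 into
p_F0, but not O_E0 into p_F0.  The dual of the lattice O^4 (with values in p_F0) is then
p^2 x O^2, and a Lagrangian would induce a Lagrangian of mu(x^2 - u y^2) on k^2, where k is
the residue field of E0 and mu is induced by lam.  A form with a Lagrangian takes the
value 0 more often than any other value; mu(x^2 - y^2) has one, but mu(x^2 - u y^2) and
mu(x^2 - y^2) together take all values equally often.

For rho = id and eps = -1 all anisotropic forms over F vanish. *)

Require Import Defs.
From HB Require Import structures.
From mathcomp Require Import all_boot all_order all_algebra all_field.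
From mathcomp Require Import zify ring.
From Stdlib Require Import Classical ClassicalEpsilon.
Set Implicit Arguments. Unset Strict Implicit. Unset Printing Implicit Defensive.
Import Order.TTheory GRing.Theory Num.Theory.
Local Open Scope ring_scope.

(** * Valuations *)

(** The target class is characterised by dimension alone, so the kernel of the trace form is never
    identified: what is bounded is the rank of its totally isotropic subspaces. In that shape the
    bound descends to the fixed fields, where a subspace of rank r over F has rank [cF * r], and it
    tolerates a hyperbolic part in the given form. Dimensions are compared as
    [cF * m' <= 4 <= cF * p], with [cF] the degree of F over its fixed field. The element theta is
    chosen in F, so that it serves rho and rho' at once and can be moved out of lam. The extension
    may be inseparable or wildly ramified, so neither the field trace nor the different can be
    relied on to describe lam. Only the largest fractional ideal that lam sends into the maximal
    ideal enters, and the induced map mu is used solely as a nonzero additive map; this is why the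
    decisive step is a count. The valuations of E and of the fixed fields are constructed from that
    of F, but remain hidden behind an existential, so compatibility along a field inclusion is
    proved for arbitrary choices. *)

Lemma int_min (P : int -> Prop) (C : int) :
  (exists z, P z) -> (forall z, P z -> C <= z) ->
  exists z, P z /\ forall z', P z' -> z <= z'.
Proof.
move=> [z0 Pz0] hC.
have : exists n : nat, P (C + n%:Z).
  by exists `|z0 - C|%N; have := hC _ Pz0 => h; have -> : C + `|z0 - C|%N = z0 by lia.
move=> [n]; elim/ltn_ind: n => n IH Pn.
case: (classic (exists2 m, (m < n)%N & P (C + m%:Z))) => [[m mn Pm]|hno].
  exact: IH Pm.
exists (C + n%:Z); split=> // z' Pz'; rewrite leNgt; apply/negP => lt.
have h := hC _ Pz'; apply: hno; exists `|z' - C|%N; first lia.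
by have -> : C + `|z' - C|%N = z' by lia.
Qed.

(** Surjectivity is dropped: the value of a norm, or the restriction of v to a fixed field, need not
    attain every integer. *)
Definition valuation (K : fieldType) (v : K -> int) :=
  (forall x y : K, x != 0 -> y != 0 -> v (x * y) = v x + v y) /\
  (forall x y : K, x != 0 -> y != 0 -> x + y != 0 ->
     Num.min (v x) (v y) <= v (x + y)).

Section Valuation.
Variables (K : fieldType) (v : K -> int).
Hypothesis hv : valuation v.

Lemma valM x y : x != 0 -> y != 0 -> v (x * y) = v x + v y.
Proof. exact: hv.1. Qed.

Lemma val1 : v 1 = 0.
Proof.
have h : v 1 = v 1 + v 1 by rewrite -valM ?oner_eq0 ?mulr1.
lia.
Qed.

Lemma valV x : x != 0 -> v x^-1 = - v x.
Proof.
move=> x0; have := valM x0 (invr_neq0 x0); rewrite divff // val1; lia.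
Qed.

Lemma valX x n : x != 0 -> v (x ^+ n) = v x * n%:Z.
Proof.
move=> x0; elim: n => [|n IH]; first by rewrite expr0 val1 mulr0.
by rewrite exprS valM ?expf_neq0 // IH; lia.
Qed.

Lemma valXz x z : x != 0 -> v (x ^ z) = v x * z.
Proof.
move=> x0; case: z => n; first by rewrite -exprnP valX.
by rewrite NegzE -exprnN valV ?expf_neq0 // valX //; lia.
Qed.

Lemma valN x : v (- x) = v x.
Proof.
have [->|x0] := eqVneq x 0; first by rewrite oppr0.
have n1 : (-1 : K) != 0 by rewrite oppr_eq0 oner_eq0.
have := valM n1 n1; rewrite mulrNN mulr1 val1 => h.
by rewrite -mulN1r valM //; lia.
Qed.

Lemma val_ge0 N : val_ge v N 0.
Proof. by rewrite /val_ge eqxx. Qed.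

Lemma val_geE N x : x != 0 -> val_ge v N x = (N <= v x).
Proof. by move=> x0; rewrite /val_ge (negbTE x0). Qed.

Lemma val_geW M N x : M <= N -> val_ge v N x -> val_ge v M x.
Proof. rewrite /val_ge => MN /orP[->//|h]; apply/orP; right; lia. Qed.

Lemma val_geN N x : val_ge v N (- x) = val_ge v N x.
Proof. by rewrite /val_ge oppr_eq0 valN. Qed.

Lemma val_geD N x y : val_ge v N x -> val_ge v N y -> val_ge v N (x + y).
Proof.
rewrite /val_ge; have [->|x0] := eqVneq x 0; first by rewrite add0r.
have [->|y0] := eqVneq y 0; first by rewrite addr0 (negbTE x0).
have [//|xy0 /= h1 h2] := eqVneq (x + y) 0.
have := hv.2 _ _ x0 y0 xy0; lia.
Qed.

Lemma val_geB N x y : val_ge v N x -> val_ge v N y -> val_ge v N (x - y).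
Proof. by move=> hx hy; apply: val_geD; rewrite ?val_geN. Qed.

Lemma val_geBC N x y : val_ge v N (x - y) = val_ge v N (y - x).
Proof. by rewrite -val_geN opprB. Qed.

Lemma val_geM M N x y : val_ge v M x -> val_ge v N y -> val_ge v (M + N) (x * y).
Proof.
have [->|x0] := eqVneq x 0; first by rewrite mul0r !val_ge0.
have [->|y0] := eqVneq y 0; first by rewrite mulr0 !val_ge0.
rewrite !val_geE ?mulf_neq0 // valM //; lia.
Qed.

Lemma val_geM0 N x y : val_ge v 0 x -> val_ge v N y -> val_ge v N (x * y).
Proof. by move=> hx hy; rewrite -[N]add0r; apply: val_geM. Qed.

Lemma val_geMV N a x : a != 0 -> val_ge v N (a * x) = val_ge v (N - v a) x.
Proof.
move=> a0; have [->|x0] := eqVneq x 0; first by rewrite mulr0 !val_ge0.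
rewrite !val_geE ?mulf_neq0 // valM //; lia.
Qed.

Lemma val_ge_sum N (I : Type) (r : seq I) (P : pred I) (f : I -> K) :
  (forall i, P i -> val_ge v N (f i)) -> val_ge v N (\sum_(i <- r | P i) f i).
Proof.
move=> h; elim/big_ind: _ => //; [exact: val_ge0 | exact: val_geD].
Qed.

Lemma val_ge_prod (I : finType) (N : int) (f : I -> K) :
  (forall i, val_ge v N (f i)) -> val_ge v (N * #|I|%:Z) (\prod_(i : I) f i).
Proof.
move=> h; rewrite -big_enum cardE; elim: (enum I) => [|a s IH].
  by rewrite big_nil /= mulr0 val_geE ?oner_eq0 // val1.
rewrite big_cons /=; have -> : N * (size s).+1%:Z = N + N * (size s)%:Z by lia.
exact: val_geM.
Qed.

Lemma val_ge1 : val_ge v 0 1.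
Proof. by rewrite val_geE ?oner_eq0 // val1. Qed.

Lemma val_ge_nat n : val_ge v 0 (n%:R : K).
Proof.
elim: n => [|n IH]; first exact: val_ge0.
by rewrite -natr1; apply: val_geD => //; exact: val_ge1.
Qed.

Lemma val_geMn N x n : val_ge v N x -> val_ge v N (x *+ n).
Proof. by move=> h; rewrite -mulr_natl; apply: val_geM0 => //; apply: val_ge_nat. Qed.

Lemma val_geX x n : val_ge v 0 x -> val_ge v 0 (x ^+ n).
Proof.
move=> h; elim: n => [|n IH]; first by rewrite expr0 val_ge1.
by rewrite exprS; apply: val_geM0.
Qed.

Lemma val_ge_eq0 x : (forall N, val_ge v N x) -> x = 0.
Proof.
move=> h; have := h (v x + 1); rewrite /val_ge => /orP[/eqP//|]; lia.
Qed.

Lemma val_addl x y : x != 0 -> val_ge v (v x + 1) y -> x + y != 0 /\ v (x + y) = v x.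
Proof.
move=> x0 hy; have xy0 : x + y != 0.
  apply/negP => /eqP /(congr1 (fun z => z - y)); rewrite addrK sub0r => xE.
  by move: hy; rewrite -val_geN -xE val_geE //; lia.
split=> //; have h1 : val_ge v (v x) (x + y).
  by apply: val_geD; [rewrite val_geE | apply: val_geW hy; lia].
have h2 : ~~ val_ge v (v x + 1) (x + y).
  apply/negP => h3; have := val_geB h3 hy; rewrite addrK val_geE //; lia.
move: h1 h2; rewrite !val_geE //; lia.
Qed.



End Valuation.

Lemma discrete_valuation (K : fieldType) (v : K -> int) :
  is_discrete_valuation v -> valuation v.
Proof. by case. Qed.

(** * Square roots of 1-units *)

Section Hensel.
Variables (K : fieldType) (v : K -> int).
Hypothesis hd : is_discrete_valuation v.
Hypothesis hc : val_complete v.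
Hypothesis h2 : odd_residue_char v.
Let hv := discrete_valuation hd.

Lemma val_ge_half N x : val_ge v N (x / 2%:R) = val_ge v N x.
Proof.
have [n2 v2] := h2; rewrite mulrC (val_geMV hv) ?invr_eq0 // (valV hv) // v2.
by rewrite oppr0 subr0.
Qed.

Let newton (x y : K) := y + (x - y ^+ 2) / 2%:R.

(* Newton's method with the fixed slope 2 = f'(1). *)
Lemma sqrt_one_unit x : val_ge v 1 (x - 1) ->
  exists y, y ^+ 2 = x /\ val_ge v 1 (y - 1).
Proof.
move=> hx; have [n2 v2] := h2.
pose u n := iter n (newton x) 1.
have hu n : val_ge v (n%:Z + 1) (x - u n ^+ 2) /\ val_ge v 1 (u n - 1).
  elim: n => [|n [IH1 IH2]].
    by rewrite /u /= expr1n subrr val_ge0.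
  have -> : u n.+1 = newton x (u n) by [].
  set y := u n in IH1 IH2 *; rewrite /newton.
  set ep := x - y ^+ 2 in IH1 *.
  have IH1' : val_ge v (n%:Z + 1) (ep / 2%:R) by rewrite val_ge_half.
  split.
    (* With the slope frozen the new error has a term linear in the old one, but its coefficient
       [y - 1] lies in p: each step gains one power. *)
    have -> : x - (y + ep / 2%:R) ^+ 2 = - (y - 1) * ep - (ep / 2%:R) * (ep / 2%:R).
      by rewrite /ep; field.
    apply: (val_geB hv).
      have -> : n.+1%:Z + 1 = 1 + (n%:Z + 1) by lia.
      by apply: (val_geM hv) => //; rewrite (val_geN hv).
    apply: (@val_geW _ _ _ ((n%:Z+1) + (n%:Z+1))); first lia.
    exact: (val_geM hv).
  have -> : y + ep / 2%:R - 1 = (y - 1) + ep / 2%:R by ring.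
  by apply: (val_geD hv) => //; apply: val_geW IH1'; lia.
have step n : val_ge v (n%:Z + 1) (u n.+1 - u n).
  have -> : u n.+1 - u n = (x - u n ^+ 2) / 2%:R by rewrite /u /= /newton; ring.
  by rewrite val_ge_half; have [] := hu n.
have far n k : val_ge v (n%:Z + 1) (u (n + k)%N - u n).
  elim: k => [|k IH]; first by rewrite addn0 subrr val_ge0.
  have -> : u (n + k.+1)%N - u n = (u (n + k).+1 - u (n + k)%N) + (u (n + k)%N - u n).
    by rewrite addnS; ring.
  by apply: (val_geD hv) => //; apply: val_geW (step _); lia.
have [l hl] : exists l, val_converges v u l.
  apply: hc => N; exists `|N|%N => m k hm hk.
  have -> : u m - u k = (u m - u `|N|%N) - (u k - u `|N|%N) by ring.
  have far' i : (`|N| <= i)%N -> val_ge v N (u i - u `|N|%N).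
    move=> hi; apply: (@val_geW _ _ _ (`|N|%N%:Z + 1)); first lia.
    by have := far `|N|%N (i - `|N|)%N; rewrite subnKC.
  by apply: (val_geB hv); apply: far'.
have hl1 : val_ge v 1 (l - 1).
  have [M /(_ _ (leqnn _)) hM] := hl 1.
  have -> : l - 1 = (u M - 1) - (u M - l) by ring.
  by apply: (val_geB hv) => //; case: (hu M).
exists l; split=> //; apply/eqP; rewrite eq_sym -subr_eq0; apply/eqP; apply: (@val_ge_eq0 _ v) => N.
have [M hM] := hl N.
pose m := maxn M `|N|%N.
have -> : x - l ^+ 2 = (x - u m ^+ 2) + (u m - l) * ((u m - 1) + (l - 1) + 2%:R) by ring.
apply: (val_geD hv); first by apply: val_geW (hu m).1; rewrite /m; lia.
rewrite mulrC; apply: (val_geM0 hv); last by apply: hM; rewrite /m; lia.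
apply: (val_geD hv); last exact: val_ge_nat.
by apply: (@val_geW _ _ _ 1) => //; apply: (val_geD hv) => //; case: (hu m).
Qed.

End Hensel.

(** * The residue field *)

(** Reduction is a total function constrained only on integral elements. The residue field enters
    later arguments only through these five clauses. *)
Definition residue_map (K : fieldType) (v : K -> int) (k : finFieldType) (red : K -> k) :=
  [/\ red 1 = 1,
      forall x y, val_ge v 0 x -> val_ge v 0 y -> red (x + y) = red x + red y,
      forall x y, val_ge v 0 x -> val_ge v 0 y -> red (x * y) = red x * red y,
      forall x, val_ge v 0 x -> (red x == 0) = val_ge v 1 x
    & forall a, exists x, val_ge v 0 x /\ red x = a].

Section ResidueField.
Variables (K : fieldType) (v : K -> int) (r : seq K).
Hypothesis hv : valuation v.
Hypothesis r_int : all (val_ge v 0) r.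
Hypothesis r_cover : forall x, val_ge v 0 x -> exists2 y, y \in r & val_ge v 1 (x - y).

(** The first entry of [r] congruent to x modulo p; by [canon_eq] this choice depends only on the
    class of x. *)
Definition canon x := nth 0 r (find (fun y => val_ge v 1 (x - y)) r).

Lemma has_canon x : val_ge v 0 x -> has (fun y => val_ge v 1 (x - y)) r.
Proof. by move=> /r_cover[y yr h]; apply/hasP; exists y. Qed.

Lemma canon_mem x : val_ge v 0 x -> canon x \in r.
Proof. by move=> /has_canon; rewrite has_find => h; apply: mem_nth. Qed.

Lemma canon_close x : val_ge v 0 x -> val_ge v 1 (x - canon x).
Proof. by move=> /has_canon h; apply: (nth_find 0 h). Qed.

Lemma canon_eq x y : val_ge v 1 (x - y) -> canon x = canon y.
Proof.
move=> h; rewrite /canon; congr nth; apply: eq_find => z /=.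
apply/idP/idP => h'.
  have -> : y - z = (x - z) - (x - y) by ring.
  exact: (val_geB hv).
have -> : x - z = (x - y) + (y - z) by ring.
exact: (val_geD hv).
Qed.


Lemma canonK x : val_ge v 0 x -> canon (canon x) = canon x.
Proof.
by move=> hx; apply: canon_eq; rewrite (val_geBC hv); apply: canon_close.
Qed.

(** [r] may contain several representatives of one class. The fixed points of [canon] contain
    exactly one for each, so equality in this type is congruence modulo p. *)
Definition resf := seq_sub [seq y <- r | canon y == y].

HB.instance Definition _ := Finite.on resf.

Lemma canon_reps x : val_ge v 0 x -> canon x \in [seq y <- r | canon y == y].
Proof. by move=> hx; rewrite mem_filter canonK // eqxx canon_mem. Qed.

Definition red (x : K) : resf := insubd (SeqSub (canon_reps (val_ge0 v 0))) (canon x).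

Lemma val_red x : val_ge v 0 x -> val (red x) = canon x.
Proof. by move=> hx; rewrite insubdK // canon_reps. Qed.

Lemma resf_int (a : resf) : val_ge v 0 (val a).
Proof.
by have := valP a; rewrite mem_filter => /andP[_ h]; apply: (allP r_int).
Qed.

Lemma valK' (a : resf) : red (val a) = a.
Proof.
apply: val_inj; rewrite val_red ?resf_int //.
by have := valP a; rewrite mem_filter => /andP[/eqP].
Qed.

Lemma red_eq x y : val_ge v 0 x -> val_ge v 0 y -> red x = red y <-> val_ge v 1 (x - y).
Proof.
move=> hx hy; split=> [/(congr1 val)|h].
  rewrite !val_red // => h.
  have -> : x - y = (x - canon x) - (y - canon y) by rewrite h; ring.
  by apply: (val_geB hv); apply: canon_close.
by apply: val_inj; rewrite !val_red //; apply: canon_eq.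
Qed.

Lemma red_close x : val_ge v 0 x -> val_ge v 1 (val (red x) - x).
Proof. by move=> hx; rewrite val_red // (val_geBC hv); apply: canon_close. Qed.

Definition radd (a b : resf) := red (val a + val b).
Definition ropp (a : resf) := red (- val a).
Definition rmul (a b : resf) := red (val a * val b).
Definition rinv (a : resf) := if a == red 0 then red 0 else red (val a)^-1.

Lemma redD x y : val_ge v 0 x -> val_ge v 0 y -> red (x + y) = radd (red x) (red y).
Proof.
move=> hx hy; apply/red_eq; [exact: (val_geD hv) | by apply: (val_geD hv); apply: resf_int |].
have -> : x + y - (val (red x) + val (red y)) = - (val (red x) - x) - (val (red y) - y).
  by ring.
by apply: (val_geB hv); rewrite ?(val_geN hv) ?red_close.
Qed.

Lemma redN x : val_ge v 0 x -> red (- x) = ropp (red x).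
Proof.
move=> hx; apply/red_eq; rewrite ?(val_geN hv) ?resf_int //.
have -> : - x - - val (red x) = val (red x) - x by ring.
by rewrite red_close.
Qed.

Lemma redM x y : val_ge v 0 x -> val_ge v 0 y -> red (x * y) = rmul (red x) (red y).
Proof.
move=> hx hy; apply/red_eq; [exact: (val_geM0 hv) | by apply: (val_geM0 hv); apply: resf_int |].
have -> : x * y - val (red x) * val (red y) =
  - (x * (val (red y) - y) + val (red y) * (val (red x) - x)) by ring.
rewrite (val_geN hv).
by apply: (val_geD hv); apply: (val_geM0 hv); rewrite ?red_close ?resf_int.
Qed.

Lemma raddA : associative radd.
Proof.
move=> a b c; rewrite -[a]valK' -[b]valK' -[c]valK' -!redD ?(val_geD hv) ?resf_int //.
by rewrite addrA.
Qed.
Lemma raddC : commutative radd.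
Proof. by move=> a b; rewrite /radd addrC. Qed.
Lemma radd0 : left_id (red 0) radd.
Proof. by move=> a; rewrite -[a]valK' -redD ?resf_int ?val_ge0 ?add0r. Qed.
Lemma raddN : left_inverse (red 0) ropp radd.
Proof.
by move=> a; rewrite -[a]valK' -redN -?redD ?(val_geN hv) ?resf_int ?addNr.
Qed.
Lemma rmulA : associative rmul.
Proof.
move=> a b c; rewrite -[a]valK' -[b]valK' -[c]valK' -!redM ?(val_geM0 hv) ?resf_int //.
by rewrite mulrA.
Qed.
Lemma rmulC : commutative rmul.
Proof. by move=> a b; rewrite /rmul mulrC. Qed.
Lemma rmul1 : left_id (red 1) rmul.
Proof. by move=> a; rewrite -[a]valK' -redM ?resf_int ?(val_ge1 hv) ?mul1r. Qed.
Lemma rmulDl : left_distributive rmul radd.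
Proof.
move=> a b c; rewrite -[a]valK' -[b]valK' -[c]valK'.
by rewrite -redD -?redM -?redD ?(val_geD hv) ?(val_geM0 hv) ?resf_int // mulrDl.
Qed.
Lemma rone_neq0 : red 1 != red 0.
Proof.
apply/eqP => /red_eq; rewrite subr0 val_ge0 (val_ge1 hv) => /(_ isT isT).
by rewrite val_geE ?oner_eq0 // (val1 hv).
Qed.

HB.instance Definition _ := GRing.isZmodule.Build resf raddA raddC radd0 raddN.
HB.instance Definition _ :=
  GRing.Zmodule_isComNzRing.Build resf rmulA rmulC rmul1 rmulDl rone_neq0.

Lemma rmulVf (a : resf) : a != 0 -> rinv a * a = 1.
Proof.
move=> a0; rewrite /rinv; have -> : (a == red 0) = false by exact: negbTE.
have va : val a != 0 /\ v (val a) = 0.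
  have h : ~~ val_ge v 1 (val a).
    apply: contra a0 => h; apply/eqP; rewrite -[a]valK'; apply/red_eq; rewrite ?subr0 ?resf_int ?val_ge0 //.
  have n0 : val a != 0 by apply: contra h => /eqP ->; rewrite val_ge0.
  split=> //; have := resf_int a; move: h; rewrite !val_geE //; lia.
have vi : val_ge v 0 (val a)^-1 by rewrite val_geE ?invr_eq0 ?va.1 // (valV hv) ?va.1 // va.2.
change (rmul (red (val a)^-1) a = red 1).
by rewrite -[X in rmul _ X]valK' -redM ?resf_int // mulVf ?va.1.
Qed.

Lemma rinv0 : rinv 0 = 0.
Proof. by rewrite /rinv eqxx. Qed.

HB.instance Definition _ := GRing.ComNzRing_isField.Build resf rmulVf rinv0.

Lemma residue_map_red : residue_map v (red : K -> (resf : finFieldType)).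
Proof.
split=> //.
- exact: redD.
- exact: redM.
- move=> x hx; apply/eqP/idP => [|h].
    by move/(@red_eq _ _ hx (val_ge0 v 0)); rewrite subr0.
  by apply/(@red_eq _ _ hx (val_ge0 v 0)); rewrite subr0.
- by move=> a; exists (val a); rewrite resf_int valK'.
Qed.

End ResidueField.

Lemma residue_map_exists (K : fieldType) (v : K -> int) :
  valuation v -> finite_residue_field v ->
  exists (k : finFieldType) (red : K -> k), residue_map v red.
Proof.
move=> hv [r [h1 h2]].
exact: (ex_intro _ _ (ex_intro _ _ (residue_map_red hv h1 h2))).
Qed.

Section ResidueMap.
Variables (K : fieldType) (v : K -> int) (k : finFieldType) (red : K -> k).
Hypothesis hv : valuation v.
Hypothesis hr : residue_map v red.

Lemma res1 : red 1 = 1. Proof. by case: hr. Qed.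
Lemma resD x y : val_ge v 0 x -> val_ge v 0 y -> red (x + y) = red x + red y.
Proof. by case: hr => _ h _ _ _; apply: h. Qed.
Lemma resM x y : val_ge v 0 x -> val_ge v 0 y -> red (x * y) = red x * red y.
Proof. by case: hr => _ _ h _ _; apply: h. Qed.
Lemma res_eq0 x : val_ge v 0 x -> (red x == 0) = val_ge v 1 x.
Proof. by case: hr => _ _ _ h _; apply: h. Qed.
Lemma res_surj a : exists x, val_ge v 0 x /\ red x = a.
Proof. by case: hr. Qed.
Lemma res0 : red 0 = 0.
Proof. by apply/eqP; rewrite res_eq0 val_ge0. Qed.
Lemma resN x : val_ge v 0 x -> red (- x) = - red x.
Proof.
move=> hx; apply/eqP; rewrite -addr_eq0 -resD ?(val_geN hv) // addNr.
by rewrite res0.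
Qed.
Lemma resB x y : val_ge v 0 x -> val_ge v 0 y -> red (x - y) = red x - red y.
Proof. by move=> hx hy; rewrite resD ?(val_geN hv) // resN. Qed.
Lemma res_eq x y : val_ge v 0 x -> val_ge v 0 y -> (red x == red y) = val_ge v 1 (x - y).
Proof. by move=> hx hy; rewrite -res_eq0 ?(val_geB hv) // resB // subr_eq0. Qed.
Lemma resX x n : val_ge v 0 x -> red (x ^+ n) = red x ^+ n.
Proof.
move=> hx; elim: n => [|n IH]; first by rewrite !expr0 res1.
by rewrite !exprS resM ?(val_geX hv) // IH.
Qed.
Lemma res_unit x : val_ge v 0 x -> red x != 0 -> x != 0 /\ v x = 0.
Proof.
move=> hx; rewrite res_eq0 // => h.
have x0 : x != 0 by apply: contra h => /eqP ->; rewrite val_ge0.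
by split=> //; move: hx h; rewrite !val_geE //; lia.
Qed.
Lemma unit_res x : x != 0 -> v x = 0 -> val_ge v 0 x /\ red x != 0.
Proof.
move=> x0 vx; have hx : val_ge v 0 x by rewrite val_geE ?vx.
by split; rewrite ?res_eq0 // val_geE ?vx.
Qed.
End ResidueMap.

(** * Compactness of the valuation ring *)

Section Compactness.
Variables (K : fieldType) (v : K -> int).
Hypothesis hd : is_discrete_valuation v.
Let hv := discrete_valuation hd.

Lemma uniformizer_exists : exists pi : K, pi != 0 /\ v pi = 1.
Proof. by case: hd => _ _; apply. Qed.

Definition vecge N M (x : 'rV[K]_N) := forall j, val_ge v M (x 0 j).

Lemma vecgeW N M M' (x : 'rV[K]_N) : M <= M' -> vecge M' x -> vecge M x.
Proof. by move=> h hx j; apply: val_geW h (hx j). Qed.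

Lemma vecgeD N M (x y : 'rV[K]_N) : vecge M x -> vecge M y -> vecge M (x + y).
Proof. by move=> hx hy j; rewrite mxE; apply: (val_geD hv). Qed.

Lemma vecgeN N M (x : 'rV[K]_N) : vecge M x -> vecge M (- x).
Proof. by move=> hx j; rewrite mxE (val_geN hv). Qed.


Lemma vecgeZ0 N M a (x : 'rV[K]_N) : val_ge v 0 a -> vecge M x -> vecge M (a *: x).
Proof. by move=> ha hx j; rewrite mxE; apply: (val_geM0 hv). Qed.

Lemma vecgeZV N M a (x : 'rV[K]_N) : a != 0 -> vecge M (a *: x) <-> vecge (M - v a) x.
Proof. by move=> a0; split=> h j; have := h j; rewrite mxE (val_geMV hv). Qed.

Lemma vecge_sum N M (I : finType) (f : I -> 'rV[K]_N) :
  (forall i, vecge M (f i)) -> vecge M (\sum_i f i).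
Proof. by move=> h j; rewrite summxE; apply: (val_ge_sum hv) => i _; apply: h. Qed.

Lemma vecge0 N M : vecge M (0 : 'rV[K]_N).
Proof. by move=> j; rewrite mxE val_ge0. Qed.

Lemma vecge_eq0 N (x : 'rV[K]_N) : (forall M, vecge M x) -> x = 0.
Proof. by move=> h; apply/rowP => j; rewrite mxE; apply: (@val_ge_eq0 _ v) => M; apply: h. Qed.

Lemma entries_bound (I : finType) (f : I -> K) : exists C : int, 0 <= C /\ forall i, val_ge v (- C) (f i).
Proof.
exists (\sum_i `|v (f i)|); split=> [|i]; first by apply: sumr_ge0.
rewrite (bigD1 i) //= /val_ge; apply/orP; right.
have : 0 <= \sum_(j | j != i) `|v (f j)| by apply: sumr_ge0.
have : - v (f i) <= `|v (f i)| by rewrite lerNl lerNnormlW.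
move: (\sum_(_ | _) _) (v (f i)); lia.
Qed.

Lemma vecge_lower N (x : 'rV[K]_N) : exists C : int, vecge (- C) x.
Proof. by have [C [_ h]] := entries_bound (fun j => x 0 j); exists C. Qed.

Lemma vecge_mulmx m n (A : 'M[K]_(m, n)) :
  exists C : int, 0 <= C /\ forall M x, vecge M x -> vecge (M - C) (x *m A).
Proof.
have [C [C0 h]] := entries_bound (fun ij : 'I_m * 'I_n => A ij.1 ij.2).
exists C; split=> // M x hx j; rewrite mxE; apply: (val_ge_sum hv) => i _.
by apply: (val_geM hv) => //; apply: (h (i, j)).
Qed.

Definition primitive N (x : 'rV[K]_N) := vecge 0 x /\ ~ vecge 1 x.

Lemma primitive_scale N (x : 'rV[K]_N) (pi : K) : pi != 0 -> v pi = 1 -> x != 0 ->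
  exists t : int, primitive (pi ^ t *: x).
Proof.
move=> pi0 vpi x0.
have [C hC] := vecge_lower x.
have [] := @int_min (fun M => ~ vecge M x) (- C).
- apply: not_all_ex_not => h; move/eqP: x0; apply; exact: vecge_eq0.
- by move=> z nz; rewrite leNgt; apply/negP => zC; apply: nz; apply: vecgeW hC; lia.
(* [M] is the first level that x misses; the exponent [1 - M] moves this level to 1. *)
move=> M [nM hM]; exists (1 - M); split.
- apply/vecgeZV; first by rewrite expfz_neq0.
  rewrite (valXz hv) // vpi; apply: NNPP => h; have := hM _ h; lia.
- move/vecgeZV; rewrite expfz_neq0 // (valXz hv) // vpi => /(_ isT) h; apply: nM.
  by apply: vecgeW h; lia.
Qed.

Hypothesis hc : val_complete v.
Variables (k : finFieldType) (red : K -> k).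
Hypothesis hr : residue_map v red.

Lemma inf_pigeonhole (T : finType) (Q : T -> nat -> Prop) :
  (forall k0, exists n, (k0 <= n)%N /\ exists y, Q y n) ->
  exists y, forall k0, exists n, (k0 <= n)%N /\ Q y n.
Proof.
move=> h; apply: NNPP => /not_ex_all_not hno.
have /fin_all_exists[f hf] : forall y, exists k0, forall n, (k0 <= n)%N -> ~ Q y n.
  move=> y; have /not_all_ex_not[k0 hk] := hno y; exists k0 => n kn qn.
  by apply: hk; exists n.
have [n [hn [y qy]]] := h (\max_y f y); apply: (hf y n) qy.
by apply: leq_trans hn; apply: leq_bigmax.
Qed.

(** Bolzano-Weierstrass for O^N: a ball visited infinitely often is a union of finitely many smaller
    balls, one of which is again visited infinitely often, and the nested centres converge by
    completeness. *)
Lemma cluster_point N (u : nat -> 'rV[K]_N) : (forall n, vecge 0 (u n)) ->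
  exists l, forall M k0, exists n, (k0 <= n)%N /\ vecge M (u n - l).
Proof.
move=> hu; have [pi [pi0 vpi]] := uniformizer_exists.
pose P (m : nat) l := forall k0, exists n, (k0 <= n)%N /\ vecge m%:Z (u n - l).
have step m l : P m l -> exists l', P m.+1 l' /\ vecge m%:Z (l' - l).
  move=> hP.
  have [|y hy] := @inf_pigeonhole _ (fun (y : 'rV[k]_N) n => vecge m%:Z (u n - l) /\
       map_mx red (pi ^- m *: (u n - l)) = y).
    move=> k0; have [n [kn hn]] := hP k0; exists n; split=> //.
    by exists (map_mx red (pi ^- m *: (u n - l))).
  have /fin_all_exists[f hf] := fun j => res_surj hr (y 0 j).
  pose z := \row_j f j; exists (l + pi ^+ m *: z); split.
    move=> k0; have [n [kn [hn hy']]] := hy k0; exists n; split=> //.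
    have -> : u n - (l + pi ^+ m *: z) = pi ^+ m *: (pi ^- m *: (u n - l) - z).
      rewrite scalerBr scalerA mulfV ?expf_neq0 // scale1r opprD addrA //.
    apply/vecgeZV; rewrite ?expf_neq0 // (valX hv) // vpi => j.
    have -> : m.+1%:Z - 1 * m%:Z = 1 by lia.
    have hi : val_ge v 0 ((pi ^- m *: (u n - l)) 0 j).
      rewrite mxE (val_geMV hv) ?invr_eq0 ?expf_neq0 // (valV hv) ?expf_neq0 // (valX hv) // vpi.
      by have := hn j; apply: val_geW; lia.
    have [fi fe] := hf j.
    rewrite [X in val_ge v _ X]mxE [X in val_ge v _ (_ + X)]mxE -(res_eq hv hr) //; last by rewrite mxE.
    by apply/eqP; move/rowP/(_ j): hy'; rewrite !mxE fe.
  rewrite addrC addKr; apply/vecgeZV; rewrite ?expf_neq0 // (valX hv) // vpi => j.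
  by rewrite mxE; apply: val_geW (hf j).1; lia.
have P0 : P 0%N 0.
  by move=> k0; exists k0; split=> //; rewrite subr0.
(* Dependent choice of nested balls: each centre carries the proof that its ball is visited
   infinitely often. *)
pose next m (s : {l | P m l}) : {l' | P m.+1 l' /\ vecge m%:Z (l' - sval s)} :=
  constructive_indefinite_description _ (step m (sval s) (svalP s)).
pose fix ls m : {l | P m l} := match m with
  | 0%N => exist _ 0 P0
  | m'.+1 => exist _ (sval (next m' (ls m'))) (svalP (next m' (ls m'))).1 end.
pose L m := sval (ls m).
have hstep m : vecge m%:Z (L m.+1 - L m) by exact: (svalP (next m (ls m))).2.
have far m n : vecge m%:Z (L (m + n)%N - L m).
  elim: n => [|n IH]; first by rewrite addn0 subrr; apply: vecge0.
  have -> : L (m + n.+1)%N - L m = (L (m + n).+1 - L (m + n)%N) + (L (m + n)%N - L m).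
    by rewrite addnS addrA subrK.
  by apply: vecgeD => //; apply: vecgeW (hstep _); lia.
have /fin_all_exists[l hl] : forall j : 'I_N, exists lj, val_converges v (fun m => L m 0 j) lj.
  move=> j; apply: hc => M; exists `|M|%N => m m' hm hm'.
  have far' i : (`|M| <= i)%N -> val_ge v M (L i 0 j - L `|M|%N 0 j).
    move=> hi; apply: (@val_geW _ _ _ (`|M|%N%:Z)); first lia.
    by have := far `|M|%N (i - `|M|)%N j; rewrite subnKC // !mxE.
  have -> : L m 0 j - L m' 0 j = (L m 0 j - L `|M|%N 0 j) - (L m' 0 j - L `|M|%N 0 j) by ring.
  by apply: (val_geB hv); apply: far'.
exists (\row_j l j) => M k0.
have /fin_all_exists[g hg] := fun j => hl j M.
pose m := maxn `|M| (\max_j g j).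
have [n [kn hn]] := svalP (ls m) k0; exists n; split=> // j.
have -> : (u n - \row_j l j) 0 j = (u n - L m) 0 j + (L m 0 j - l j) by rewrite !mxE; ring.
apply: (val_geD hv); first by apply: val_geW (hn j); rewrite /m; lia.
by apply: hg; apply: leq_trans (leq_maxr _ _); apply: leq_bigmax.
Qed.

Lemma primitive_cluster N (u : nat -> 'rV[K]_N) l :
  (forall n, primitive (u n)) -> (exists n, vecge 1 (u n - l)) -> l != 0.
Proof.
move=> hu [n hn]; apply/eqP => l0; apply: (hu n).2.
by move: hn; rewrite l0 subr0.
Qed.

End Compactness.

(* 1 + p is 2-divisible, hence killed by every homomorphism to the integers. *)
Lemma val_hom (K K' : fieldType) (v : K -> int) (v' : K' -> int) (phi : {rmorphism K -> K'}) :
  is_discrete_valuation v -> val_complete v -> finite_residue_field v -> odd_residue_char v ->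
  is_discrete_valuation v' -> finite_residue_field v' ->
  exists e : int, 0 < e /\ forall x, x != 0 -> v' (phi x) = e * v x.
Proof.
move=> hd hc hf h2 hd' hf'.
have hv := discrete_valuation hd; have hv' := discrete_valuation hd'.
have [k [red hr]] := residue_map_exists hv hf.
have [k' [red' hr']] := residue_map_exists hv' hf'.
have p0 x : x != 0 -> phi x != 0 by rewrite fmorph_eq0.
have one_neq0 x : val_ge v 1 (x - 1) -> x != 0.
  by apply: contraTneq => ->; rewrite sub0r (val_geN hv) val_geE ?oner_eq0 // (val1 hv).
have unit1 x : val_ge v 1 (x - 1) -> v' (phi x) = 0.
  move=> hx.
  have div2 n : forall x, val_ge v 1 (x - 1) -> exists z : int, v' (phi x) = 2%:Z ^+ n * z.
    elim: n => [|n IH] y hy; first by exists (v' (phi y)); rewrite expr0 mul1r.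
    have [z [<- hz]] := sqrt_one_unit hd hc h2 hy.
    have [w hw] := IH z hz; exists w.
    by rewrite rmorphXn (valX hv') ?p0 ?one_neq0 // hw exprS; ring.
  have [z hz] := div2 `|v' (phi x)|%N x hx.
  have h : (`|v' (phi x)| = 2 ^ `|v' (phi x)| * `|z|)%N by rewrite {1}hz abszM abszX.
  have := ltn_expl `|v' (phi x)|%N (isT : (1 < 2)%N).
  case: (posnP `|z|%N) => [z0|zp]; last by move: h; nia.
  lia.
have unit x : x != 0 -> v x = 0 -> v' (phi x) = 0.
  move=> x0 vx; have [xi rx] := unit_res hr x0 vx.
  (* With q the order of the residue field, the power [x ^ (q - 1)] of a unit has residue 1, so it
     is a 1-unit. *)
  have : v' (phi (x ^+ #|k| / x)) = 0.
    apply: unit1; have -> : x ^+ #|k| / x - 1 = (x ^+ #|k| - x) / x by field.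
    rewrite mulrC (val_geMV hv) ?invr_eq0 // (valV hv) // vx oppr0 subr0.
    by rewrite -(res_eq hv hr) ?(val_geX hv) // (resX hv hr) // expf_card.
  rewrite rmorphM /= rmorphXn fmorphV (valM hv') ?expf_neq0 ?invr_eq0 ?p0 //.
  rewrite (valV hv') ?p0 // (valX hv') ?p0 //.
  move=> h; have : v' (phi x) * (#|k|%:Z - 1) = 0 by rewrite mulrBr mulr1.
  by move/eqP; rewrite mulf_eq0 subr_eq0 => /orP[/eqP//|/eqP[q1]]; have := finNzRing_gt1 k; rewrite q1.
have [pi [pi0 vpi]] := uniformizer_exists hd.
pose e := v' (phi pi).
have hE x : x != 0 -> v' (phi x) = e * v x.
  move=> x0; have n0 : pi ^ (v x) != 0 by rewrite expfz_neq0.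
  have : v' (phi (x / pi ^ (v x))) = 0.
    apply: unit; first by rewrite mulf_neq0 ?invr_eq0.
    rewrite (valM hv) ?invr_eq0 // (valV hv) // (valXz hv) // vpi; lia.
  rewrite rmorphM /= fmorphV (valM hv') ?invr_eq0 ?p0 // (valV hv') ?p0 //.
  rewrite fmorphXz (valXz hv') ?p0 // -/e; lia.
exists e; split=> //; rewrite ltNge; apply/negP => ele.
(* If [e = 0], all nonzero elements of the image are units, so distinct powers of pi would have
   distinct residues in a finite field. *)
have [e0|en] : e = 0 \/ e < 0 by lia.
  pose f (i : 'I_(#|k'|.+1)) := red' (phi (pi ^+ i)).
  have finj : injective f.
    move=> i j; apply: contra_eq => ij; rewrite /f.
    have v0 x : x != 0 -> v' (phi x) = 0 by move=> /hE ->; rewrite e0 mul0r.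
    have vi x : x != 0 -> val_ge v' 0 (phi x) by move=> x0; rewrite val_geE ?p0 // v0.
    rewrite (res_eq hv' hr') ?vi ?expf_neq0 // -rmorphB.
    have dij : pi ^+ i - pi ^+ j != 0.
      rewrite subr_eq0; apply: contra ij => /eqP /(congr1 v).
      by rewrite !(valX hv) // vpi !mul1r => -[h]; apply/eqP/val_inj.
    by rewrite val_geE ?p0 // v0.
  by have := leq_card f finj; rewrite card_ord ltnn.
(* If [e < 0], then [phi pi] dominates 1, so [phi (pi + 1)] has negative value although [pi + 1] is
   a unit. *)
have [n0 v1] : pi + 1 != 0 /\ v (pi + 1) = 0.
  rewrite addrC -(val1 hv); apply: (val_addl hv); first exact: oner_neq0.
  by rewrite (val1 hv) val_geE ?vpi.
have p1 : v' (phi (pi + 1)) = 0 by rewrite hE // v1 mulr0.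
have [] := @val_addl _ _ hv' (phi pi) 1 (p0 _ pi0).
  by rewrite val_geE ?oner_eq0 // (val1 hv') -/e; lia.
move=> _; rewrite -[X in phi pi + X](rmorph1 phi) -rmorphD p1 -/e; lia.
Qed.

(** * Finite extensions and fixed fields of local fields *)

(** The least positive value [g] generates the value group. Dividing by it makes w surjective and
    only relabels the levels, so completeness and the residue field persist. *)
Lemma local_of_valuation (K : fieldType) (w : K -> int) :
  valuation w -> (exists x, x != 0 /\ w x != 0) -> val_complete w ->
  finite_residue_field w -> odd_residue_char w -> nonarch_local_field_odd_residue K.
Proof.
move=> hw [x0 [x00 wx0]] hc [r [hr1 hr2]] [n2 w2].
have [||g [[g0 [x1 [x10 wx1]]] hg]] := @int_min (fun z => 0 < z /\ exists x, x != 0 /\ w x = z) 0.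
- have [h|h] : 0 < w x0 \/ 0 < - w x0 by lia.
    by exists (w x0); split=> //; exists x0.
  by exists (- w x0); split=> //; exists x0^-1; rewrite invr_eq0 (valV hw).
- by move=> z [h _]; apply: ltW.
have wE x : x != 0 -> w x = (w x %/ g)%Z * g.
  move=> xn0; rewrite {1}(divz_eq (w x) g).
  have h1 := modz_ge0 (w x) (lt0r_neq0 g0); have h2 := ltz_pmod (w x) g0.
  suff -> : (w x %% g)%Z = 0 by rewrite addr0.
  case: (ltgtP 0 (w x %% g)%Z) => [h|h|//]; last by lia.
  (* The remainder is itself a value, attained at x divided by a power of [x1]; were it positive, it
     would undercut [g]. *)
  suff : g <= (w x %% g)%Z by lia.
  apply: hg; split=> //; exists (x / x1 ^ (w x %/ g)%Z).
  rewrite mulf_neq0 ?invr_eq0 ?expfz_neq0 // (valM hw) ?invr_eq0 ?expfz_neq0 //.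
  rewrite (valV hw) ?expfz_neq0 // (valXz hw) // wx1; split=> //.
  have := divz_eq (w x) g; move: (w x) (w x %/ g)%Z (w x %% g)%Z => a b c; lia.
pose v x := (w x %/ g)%Z.
have wv x : x != 0 -> w x = v x * g by apply: wE.
have geE N x : val_ge v N x = val_ge w (N * g) x.
  by rewrite /val_ge; case: eqVneq => //= xn0; rewrite wv // ler_pM2r.
have hd : is_discrete_valuation v.
  split=> [x y xn yn|x y xn yn xyn|z].
  - apply: (@mulIf _ g); first exact: lt0r_neq0.
    by rewrite -wv ?mulf_neq0 // (valM hw) // !wv // mulrDl.
  - rewrite -(ler_pM2r g0) -wv //; have := hw.2 _ _ xn yn xyn; rewrite !wv //.
    by case: (leP (v x) (v y)) => h; nia.
  exists (x1 ^ z); split; first by rewrite expfz_neq0.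
  apply: (@mulIf _ g); first exact: lt0r_neq0.
  by rewrite -wv ?expfz_neq0 // (valXz hw) // wx1 mulrC.
exists v; split=> //.
- move=> u hu; have [|l hl] := hc u.
    move=> N; have [M hM] := hu `|N|; exists M => m k hm hk.
    by have := hM m k hm hk; rewrite geE; apply: val_geW; nia.
  exists l => N; have [M hM] := hl (N * g); exists M => m hm.
  by rewrite geE; apply: hM.
- exists r; split; first by apply: sub_all hr1 => x; rewrite geE mul0r.
  move=> x; rewrite geE mul0r => /hr2[y yr h]; exists y => //.
  rewrite geE mul1r; move: h; rewrite /val_ge; case: eqVneq => //= n0.
  rewrite wv //; move: (v _) => a; case: (lerP a 0) => ha; nia.
- by split=> //; apply: (@mulIf _ g); [apply: lt0r_neq0 | rewrite -wv // w2 mul0r].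
Qed.

(** Approximants from outside P can be replaced by elements of P: for each [a] in the list keep one
    element of P congruent to it, if there is any. This provides integral or fixed representatives
    of residue classes. *)
Lemma finite_reps (K : fieldType) (w : K -> int) (P : K -> Prop) (s : seq K) :
  valuation w -> (forall x, P x -> exists2 y, y \in s & val_ge w 1 (x - y)) ->
  exists r : seq K, (forall y, y \in r -> P y) /\
    forall x, P x -> exists2 y, y \in r & val_ge w 1 (x - y).
Proof.
move=> hw hs.
suff [r [h1 h2]] : exists r : seq K, (forall y, y \in r -> P y) /\
    forall x, P x -> (exists2 y, y \in s & val_ge w 1 (x - y)) ->
      exists2 y, y \in r & val_ge w 1 (x - y).
  by exists r; split=> // x px; apply: h2 => //; apply: hs.
elim: {hs} s => [|a s [r [h1 h2]]]; first by exists [::]; split=> // x _ [].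
case: (classic (exists2 z, P z & val_ge w 1 (z - a))) => [[z Pz za]|hno].
  exists (z :: r); split=> [y|x Px [y]]; first by rewrite inE => /orP[/eqP ->|/h1].
  rewrite inE => /orP[/eqP -> xa|ys xy].
    exists z; first exact: mem_head.
    have -> : x - z = (x - a) - (z - a) by ring.
    exact: (val_geB hw).
  have [|y' y'r h] := h2 x Px; first by exists y.
  by exists y' => //; rewrite inE y'r orbT.
exists r; split=> // x Px [y]; rewrite inE => /orP[/eqP -> xa|ys xy].
  by case: hno; exists x.
by apply: h2 => //; exists y.
Qed.

(** * The valuation of a finite extension, by means of the norm *)

Section Extension.
Import VectorInternalTheory.
Variables (F : fieldType) (E : fieldExtType F) (v : F -> int).
Hypothesis hd : is_discrete_valuation v.
Hypothesis hc : val_complete v.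
Hypothesis hf : finite_residue_field v.
Hypothesis h2 : odd_residue_char v.
Let hv := discrete_valuation hd.
Let n := dim E.
Local Notation rE := (@r2v F E).

Definition mulm (x : E) : 'M[F]_n := \matrix_(i, j) v2r (x * rE (delta_mx 0 i)) 0 j.

Lemma mulmE y x : y *m mulm x = v2r (x * rE y).
Proof.
rewrite {2}(row_sum_delta y) !linear_sum /= mulr_sumr linear_sum mulmx_sum_row.
apply: eq_bigr => i _; rewrite !linearZ /= -scalerAr linearZ; congr (_ *: _).
by apply/rowP => j; rewrite !mxE.
Qed.

Lemma mulmM x y : mulm (x * y) = mulm y *m mulm x.
Proof. by apply/row_matrixP => i; rewrite !rowE mulmxA !mulmE v2rK mulrA. Qed.

Lemma mulm1 : mulm 1 = 1%:M.
Proof. by apply/row_matrixP => i; rewrite !rowE mulmE mul1r r2vK mulmx1. Qed.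

Lemma mulmZ a x : mulm (a *: x) = a *: mulm x.
Proof.
by apply/row_matrixP => i; rewrite !rowE -scalemxAr !mulmE -scalerAl linearZ.
Qed.

(** The value of the norm of x. It extends v only up to the factor [E : F], and its range may be a
    proper subgroup of the integers. *)
Definition wext (x : E) : int := v (\det (mulm x)).

Lemma det_mulm_neq0 x : x != 0 -> \det (mulm x) != 0.
Proof.
move=> x0; have := congr1 determinant (mulmM x x^-1); rewrite divff // mulm1 det1 det_mulmx.
by apply: contra_eq_neq => ->; rewrite mulr0 oner_neq0.
Qed.

Lemma wextM x y : x != 0 -> y != 0 -> wext (x * y) = wext x + wext y.
Proof.
by move=> x0 y0; rewrite /wext mulmM det_mulmx (valM hv) ?det_mulm_neq0 // addrC.
Qed.

Lemma wextZ a x : a != 0 -> x != 0 -> wext (a *: x) = v a * n%:Z + wext x.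
Proof.
by move=> a0 x0; rewrite /wext mulmZ detZ (valM hv) ?expf_neq0 ?det_mulm_neq0 // (valX hv).
Qed.

Lemma dim_gt0 : (0 < n)%N.
Proof.
rewrite lt0n; apply/negP => /eqP n0; have : v2r (1 : E) = 0.
  by apply/rowP => -[j jn]; have := jn; rewrite [X in (_ < X)%N]n0.
by move/(congr1 rE); rewrite v2rK linear0 => /eqP; rewrite oner_eq0.
Qed.

Lemma mulm_bound : exists C : int, 0 <= C /\
  forall a (x : E), vecge v a (v2r x) -> forall i j, val_ge v (a - C) (mulm x i j).
Proof.
have /fin_all_exists[C hC] := fun i => vecge_mulmx hd (mulm (rE (delta_mx 0 i))).
exists (\sum_i C i); split; first by apply: sumr_ge0 => i _; case: (hC i).
move=> a x hx i j; rewrite mxE mulrC.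
have := (hC i).2 a _ hx j; rewrite mulmE v2rK; apply: val_geW.
rewrite (bigD1 i) //=; have : 0 <= \sum_(l | l != i) C l by apply: sumr_ge0 => l _; case: (hC l).
move: (\sum_(_ | _) _) (C i); lia.
Qed.

Lemma mul_bound : exists C : int, 0 <= C /\
  forall a b (x y : E), vecge v a (v2r x) -> vecge v b (v2r y) -> vecge v (a + b - C) (v2r (x * y)).
Proof.
have [C [C0 hC]] := mulm_bound; exists C; split=> // a b x y hx hy j.
rewrite -{1}[y]v2rK -mulmE mxE; apply: (val_ge_sum hv) => i _.
have -> : a + b - C = b + (a - C) by lia.
by apply: (val_geM hv); [apply: hy | apply: hC].
Qed.

Lemma val_ge_det m a (A : 'M[F]_m) : (forall i j, val_ge v a (A i j)) -> val_ge v (a * m%:Z) (\det A).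
Proof.
move=> h; apply: (val_ge_sum hv) => s _; apply: (val_geM0 hv).
  by apply: (val_geX hv); rewrite (val_geN hv) (val_ge1 hv).
have -> : a * m%:Z = a * #|'I_m|%:Z by rewrite card_ord.
by apply: (val_ge_prod hv).
Qed.

(** If inverses of primitive vectors were unbounded, there would be primitive [x m] and [y m] with
    product [pi ^ t] for arbitrarily large t. Compactness yields nonzero X and Y with [X * Y = 0],
    impossible in a field. *)
Lemma inv_bound : exists C : int, 0 <= C /\
  forall x : E, primitive v (v2r x) -> vecge v (- C) (v2r x^-1).
Proof.
have [k [red hr]] := residue_map_exists hv hf.
have [pi [pi0 vpi]] := uniformizer_exists hd.
apply: NNPP => /not_ex_all_not hno.
have hx (m : nat) : exists x : E, primitive v (v2r x) /\ ~ vecge v (- m%:Z) (v2r x^-1).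
  apply: NNPP => /not_ex_all_not hall; apply: (hno m%:Z); split=> // x px.
  by apply: NNPP => h; apply: (hall x).
have pn0 (x : E) : primitive v (v2r x) -> x != 0.
  by case=> _; apply: contra_notN => /eqP ->; rewrite linear0; apply: vecge0.
have hxt (m : nat) : exists xt : E * int, [/\ primitive v (v2r xt.1), (m%:Z < xt.2) &
    primitive v (v2r (pi ^ xt.2 *: xt.1^-1))].
  have [x [px nx]] := hx m.
  have [|t ht] := @primitive_scale _ v hd _ (v2r x^-1) pi pi0 vpi.
    by apply/eqP => h; have := pn0 _ px; rewrite -invr_eq0 -[x^-1]v2rK h linear0 eqxx.
  exists (x, t); split=> //=; last by rewrite linearZ.
  rewrite ltNge; apply/negP => tm; apply: nx; case: ht => + _.
  move/vecgeZV; rewrite expfz_neq0 // (valXz hv) // vpi => /(_ hd isT).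
  by apply: vecgeW; lia.
pose s m := sval (constructive_indefinite_description _ (hxt m)).
have sP m := svalP (constructive_indefinite_description _ (hxt m)).
pose x m := (s m).1; pose y m := pi ^ (s m).2 *: (s m).1^-1.
have xP m : primitive v (v2r (x m)) by case: (sP m).
have yP m : primitive v (v2r (y m)) by case: (sP m).
have xy m : x m * y m = pi ^ (s m).2 *: 1.
  by rewrite /x /y -scalerAr divff // (pn0 _ (xP m)).
have [m|l hl] := cluster_point hd hc hr (u := fun m => row_mx (v2r (x m)) (v2r (y m))).
  by move=> j; rewrite mxE; case: split => i; [apply: (xP m).1 | apply: (yP m).1].
pose X := rE (lsubmx l); pose Y := rE (rsubmx l).
have hXY M k0 : exists m, [/\ (k0 <= m)%N, vecge v M (v2r (x m - X)) & vecge v M (v2r (y m - Y))].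
  have [m [km hm]] := hl M k0; exists m; split=> // j; rewrite linearB /= r2vK.
    by have := hm (lshift _ j); rewrite mxE row_mxEl !mxE.
  by have := hm (rshift _ j); rewrite mxE row_mxEr !mxE.
have X0 : X != 0.
  apply/eqP => X0; have [m [_ h _]] := hXY 1 0%N; apply: (xP m).2.
  by move: h; rewrite X0 subr0.
have Y0 : Y != 0.
  apply/eqP => Y0; have [m [_ _ h]] := hXY 1 0%N; apply: (yP m).2.
  by move: h; rewrite Y0 subr0.
have iX : vecge v 0 (v2r X).
  have [m [_ h _]] := hXY 0 0%N; have -> : X = x m - (x m - X) by rewrite subKr.
  by rewrite linearB; apply: (vecgeD hd); [apply: (xP m).1 | apply: (vecgeN hd)].
have [C [C0 hC]] := mul_bound.
have [C1 hC1] := vecge_lower v (v2r (1 : E)).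
suff : X * Y = 0 by apply/eqP; rewrite mulf_neq0.
apply: v2r_inj; rewrite linear0; apply: (@vecge_eq0 _ v) => M.
have [m [km hX hY]] := hXY (M + C) `|(M + C1)%R|%N.
have -> : X * Y = x m * y m - (X * (y m - Y) + (x m - X) * y m) by ring.
rewrite linearB linearD /=; apply: (vecgeD hd); last first.
  apply: (vecgeN hd); apply: (vecgeD hd).
    by have := hC _ _ _ _ iX hY; apply: vecgeW; lia.
  by have := hC _ _ _ _ hX (yP m).1; apply: vecgeW; lia.
rewrite xy linearZ; apply/(vecgeZV hd); rewrite ?expfz_neq0 // (valXz hv) // vpi.
apply: vecgeW hC1; have [_ + _] := sP m; rewrite -/(s m); move: (s m).2 => t; lia.
Qed.

(** Bounded coordinates bound a determinant from below. Applied to x and to its inverse, whose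
    values add up to 0, this gives both bounds. *)
Lemma wext_primitive : exists D : int, 0 <= D /\
  forall x : E, primitive v (v2r x) -> x != 0 /\ `|wext x| <= D.
Proof.
have [C [C0 hC]] := mulm_bound; have [C1 [C10 hC1]] := inv_bound.
exists ((C + C1) * n%:Z); split=> [|x px]; first by nia.
have x0 : x != 0.
  by case: px => _; apply: contra_notN => /eqP ->; rewrite linear0; apply: vecge0.
split=> //.
have := val_ge_det (hC _ _ px.1); rewrite val_geE ?det_mulm_neq0 // -/(wext x).
have := val_ge_det (hC _ _ (hC1 _ px)); rewrite val_geE ?det_mulm_neq0 ?invr_eq0 // -/(wext _).
have := wextM x0 (invr_neq0 x0); rewrite divff // {1}/wext mulm1 det1 (val1 hv).
move: (wext x) (wext x^-1) => a b; nia.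
Qed.

(** Equivalence of norms on E: multiplication by pi shifts the coordinate level by 1 and [wext] by
    n, so the comparison on primitive vectors suffices. *)
Lemma wext_coord : exists D : int, 0 <= D /\ (forall a (x : E), vecge v a (v2r x) -> val_ge wext (a * n%:Z - D) x)
  /\ (forall a N (x : E), val_ge wext N x -> a * n%:Z + D <= N -> vecge v a (v2r x)).
Proof.
have [pi [pi0 vpi]] := uniformizer_exists hd.
have [D [D0 hD]] := wext_primitive; exists D; split=> //.
have n0 := dim_gt0.
have dec x : x != 0 -> exists t x', [/\ x = pi ^ t *: x', primitive v (v2r x') &
    wext x = t * n%:Z + wext x'].
  move=> x0; have [|t ht] := @primitive_scale _ v hd _ (v2r x) pi pi0 vpi.
    by apply/eqP => h; move: x0; rewrite -[x]v2rK h linear0 eqxx.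
  exists (- t), (pi ^ t *: x); split.
  - by rewrite scalerA -expfzDr // addNr expr0z scale1r.
  - by rewrite linearZ.
  rewrite wextZ ?expfz_neq0 // (valXz hv) // vpi; lia.
split=> [a x hx|a N x hx aN].
  have [->|x0] := eqVneq x 0; first exact: val_ge0.
  have [t [x' [xE px wE]]] := dec x x0; have [_ h] := hD _ px.
  rewrite val_geE // wE; suff : a <= t by nia.
  rewrite leNgt; apply/negP => ta; apply: px.2; move: hx; rewrite xE linearZ.
  move/vecgeZV; rewrite expfz_neq0 // (valXz hv) // vpi => /(_ hd isT).
  by apply: vecgeW; lia.
have [->|x0] := eqVneq x 0; first by rewrite linear0; apply: vecge0.
move: hx; rewrite val_geE // => hx.
have [t [x' [xE px wE]]] := dec x x0; have [_ h] := hD _ px.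
rewrite xE linearZ; apply/(vecgeZV hd); rewrite ?expfz_neq0 // (valXz hv) // vpi.
apply: vecgeW px.1; move: hx h; rewrite wE; move: (wext x') => b; nia.
Qed.

(* If w x >= 0 the powers of 1 + x are bounded, and w (1 + x) < 0 would make
   w ((1 + x) ^ m) unbounded below. *)
Lemma wext_valuation : valuation wext.
Proof.
split; first exact: wextM.
have [D [D0 [hD1 hD2]]] := wext_coord; have n0 := dim_gt0.
have h1 x : x != 0 -> 0 <= wext x -> 1 + x != 0 -> 0 <= wext (1 + x).
  move=> x0 wx x10.
  have X y m : y != 0 -> wext (y ^+ m) = wext y * m%:Z.
    move=> y0; elim: m => [|m IH]; first by rewrite expr0 /wext mulm1 det1 (val1 hv) mulr0.
    by rewrite exprS wextM ?expf_neq0 // IH; lia.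
  have px i : vecge v (- D) (v2r (x ^+ i)).
    by apply: (hD2 _ 0); rewrite ?val_geE ?expf_neq0 ?X //; nia.
  have bd m : - D * n%:Z - D <= wext (1 + x) * m%:Z.
    rewrite -X // -(val_geE _ _ (expf_neq0 _ x10)); apply: hD1.
    rewrite exprDn linear_sum; apply: (vecge_sum hd) => i.
    rewrite expr1n mul1r linearMn => j; rewrite mulmxnE; apply: (val_geMn hv); exact: px.
  rewrite leNgt; apply/negP => neg.
  have := bd (`|(D * n%:Z + D)%R|.+1)%N; nia.
have sym x y : x != 0 -> y != 0 -> x + y != 0 -> wext y <= wext x -> wext y <= wext (x + y).
  move=> x0 y0 xy0 yx.
  have xyE : x + y = y * (1 + x / y) by field.
  have q0 : 1 + x / y != 0 by apply: contraNneq xy0 => h; rewrite xyE h mulr0.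
  have qE : wext (x / y) = wext x - wext y.
    have := @wextM (x / y) y; rewrite divfK // mulf_neq0 ?invr_eq0 // => /(_ isT y0); lia.
  rewrite xyE wextM //; have := @h1 (x / y); rewrite mulf_neq0 ?invr_eq0 // qE => /(_ isT).
  move=> /(_ _ q0); lia.
move=> x y x0 y0 xy0; case: (leP (wext x) (wext y)) => h.
  by rewrite addrC; apply: sym; rewrite // addrC.
by apply: sym => //; apply: ltW.
Qed.

(** Finitely many digits in base pi, each from a finite list of representatives. *)
Lemma reps_between a b : exists r : seq F, forall x, val_ge v a x ->
  exists2 y, y \in r & val_ge v b (x - y).
Proof.
have [pi [pi0 vpi]] := uniformizer_exists hd.
have [r0 [_ h0]] := hf.
suff lev (j : nat) : exists r : seq F, forall x, val_ge v 0 x ->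
  exists2 y, y \in r & val_ge v j%:Z (x - y).
  have [r hr] := lev `|b - a|%N.
  exists [seq pi ^ a * y | y <- r] => x hx.
  have [|y yr hy] := hr (pi ^ (- a) * x).
    by rewrite (val_geMV hv) ?expfz_neq0 // (valXz hv) // vpi; apply: val_geW hx; lia.
  exists (pi ^ a * y); first exact: map_f.
  have -> : x - pi ^ a * y = pi ^ a * (pi ^ (- a) * x - y).
    by rewrite mulrBr mulrA -expfzDr // subrr expr0z mul1r.
  by rewrite (val_geMV hv) ?expfz_neq0 // (valXz hv) // vpi; apply: val_geW hy; lia.
elim: j => [|j [r hr]].
  by exists [:: 0] => x hx; exists 0; rewrite ?mem_head ?subr0.
exists [seq y + pi ^+ j * z | y <- r, z <- r0] => x /hr[y yr hy].
have [|z zr hz] := h0 (pi ^- j * (x - y)).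
  rewrite (val_geMV hv) ?invr_eq0 ?expf_neq0 // (valV hv) ?expf_neq0 // (valX hv) // vpi.
  by apply: val_geW hy; lia.
exists (y + pi ^+ j * z); first by apply/allpairsP; exists (y, z).
have -> : x - (y + pi ^+ j * z) = pi ^+ j * (pi ^- j * (x - y) - z).
  by rewrite mulrBr mulrA mulfV ?expf_neq0 //; ring.
rewrite (val_geMV hv) ?expf_neq0 // (valX hv) // vpi.
by apply: val_geW hz; lia.
Qed.

Lemma extension_local_aux : nonarch_local_field_odd_residue E.
Proof.
have hw := wext_valuation; have n0 := dim_gt0.
have [pi [pi0 vpi]] := uniformizer_exists hd.
have [D [D0 [hD1 hD2]]] := wext_coord.
have w1 : wext 1 = 0 by rewrite /wext mulm1 det1 (val1 hv).
apply: (@local_of_valuation E wext) => //.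
- exists (pi *: 1); rewrite scaler_eq0 negb_or pi0 oner_eq0; split=> //.
  by rewrite wextZ ?oner_eq0 // w1 vpi; lia.
- move=> u hu.
  have /fin_all_exists[l hl] : forall j : 'I_n, exists lj, val_converges v (fun m => v2r (u m) 0 j) lj.
    move=> j; apply: hc => N; have [M hM] := hu (N * n%:Z + D); exists M => m m' hm hm'.
    have := @hD2 N _ _ (hM m m' hm hm') (lexx _) j.
    by rewrite linearB /= !mxE.
  exists (rE (\row_j l j)) => N.
  pose a := `|N + D|.
  have /fin_all_exists[g hg] := fun j => hl j a.
  exists (\max_j g j) => m hm.
  have : val_ge wext (a * n%:Z - D) (u m - rE (\row_j l j)).
    apply: hD1 => j; rewrite linearB /= r2vK !mxE; apply: hg.
    by apply: leq_trans hm; apply: leq_bigmax.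
  by apply: val_geW; rewrite /a; nia.
(* Integral elements have coordinates of value at least [- D]; agreement of coordinates up to level
   [D + 1] gives the difference value at least [(D + 1) * n - D], which is at least 1. *)
- have [r hr] := reps_between (- D) (D + 1).
  pose s := [seq rE (\row_j nth 0 r (f j)) | f : {ffun 'I_n -> 'I_(size r)}].
  have [|r' [h1 hr']] := @finite_reps E wext (val_ge wext 0) s hw.
    move=> x hx.
    have hx' : vecge v (- D) (v2r x) by apply: (hD2 _ 0) => //; nia.
    have /fin_all_exists[f hf'] : forall j : 'I_n, exists i : 'I_(size r), val_ge v (D + 1) (v2r x 0 j - nth 0 r i).
      move=> j; have [y yr hy] := hr _ (hx' j).
      have yi : (index y r < size r)%N by rewrite index_mem.
      by exists (Ordinal yi); rewrite /= nth_index.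
    exists (rE (\row_j nth 0 r (finfun f j))); first by apply/imageP; exists (finfun f).
    have : val_ge wext ((D + 1) * n%:Z - D) (x - rE (\row_j nth 0 r (finfun f j))).
      by apply: hD1 => j; rewrite linearB /= r2vK !mxE ffunE.
    by apply: val_geW; nia.
  by exists r'; split; [apply/allP | ].
- have [n2 v2] := h2.
  have E2 : (2%:R : E) = 2%:R *: 1 by rewrite scaler_nat.
  rewrite /odd_residue_char E2 scaler_eq0 negb_or n2 oner_eq0; split=> //.
  by rewrite wextZ ?oner_eq0 // v2 w1 mul0r.
Qed.

End Extension.

Lemma extension_local (F : fieldType) (E : fieldExtType F) :
  nonarch_local_field_odd_residue F -> nonarch_local_field_odd_residue E.
Proof. by case=> v [h1 h2 h3 h4]; exact: (extension_local_aux E h1 h2 h3 h4). Qed.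

(** * The fixed field of an involution *)

Section FixedField.
Variables (K : fieldType) (tau : {rmorphism K -> K}).

Definition fix_pred : {pred K} := [pred x | tau x == x].

Lemma fix_divring_closed : divring_closed fix_pred.
Proof.
split=> [|x y|x y]; rewrite !inE ?rmorph1 // ?rmorphB ?rmorphM ?fmorphV /=.
  by move=> /eqP -> /eqP ->.
by move=> /eqP -> /eqP ->.
Qed.

HB.instance Definition _ := GRing.isDivringClosed.Build K fix_pred fix_divring_closed.

Record fixf := Fixf { fixval : K; fixvalP : fixval \in fix_pred }.
HB.instance Definition _ := [isSub for fixval].
HB.instance Definition _ := [Choice of fixf by <:].
HB.instance Definition _ := [SubChoice_isSubIntegralDomain of fixf by <:].
HB.instance Definition _ := [SubIntegralDomain_isSubField of fixf by <:].

HB.instance Definition _ := GRing.RMorphism.copy fixval (\val : fixf -> K).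

Lemma fix_val (x : fixf) : tau (fixval x) = fixval x.
Proof. by apply/eqP; exact: (valP x). Qed.

Lemma fixval_inj : injective fixval.
Proof. exact: val_inj. Qed.

Definition tofix (x : K) : fixf := insubd 0 x.

Lemma tofixK x : tau x = x -> fixval (tofix x) = x.
Proof. by move=> h; apply: (insubdK (0 : fixf)); rewrite inE h. Qed.

Lemma fixvalK (x : fixf) : tofix (fixval x) = x.
Proof. by apply: fixval_inj; rewrite tofixK ?fix_val. Qed.

Hypothesis tauK : involutive tau.

(** Composition with tau multiplies v by some e > 0, and applying tau twice gives [e * e = 1]. *)
Lemma val_invol (v : K -> int) : is_discrete_valuation v -> val_complete v ->
  finite_residue_field v -> odd_residue_char v -> forall x, x != 0 -> v (tau x) = v x.
Proof.
move=> h1 h2 h3 h4; have [e [e0 he]] := val_hom tau h1 h2 h3 h4 h1 h3.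
have [pi [pi0 vpi]] := uniformizer_exists h1.
have := he _ pi0; have t0 : tau pi != 0 by rewrite fmorph_eq0.
have := he _ t0; rewrite tauK vpi => h h'.
have e1 : e = 1 by nia.
by move=> x x0; rewrite he // e1 mul1r.
Qed.

Lemma fixed_local : nonarch_local_field_odd_residue K -> nonarch_local_field_odd_residue fixf.
Proof.
case=> v [hd hc hf h2]; have hv := discrete_valuation hd.
have vt := val_invol hd hc hf h2.
pose w (x : fixf) := v (fixval x).
have n0 (x : fixf) : (fixval x != 0) = (x != 0) by rewrite fmorph_eq0.
have geE N x : val_ge w N x = val_ge v N (fixval x) by rewrite /val_ge fmorph_eq0.
have hw : valuation w.
  split=> x y x0 y0; rewrite /w ?rmorphM ?rmorphD /=; first by rewrite (valM hv) ?n0.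
  by move=> xy0; apply: hv.2; rewrite ?n0 // -rmorphD n0.
apply: (local_of_valuation hw).
- have [pi [pi0 vpi]] := uniformizer_exists hd.
  (* A uniformizer need not be fixed; nontriviality is witnessed by [pi * tau pi], of value 2. *)
  have tp : tau (pi * tau pi) = pi * tau pi by rewrite rmorphM /= tauK mulrC.
  exists (tofix (pi * tau pi)); rewrite -n0 /w tofixK //.
  by rewrite mulf_neq0 ?fmorph_eq0 // (valM hv) ?fmorph_eq0 // vt // vpi.
- move=> u hu; have [|l hl] := hc (fun m => fixval (u m)).
    by move=> N; have [M hM] := hu N; exists M => m k hm hk; rewrite -rmorphB -geE; apply: hM.
  (* tau preserves v, hence is continuous, and a limit of fixed elements is fixed. *)
  have tl : tau l = l.
    apply/eqP; rewrite -subr_eq0; apply/eqP; apply: (@val_ge_eq0 _ v) => N.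
    have [M /(_ _ (leqnn _)) hM] := hl N.
    have -> : tau l - l = (fixval (u M) - l) - tau (fixval (u M) - l).
      by rewrite rmorphB fix_val /=; ring.
    apply: (val_geB hv) => //; move: hM; rewrite /val_ge fmorph_eq0.
    by case: eqVneq => //= h; rewrite vt.
  exists (tofix l) => N; have [M hM] := hl N; exists M => m hm.
  by rewrite geE rmorphB /= tofixK //; apply: hM.
- have [r [_ hr]] := hf.
  have [|r' [h1 h3]] := @finite_reps K v (fun x => tau x = x /\ val_ge v 0 x) r hv.
    by move=> x [_ /hr].
  exists [seq tofix y | y <- r']; split.
    by apply/allP => _ /mapP[y /h1[ty iy] ->]; rewrite geE tofixK.
  move=> x; rewrite geE => hx; have [|y yr hy] := h3 (fixval x); first by rewrite fix_val.
  exists (tofix y); first exact: map_f.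
  by rewrite geE rmorphB /= tofixK //; case: (h1 _ yr).
- have [n2 v2] := h2; rewrite /odd_residue_char -n0 /w rmorph_nat; split=> //.
Qed.

(* dl is (1) when tau = id, and otherwise (1, delta) with tau delta = - delta. *)
Lemma fix_basis : (2%:R : K) != 0 ->
  exists (c : nat) (dl : 'I_c -> K) (dec : 'I_c -> K -> fixf),
    [/\ (0 < c)%N, forall x, x = \sum_i dl i * fixval (dec i x)
      & forall (y : 'I_c -> fixf) i, dec i (\sum_j dl j * fixval (y j)) = y i].
Proof.
move=> n2; case: (classic (tau =1 id)) => [tid|].
  exists 1%N, (fun=> 1), (fun=> tofix); split=> // [x|y i].
    by rewrite big_ord1 mul1r tofixK //; apply: tid.
  by rewrite big_ord1 mul1r fixvalK (ord1 i).
move=> hno; have [a ha] := not_all_ex_not _ _ hno.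
pose d := a - tau a.
have d0 : d != 0 by rewrite subr_eq0 eq_sym; apply/eqP.
have td : tau d = - d by rewrite rmorphB /= tauK opprB.
have t2 : tau 2%:R = 2%:R by rewrite rmorph_nat.
exists 2%N, (fun i => if i == ord0 then 1 else d),
  (fun i x => if i == ord0 then tofix ((x + tau x) / 2%:R) else tofix ((x - tau x) / (2%:R * d))).
have f1 x : tau ((x + tau x) / 2%:R) = (x + tau x) / 2%:R.
  by rewrite rmorphM fmorphV rmorphD /= tauK t2 addrC.
have f2 x : tau ((x - tau x) / (2%:R * d)) = (x - tau x) / (2%:R * d).
  rewrite rmorphM fmorphV rmorphB rmorphM /= tauK t2 td; field.
  by rewrite d0 n2 oppr_eq0 d0.
have e1 : (lift ord0 ord0 == ord0 :> 'I_2) = false by [].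
split=> // [x|y i].
  rewrite big_ord_recl big_ord1 eqxx e1 !tofixK //; field.
  by rewrite d0 n2.
rewrite !big_ord_recl big_ord0 eqxx e1; set S := (X in tofix ((X + _) / _)).
have tS : tau S = fixval (y ord0) - d * fixval (y (lift ord0 ord0)).
  by rewrite /S !rmorphD !rmorphM /= rmorph1 rmorph0 !fix_val td; ring.
case: ifP => [/eqP ->|/negbT i0]; apply: fixval_inj.
  by rewrite tofixK // tS /S; field.
have -> : i = lift ord0 ord0.
  by apply: val_inj; case: i i0 => -[|[|]].
by rewrite tofixK // tS /S; field; rewrite d0 n2.
Qed.

End FixedField.

(** * Quadratic forms over finite and local fields *)

Section FiniteField.
Variable k : finFieldType.
Hypothesis k2 : (2%:R : k) != 0.

Let sq := [set x ^+ 2 | x : k].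

Lemma neq_opp (y : k) : y != 0 -> y != - y.
Proof. by move=> y0; rewrite -subr_eq0 opprK -mulr2n -mulr_natl mulf_neq0. Qed.

Lemma card_roots (y : k) : y != 0 -> #|[set x : k | x ^+ 2 == y ^+ 2]| = 2%N.
Proof.
move=> y0; transitivity #|[set y; - y]|; last by rewrite cards2 neq_opp.
by apply: eq_card => x; rewrite !inE eqf_sqr.
Qed.

(** Fibres of squaring have at most two elements, and the fibre of 0 only one, which makes the
    inequality strict. *)
Lemma card_sq : (#|k| < 2 * #|sq|)%N.
Proof.
have sq0 : (0 : k) \in sq by apply/imsetP; exists 0; rewrite ?expr0n.
have -> : #|k| = (\sum_(s in sq) #|[set x : k | x ^+ 2 == s]|)%N.
  rewrite -sum1_card (partition_big (fun x : k => x ^+ 2) (mem sq)) /=; last first.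
    by move=> x _; apply/imsetP; exists x.
  by apply: eq_bigr => s _; rewrite -sum1_card; apply: eq_bigl => x; rewrite !inE.
rewrite (bigD1 0) //= (cardsD1 0 sq) sq0.
have -> : #|[set x : k | x ^+ 2 == 0]| = 1%N.
  transitivity #|[set 0 : k]|; last exact: cards1.
  by apply: eq_card => x; rewrite !inE sqrf_eq0.
have : (\sum_(s in sq | s != 0%R) #|[set x : k | x ^+ 2 == s]| <= \sum_(s in sq | s != 0%R) 2)%N.
  apply: leq_sum => s /andP[/imsetP[y _ ->] y2]; rewrite card_roots //.
  by apply: contraNneq y2 => ->; rewrite expr0n.
rewrite sum_nat_const (eq_card (B := mem (sq :\ 0))); last by move=> x; rewrite !inE andbC.
have -> : #|mem (sq :\ 0)| = #|sq :\ 0| by [].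
move: (\sum_(_ in _ | _) _)%N #|sq :\ 0| => a b; rewrite /=; lia.
Qed.

(** On a finite set a surjection is injective, but squaring identifies 1 and -1. *)
Lemma nonsquare_exists : exists u : k, forall x, x ^+ 2 != u.
Proof.
apply: NNPP => /not_ex_all_not hno.
have : injective (fun x : k => x ^+ 2).
  have onto (u : k) : exists x, x ^+ 2 = u.
    by apply: NNPP => h; apply: (hno u) => x; apply/eqP => hx; apply: h; exists x.
  have /fin_all_exists[g hg] := onto.
  have gi : injective g by move=> x y h; rewrite -(hg x) -(hg y) h.
  have [g' gk kg] := injF_bij gi => x y h.
  by move: h; rewrite -(kg x) -(kg y) !hg => ->.
move/(_ 1 (-1)); rewrite sqrrN => /(_ erefl) /eqP.
by rewrite (negbTE (neq_opp (oner_neq0 k))).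
Qed.

(** The squares and their multiples by u share only 0, and each of the two sets has more than half
    of the elements. *)
Lemma sq_cover (u : k) : u != 0 -> (forall x, x ^+ 2 != u) ->
  forall s, exists x, x ^+ 2 = s \/ u * x ^+ 2 = s.
Proof.
move=> u0 hu s.
pose usq := [set u * s | s in sq].
have cu : #|usq| = #|sq| by rewrite card_imset //; apply: mulfI.
have si : (#|sq :&: usq| <= 1)%N.
  rewrite -(cards1 (0 : k)); apply: subset_leq_card; apply/subsetP => x.
  rewrite !inE => /andP[/imsetP[y _ xy] /imsetP[_ /imsetP[z _ ->] xz]].
  have [z0|z0] := eqVneq z 0; first by rewrite xz z0 expr0n mulr0.
  have := hu (y / z); rewrite expr_div_n -xy xz mulfK ?expf_neq0 // eqxx //.
have cov : sq :|: usq = setT.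
  apply/eqP; rewrite eqEcard subsetT cardsT cardsU cu.
  have := card_sq; move: si; move: #|sq :&: usq| #|sq| #|k| => a b c; lia.
have : s \in sq :|: usq by rewrite cov in_setT.
rewrite inE => /orP[/imsetP[x _ ->]|/imsetP[_ /imsetP[x _ ->] ->]]; exists x; first by left.
by right.
Qed.

(** A nonzero s is either a square or u times a square, never both, and has two roots; 0 has a
    single root on each side. The uniformity in s, including 0, is what the later count exploits. *)
Lemma count_sq (u : k) : u != 0 -> (forall x, x ^+ 2 != u) ->
  forall s, (#|[set y : k | y ^+ 2 == s]| + #|[set y : k | (u * y ^+ 2 == s)%R]| = 2)%N.
Proof.
move=> u0 hu s.
have [->|s0] := eqVneq s 0.
  have -> : [set y : k | y ^+ 2 == 0] = [set 0] by apply/setP => x; rewrite !inE sqrf_eq0.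
  have -> : [set y : k | (u * y ^+ 2 == 0)%R] = [set 0].
    by apply/setP => x; rewrite !inE mulf_eq0 (negbTE u0) sqrf_eq0.
  by rewrite cards1.
have [x hx] := sq_cover u0 hu s.
have x0 : x != 0.
  by apply: contraNneq s0 => x0; case: hx => <-; rewrite x0 expr0n ?mulr0.
case: hx => hx; subst s.
  rewrite card_roots // (_ : [set y | _] = set0) ?cards0 //.
  apply/setP => y; rewrite !inE; apply/negbTE; apply/eqP => h.
  have y0 : y != 0.
    by apply: contraNneq s0 => y0; rewrite -h y0 expr0n mulr0.
  by have := hu (x / y); rewrite expr_div_n -h mulfK ?expf_neq0 // eqxx.
rewrite (_ : [set y | y ^+ 2 == _] = set0) ?cards0.
  apply: etrans (card_roots x0); rewrite add0n; apply: eq_card => y; rewrite !inE.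
  by rewrite (inj_eq (mulfI u0)).
apply/setP => y; rewrite !inE; apply/negbTE; apply/eqP => h.
by have := hu (y / x); rewrite expr_div_n h mulfK ?expf_neq0 // eqxx.
Qed.

(** Pigeonhole: [a * x ^ 2] and [c - b * y ^ 2] each take more than half of all values. *)
Lemma binary_universal (a b c : k) : a != 0 -> b != 0 -> exists x y, a * x ^+ 2 + b * y ^+ 2 = c.
Proof.
move=> a0 b0.
pose A := [set a * s | s in sq]; pose B := [set c - b * s | s in sq].
have cA : #|A| = #|sq| by rewrite card_imset //; apply: mulfI.
have cB : #|B| = #|sq|.
  by rewrite card_imset // => x y h; apply: (mulfI b0); apply: oppr_inj; exact: (addrI c h).
have : A :&: B != set0.
  rewrite -card_gt0; have := card_sq; have := subset_leq_card (subsetT (A :|: B)).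
  rewrite cardsU cA cB cardsT; move: #|A :&: B| #|sq| #|k| => i j l; lia.
case/set0Pn => z; rewrite inE => /andP[/imsetP[_ /imsetP[x _ ->] ->]].
case/imsetP => _ /imsetP[y _ ->] h; exists x, y; rewrite h; ring.
Qed.

End FiniteField.

Lemma evenz_dec (a b : int) : odd `|a| = odd `|b| -> exists m, a = b + 2 * m.
Proof.
move=> h; exists ((a - b) %/ 2)%Z.
have := divz_eq (a - b) 2; have := modz_ge0 (a - b) (isT : 2 != 0 :> int).
have := ltz_pmod (a - b) (isT : 0 < 2 :> int).
move: ((a - b) %/ 2)%Z ((a - b) %% 2)%Z => q r; lia.
Qed.

(** * Square classes and binary forms over a local field *)

Section OddUnits.
Variables (K : fieldType) (v : K -> int).
Hypothesis hd : is_discrete_valuation v.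
Hypothesis hc : val_complete v.
Hypothesis h2 : odd_residue_char v.
Variables (k : finFieldType) (red : K -> k).
Hypothesis hr : residue_map v red.
Let hv := discrete_valuation hd.

Lemma res2 : (2%:R : k) != 0.
Proof.
have [n2 v2] := h2; have [_] := unit_res hr n2 v2.
by rewrite (resD hr) ?(val_ge1 hv) // (res1 hr).
Qed.

Lemma sqrt_unit a b : a != 0 -> v a = 0 -> b ^+ 2 = red a -> exists y, y ^+ 2 = a.
Proof.
move=> a0 va hb; have [ia ra] := unit_res hr a0 va.
have [y [iy ry]] := res_surj hr b.
have b0 : b != 0 by apply: contraNneq ra => b0; rewrite -hb b0 expr0n.
have [y0 vy] : y != 0 /\ v y = 0 by apply: (res_unit hr iy); rewrite ry.
have [|z [hz _]] := @sqrt_one_unit _ _ hd hc h2 (a / y ^+ 2).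
  have -> : a / y ^+ 2 - 1 = (y ^+ 2)^-1 * (a - y ^+ 2) by field.
  rewrite (val_geMV hv) ?invr_eq0 ?expf_neq0 // (valV hv) ?expf_neq0 // (valX hv) // vy mul0r subr0.
  by rewrite -(res_eq hv hr) ?(val_geX hv) // (resX hv hr) // ry hb.
by exists (y * z); rewrite exprMn hz; field.
Qed.

Variables (u : K).
Hypothesis u0 : u != 0.
Hypothesis vu : v u = 0.
Hypothesis hu : forall x : k, x ^+ 2 != red u.

Let iu : val_ge v 0 u. Proof. by have [] := unit_res hr u0 vu. Qed.
Let ru0 : red u != 0. Proof. by have [] := unit_res hr u0 vu. Qed.

Lemma unit_class a : a != 0 -> v a = 0 -> exists t, a = t ^+ 2 \/ a = u * t ^+ 2.
Proof.
move=> a0 va; have [ia ra] := unit_res hr a0 va.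
have [x [hx|hx]] := sq_cover res2 ru0 hu (red a).
  by have [t ht] := sqrt_unit a0 va hx; exists t; left.
have vau : v (a / u) = 0 by rewrite (valM hv) ?invr_eq0 // (valV hv) // va vu.
have [||t ht] := @sqrt_unit (a / u) x _ vau; first by rewrite mulf_neq0 ?invr_eq0.
  apply: (mulfI ru0); rewrite hx -(resM hr) //; first by rewrite mulrC divfK.
  by rewrite val_geE ?mulf_neq0 ?invr_eq0 // vau.
by exists t; right; rewrite ht mulrC divfK.
Qed.

Lemma even_class a m : a != 0 -> v a = 2 * m -> exists t, t != 0 /\ (a = t ^+ 2 \/ a = u * t ^+ 2).
Proof.
move=> a0 va; have [pi [pi0 vpi]] := uniformizer_exists hd.
have p0 : pi ^ m != 0 by rewrite expfz_neq0.
have [||t ht] := @unit_class (a / (pi ^ m) ^+ 2).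
- by rewrite mulf_neq0 ?invr_eq0 ?expf_neq0.
- rewrite (valM hv) ?invr_eq0 ?expf_neq0 // (valV hv) ?expf_neq0 // (valX hv) // (valXz hv) // va vpi; lia.
have e : a = a / (pi ^ m) ^+ 2 * (pi ^ m) ^+ 2 by rewrite divfK ?expf_neq0.
exists (t * pi ^ m); have ht' : a = (t * pi ^ m) ^+ 2 \/ a = u * (t * pi ^ m) ^+ 2.
  by case: ht => h; [left|right]; rewrite {1}e h; ring.
split=> //; apply: contraNneq a0 => h; case: ht' => ->; by rewrite h expr0n ?mulr0.
Qed.


(** In a solution over the residue field one variable is lifted arbitrarily; the other then needs
    the square root of a unit, whose residue must be nonzero. Hence the reduction to [x != 0]. *)
Lemma units_binary a b : a != 0 -> v a = 0 -> b != 0 -> v b = 0 ->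
  exists x y, a * x ^+ 2 + b * y ^+ 2 = 1.
Proof.
move=> a0 va b0 vb; have [ia ra] := unit_res hr a0 va; have [ib rb] := unit_res hr b0 vb.
have [x [y hxy]] := binary_universal res2 1 ra rb.
wlog x0 : a b a0 va b0 vb ia ra ib rb x y hxy / x != 0.
  move=> W; have [x0|x0] := eqVneq x 0; last exact: (W a b a0 va b0 vb ia ra ib rb x y).
  have y0 : y != 0.
    apply/eqP => y0; move: hxy; rewrite x0 y0 !expr0n !mulr0 addr0 => /esym/eqP.
    by rewrite oner_eq0.
  have [|s [t h]] := W b a b0 vb a0 va ib rb ia ra y x _ y0; first by rewrite addrC.
  by exists t, s; rewrite addrC.
have [Y [iY rY]] := res_surj hr y.
have iZ : val_ge v 0 (1 - b * Y ^+ 2).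
  by rewrite (val_geB hv) ?(val_ge1 hv) ?(val_geM0 hv) ?(val_geX hv).
have rZ : red (1 - b * Y ^+ 2) = red a * x ^+ 2.
  rewrite (resB hv hr) ?(val_ge1 hv) ?(val_geM0 hv) ?(val_geX hv) // (resM hr) ?(val_geX hv) //.
  by rewrite (resX hv hr) // rY (res1 hr) -hxy addrK.
have [Z0 vZ] : 1 - b * Y ^+ 2 != 0 /\ v (1 - b * Y ^+ 2) = 0.
  by apply: (res_unit hr iZ); rewrite rZ mulf_neq0 ?expf_neq0.
have vq : v ((1 - b * Y ^+ 2) / a) = 0.
  by rewrite (valM hv) ?invr_eq0 // (valV hv) // vZ va.
have [||X hX] := @sqrt_unit ((1 - b * Y ^+ 2) / a) x _ vq.
- by rewrite mulf_neq0 ?invr_eq0.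
- apply: (mulfI ra); rewrite -rZ -(resM hr) //; first by rewrite [a * _]mulrC divfK.
  by rewrite val_geE ?mulf_neq0 ?invr_eq0 // vq.
by exists X, Y; rewrite hX [a * _]mulrC divfK // subrK.
Qed.

Definition par (a : K) := odd `|v a|.

Lemma par_quot a b : a != 0 -> b != 0 -> par a = par b -> exists m, v (a / b) = 2 * m.
Proof.
move=> a0 b0 /evenz_dec[m h]; exists m; clear - hv a0 b0 h.
rewrite (valM hv) ?invr_eq0 // (valV hv) // h; lia.
Qed.

Lemma binary_rep a b c : a != 0 -> b != 0 -> c != 0 -> par a = par c -> par b = par c ->
  exists x y, a * x ^+ 2 + b * y ^+ 2 = c.
Proof.
move=> a0 b0 c0 /(par_quot a0 c0)[m hm] /(par_quot b0 c0)[m' hm'].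
have [|t [t0 ht]] := @even_class (a / c) m _ hm; first by rewrite mulf_neq0 ?invr_eq0.
have [|s [s0 hs]] := @even_class (b / c) m' _ hm'; first by rewrite mulf_neq0 ?invr_eq0.
(* The unit is 1 or u, so binary forms with coefficients of even value reduce to forms with unit
   coefficients. *)
have unitof z w : z != 0 -> w != 0 -> z = w ^+ 2 \/ z = u * w ^+ 2 ->
    exists e, [/\ e != 0, v e = 0 & z = e * w ^+ 2].
  by move=> z0 w0 [->|->]; [exists 1 | exists u]; rewrite ?mul1r ?oner_neq0 ?(val1 hv).
have [|al [al0 val_ E1]] := unitof _ _ _ t0 ht; first by rewrite mulf_neq0 ?invr_eq0.
have [|be [be0 vbe E2]] := unitof _ _ _ s0 hs; first by rewrite mulf_neq0 ?invr_eq0.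
have [x [y hxy]] := units_binary al0 val_ be0 vbe.
exists (x / t), (y / s).
have -> : a = c * (al * t ^+ 2) by rewrite -E1 mulrC divfK.
have -> : b = c * (be * s ^+ 2) by rewrite -E2 mulrC divfK.
by rewrite -[RHS]mulr1 -hxy; field; rewrite t0 s0.
Qed.

Lemma par_opp a : par (- a) = par a.
Proof. by rewrite /par (valN hv). Qed.

(* An anisotropic plane with diagonal entries of equal valuation parity is a
   multiple of the norm form of the unramified quadratic extension. *)
Lemma plane_norm a b c : a != 0 -> b != 0 -> c != 0 -> par a = par c -> par b = par c ->
  (forall x y, a * x ^+ 2 + b * y ^+ 2 = 0 -> x = 0) ->
  exists x y x' y', [/\ a * x ^+ 2 + b * y ^+ 2 = c, a * x * x' + b * y * y' = 0
    & a * x' ^+ 2 + b * y' ^+ 2 = - u * c].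
Proof.
move=> a0 b0 c0 pa pb an.
have [x [y hxy]] := binary_rep a0 b0 c0 pa pb.
have [m hm] : exists m, v (- a * b) = 2 * m.
  have [m h] := par_quot a0 b0 (etrans pa (esym pb)); exists (m + v b).
  move: h; rewrite mulNr (valN hv) !(valM hv) ?invr_eq0 // (valV hv) //; lia.
have [|t [t0 ht]] := even_class _ hm; first by rewrite mulf_neq0 ?oppr_eq0.
(* [- a * b] is a square or u times a square; a square would make the plane isotropic. *)
case: ht => ht.
  have := an b t; rewrite -ht => h; have /eqP : b = 0 by apply: h; ring.
  by rewrite (negbTE b0).
(* The second vector is orthogonal to the first, and its value is that of the first times
   [a * b / t ^ 2 = - u]. *)
exists x, y, (- b * y / t), (a * x / t); split=> //; first by field.
have -> : a * (- b * y / t) ^+ 2 + b * (a * x / t) ^+ 2 = - (- a * b / t ^+ 2) * (a * x ^+ 2 + b * y ^+ 2).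
  by field.
by rewrite ht mulfK ?expf_neq0 // hxy.
Qed.

(** Norms from the unramified quadratic extension have even value: if x and z have equal value, the
    leading terms cannot cancel, because u is not a square in the residue field. *)
Lemma norm_par x z : x ^+ 2 - u * z ^+ 2 != 0 -> par (x ^+ 2 - u * z ^+ 2) = false.
Proof.
have pv (w : K) : w != 0 -> v (w ^+ 2) = v w * 2 by move=> w0; rewrite (valX hv).
have ev (n : int) : odd `|n * 2| = false by lia.
have [->|x0] := eqVneq x 0.
  rewrite expr0n sub0r oppr_eq0 mulf_eq0 negb_or u0 sqrf_eq0 /= => z0.
  by rewrite par_opp /par (valM hv) ?expf_neq0 // vu add0r pv.
have [-> _|z0 n0] := eqVneq z 0; first by rewrite expr0n mulr0 subr0 /par pv.
have uz : - (u * z ^+ 2) != 0 by rewrite oppr_eq0 mulf_neq0 ?expf_neq0.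
have vuz : v (- (u * z ^+ 2)) = v z * 2 by rewrite (valN hv) (valM hv) ?expf_neq0 // vu add0r pv.
case: (ltgtP (v x) (v z)) => h.
- have [||_ E] := @val_addl _ _ hv (x ^+ 2) (- (u * z ^+ 2)); first by rewrite expf_neq0.
    by rewrite val_geE // vuz pv //; lia.
  by rewrite /par E pv.
- have [|_ E] := @val_addl _ _ hv (- (u * z ^+ 2)) (x ^+ 2) uz.
    by rewrite val_geE ?expf_neq0 // vuz pv //; lia.
  by rewrite /par addrC E vuz.
have xz : v (x / z) = 0 by rewrite (valM hv) ?invr_eq0 // (valV hv) // h subrr.
have xz0 : x / z != 0 by rewrite mulf_neq0 ?invr_eq0.
have [ixz _] := unit_res hr xz0 xz.
have i1 : val_ge v 0 ((x / z) ^+ 2 - u) by rewrite (val_geB hv) ?(val_geX hv).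
have [n1 v1] : (x / z) ^+ 2 - u != 0 /\ v ((x / z) ^+ 2 - u) = 0.
  apply: (res_unit hr i1); rewrite (resB hv hr) ?(val_geX hv) // subr_eq0 (resX hv hr) //.
have -> : x ^+ 2 - u * z ^+ 2 = ((x / z) ^+ 2 - u) * z ^+ 2 by field.
by rewrite /par (valM hv) ?expf_neq0 // v1 add0r pv.
Qed.

End OddUnits.

(** * Diagonal anisotropic forms, split by the parity of the valuations *)

Section DiagonalForms.
Variables (K : fieldType) (v : K -> int).
Hypothesis hd : is_discrete_valuation v.
Hypothesis hc : val_complete v.
Hypothesis h2 : odd_residue_char v.
Variables (k : finFieldType) (red : K -> k).
Hypothesis hr : residue_map v red.
Let hv := discrete_valuation hd.
Variables (u : K).
Hypothesis u0 : u != 0.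
Hypothesis vu : v u = 0.
Hypothesis hu : forall x : k, x ^+ 2 != red u.

Variables (n : nat) (d : 'I_n -> K).
Hypothesis d_aniso : forall y : 'I_n -> K, \sum_i d i * y i ^+ 2 = 0 -> forall i, y i = 0.

Definition tri (i j l : 'I_n) (a b c : K) (m : 'I_n) :=
  if m == i then a else if m == j then b else if m == l then c else 0.

Lemma tri_sum i j l a b c : i != j -> j != l -> l != i ->
  \sum_m d m * tri i j l a b c m ^+ 2 = d i * a ^+ 2 + d j * b ^+ 2 + d l * c ^+ 2.
Proof.
move=> ij jl li; rewrite (bigD1 i) //= (bigD1 j) 1?eq_sym //= (bigD1 l) /=; last by rewrite li eq_sym jl.
rewrite big1 => [|m /andP[/andP[mi mj] ml]]; last first.
  by rewrite /tri (negbTE mi) (negbTE mj) (negbTE ml) expr0n mulr0.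
by rewrite /tri !eqxx (negbTE li) [j == i]eq_sym (negbTE ij) [l == j]eq_sym (negbTE jl) addr0 addrA.
Qed.

Lemma d_neq0 i : d i != 0.
Proof.
apply/eqP => di0; have := d_aniso (y := fun m => (m == i)%:R).
have -> : \sum_m d m * (m == i)%:R ^+ 2 = 0.
  apply: big1 => m _; case: eqP => [->|_]; first by rewrite di0 mul0r.
  by rewrite expr0n mulr0.
by move=> /(_ erefl i) /eqP; rewrite eqxx oner_eq0.
Qed.

Lemma pair_aniso i j : i != j -> forall x y, d i * x ^+ 2 + d j * y ^+ 2 = 0 -> x = 0.
Proof.
move=> ij x y h; have := d_aniso (y := fun m => if m == i then x else if m == j then y else 0).
rewrite (bigD1 i) //= (bigD1 j) 1?eq_sym //= big1 => [|m /andP[/negbTE mi /negbTE mj]]; last first.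
  by rewrite mi mj expr0n mulr0.
rewrite !eqxx [j == i]eq_sym (negbTE ij) addr0 => /(_ h i); by rewrite eqxx.
Qed.

Definition cls (b : bool) := [set i | par v (d i) == b].

Lemma cls_par b i : i \in cls b -> par v (d i) = b.
Proof. by rewrite inE => /eqP. Qed.

(** Two entries of one parity represent every element of that parity, in particular the negative of
    a third entry. *)
Lemma card_cls b : (#|cls b| <= 2)%N.
Proof.
rewrite leqNgt; apply/negP => /card_gt2P[i [j [l [[hi hj hl] [ij jl li]]]]].
move: hi hj hl; rewrite !inE => /eqP hi /eqP hj /eqP hl.
have [|||x [y hxy]] := binary_rep hd hc h2 hr u0 vu hu (d_neq0 i) (d_neq0 j) (c := - d l).
- by rewrite oppr_eq0 d_neq0.
- by rewrite (par_opp hd) hi hl.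
- by rewrite (par_opp hd) hj hl.
have := d_aniso (y := tri i j l x y 1); rewrite tri_sum // hxy expr1n mulr1 addNr.
move=> /(_ erefl l); rewrite /tri (negbTE li) [l == j]eq_sym (negbTE jl) eqxx => /eqP.
by rewrite oner_eq0.
Qed.

Lemma cls_sum : (n = #|cls true| + #|cls false|)%N.
Proof.
rewrite -[LHS]card_ord -(cardsC (cls true)).
congr (_ + _)%N; apply: eq_card => i; rewrite !inE; by case: (par _ _).
Qed.

Lemma diag_dim : (n <= 4)%N.
Proof. rewrite cls_sum; have := card_cls true; have := card_cls false; lia. Qed.

(** A block has at most two entries. With two, anisotropy makes it a multiple of a norm form
    [x ^ 2 - u * z ^ 2], whose nonzero values have even valuation. *)
Lemma cls_value b (y : 'I_n -> K) :
  \sum_(i in cls b) d i * y i ^+ 2 != 0 -> par v (\sum_(i in cls b) d i * y i ^+ 2) = b.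
Proof.
have psq (a t : K) : a != 0 -> t != 0 -> par v (a * t ^+ 2) = par v a.
  move=> a0 t0; rewrite /par (valM hv) ?expf_neq0 // (valX hv) //; lia.
have := card_cls b; case: (ltngtP #|cls b| 2) => // [c2 _|/eqP c2 _].
  case: (posnP #|cls b|) => [/eqP|c0].
    by rewrite cards_eq0 => /eqP ->; rewrite big_set0 eqxx.
  have /eqP/cards1P[i E] : #|cls b| = 1%N by lia.
  have pi : par v (d i) = b.
    by apply: cls_par; rewrite E set11.
  rewrite E big_set1 mulf_eq0 negb_or sqrf_eq0 => /andP[_ yi].
  by rewrite psq // d_neq0.
have /cards2P[i [j [ij E]]] := c2.
have pi : par v (d i) = b.
  by apply: cls_par; rewrite E !inE eqxx.
have pj : par v (d j) = b.
  by apply: cls_par; rewrite E !inE eqxx orbT.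
rewrite E big_setU1 ?inE // big_set1 /=.
have [m hm] : exists m, v (- d i / d j) = 2 * m.
  apply: (par_quot hd); rewrite ?oppr_eq0 ?d_neq0 //.
  by rewrite (par_opp hd) pi pj.
have ni : - d i / d j != 0 by rewrite mulf_neq0 ?invr_eq0 ?oppr_eq0 ?d_neq0.
have [s [s0 [hs|hs]]] := even_class hd hc h2 hr u0 vu hu ni hm.
  have /eqP : (1 : K) = 0.
    by apply: (pair_aniso ij (y := s)); rewrite -hs expr1n mulr1 [d j * _]mulrC divfK ?d_neq0 // subrr.
  by rewrite oner_eq0.
have dj : d j = - d i / (u * s ^+ 2).
  by rewrite -hs invf_div mulrCA mulfV ?mulr1 // oppr_eq0 d_neq0.
have -> : d i * y i ^+ 2 + d j * y j ^+ 2 = d i * (y i ^+ 2 - u * (y j / (u * s)) ^+ 2).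
  by rewrite dj; field; rewrite u0 s0.
rewrite mulf_eq0 negb_or => /andP[_ n0].
have := norm_par hd hr u0 vu hu n0; rewrite -pi /par (valM hv) ?d_neq0 //.
move: (v (d i)) (v (_ - _)) => p q; lia.
Qed.

(** The two blocks take values of different parity, so a represented c of parity b agrees to leading
    order with the value of block b. A block with a single entry d reaches only the square class of
    d to that precision and misses [u * d]; an empty block reaches nothing. *)
Lemma diag_universal : (forall c, c != 0 -> exists y : 'I_n -> K, \sum_i d i * y i ^+ 2 = c) -> (4 <= n)%N.
Proof.
move=> univ; suff h b : (2 <= #|cls b|)%N by rewrite cls_sum; have := h true; have := h false; lia.
rewrite leqNgt; apply/negP => lt.
have split_sum (y : 'I_n -> K) : \sum_i d i * y i ^+ 2 =
    \sum_(i in cls b) d i * y i ^+ 2 + \sum_(i in cls (~~ b)) d i * y i ^+ 2.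
  rewrite (bigID (mem (cls b))) /=; congr (_ + _); apply: eq_bigl => i; rewrite !inE.
  by case: (par _ _); case: (b).
have key c : c != 0 -> par v c = b -> exists y : 'I_n -> K,
    val_ge v (v c + 1) (c - \sum_(i in cls b) d i * y i ^+ 2).
  move=> c0 pc; have [y hy] := univ c c0; exists y.
  set S := \sum_(i in cls b) _; set T := \sum_(i in cls (~~ b)) d i * y i ^+ 2.
  have cE : c = S + T by rewrite -hy split_sum.
  have -> : c - S = T by rewrite cE addrC addKr.
  have [->|T0] := eqVneq T 0; first exact: val_ge0.
  have pT : par v T = ~~ b by apply: cls_value.
  have ne : v T <> v c by move=> h; move: pT; rewrite /par h -/(par v c) pc; case: (b).
  have [S0|S0] := eqVneq S 0; first by move: ne; rewrite cE S0 add0r.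
  have pS : par v S = b by apply: cls_value.
  have ne2 : v T <> v S by move=> h; move: pT; rewrite /par h -/(par v S) pS; case: (b).
  rewrite val_geE //; suff : v c < v T by lia.
  case: (ltgtP (v S) (v T)) => [h|h|h]; last by case: ne2.
    have gT : val_ge v (v S + 1) T by rewrite val_geE //; lia.
    by have [_] := val_addl hv S0 gT; rewrite -cE => ->.
  have gS : val_ge v (v T + 1) S by rewrite val_geE //; lia.
  by have [_] := val_addl hv T0 gS; rewrite addrC -cE => /esym.
case: (posnP #|cls b|) => [/eqP|c0].
  rewrite cards_eq0 => /eqP E0.
  have [pi [pi0 vpi]] := uniformizer_exists hd.
  pose c := pi ^+ b.
  have c0 : c != 0 by rewrite expf_neq0.
  have pc : par v c = b by rewrite /par (valX hv) // vpi; case: (b).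
  have [y] := key c c0 pc; rewrite E0 big_set0 subr0 val_geE //; lia.
have /eqP/cards1P[i E] : #|cls b| = 1%N by lia.
have pi : par v (d i) = b.
  by apply: cls_par; rewrite E set11.
have c1 : u * d i != 0 by rewrite mulf_neq0 ?d_neq0.
have pc : par v (u * d i) = b by rewrite /par (valM hv) ?d_neq0 // vu add0r.
have [y] := key _ c1 pc; rewrite E big_set1 => h.
have h' : val_ge v 1 (u - y i ^+ 2).
  move: h; have -> : u * d i - d i * y i ^+ 2 = d i * (u - y i ^+ 2) by ring.
  by rewrite (val_geMV hv) ?d_neq0 // (valM hv) ?d_neq0 // vu; apply: val_geW; lia.
have [iu _] := unit_res hr u0 vu.
have iy2 : val_ge v 0 (y i ^+ 2).
  have -> : y i ^+ 2 = u - (u - y i ^+ 2) by rewrite subKr.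
  by apply: (val_geB hv) => //; apply: val_geW h'.
have iy : val_ge v 0 (y i).
  have [->|y0] := eqVneq (y i) 0; first exact: val_ge0.
  by move: iy2; rewrite !val_geE ?expf_neq0 // (valX hv) //; lia.
have := hu (red (y i)); rewrite -(resX hv hr) // eq_sym (res_eq hv hr) //.
by rewrite h'.
Qed.

End DiagonalForms.

(** * Witt decomposition *)

Section FormAlgebra.
Variables (K : fieldType) (tau : {rmorphism K -> K}).
Local Notation fev := (form_eval tau).

Lemma fevDl n (H : 'M[K]_n) x y z : fev H (x + y) z = fev H x z + fev H y z.
Proof. by rewrite /form_eval map_mxD !mulmxDl mxE. Qed.

Lemma fevDr n (H : 'M[K]_n) x y z : fev H x (y + z) = fev H x y + fev H x z.
Proof. by rewrite /form_eval linearD /= mulmxDr mxE. Qed.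

Lemma fevZl n (H : 'M[K]_n) a x z : fev H (a *: x) z = tau a * fev H x z.
Proof. by rewrite /form_eval map_mxZ -!scalemxAl mxE. Qed.

Lemma fevZr n (H : 'M[K]_n) a x z : fev H x (a *: z) = a * fev H x z.
Proof. by rewrite /form_eval linearZ /= -scalemxAr mxE. Qed.

Lemma fev0l n (H : 'M[K]_n) z : fev H 0 z = 0.
Proof. by rewrite -(scale0r 0) fevZl rmorph0 mul0r. Qed.

Lemma fev0r n (H : 'M[K]_n) z : fev H z 0 = 0.
Proof. by rewrite -(scale0r 0) fevZr mul0r. Qed.

Lemma fevNr n (H : 'M[K]_n) x z : fev H x (- z) = - fev H x z.
Proof. by rewrite -scaleN1r fevZr mulN1r. Qed.

Lemma fevBr n (H : 'M[K]_n) x y z : fev H x (y - z) = fev H x y - fev H x z.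
Proof. by rewrite fevDr fevNr. Qed.

Lemma fev_sumr n (H : 'M[K]_n) (I : finType) x (f : I -> 'rV[K]_n) :
  fev H x (\sum_i f i) = \sum_i fev H x (f i).
Proof. by elim/big_ind2: _ => //; [rewrite fev0r | move=> ? ? ? ? <- <-; rewrite fevDr]. Qed.

Lemma fev_suml n (H : 'M[K]_n) (I : finType) x (f : I -> 'rV[K]_n) :
  fev H (\sum_i f i) x = \sum_i fev H (f i) x.
Proof. by elim/big_ind2: _ => //; [rewrite fev0l | move=> ? ? ? ? <- <-; rewrite fevDl]. Qed.

Lemma fev_mulmx n m (H : 'M[K]_n) (P : 'M[K]_(m, n)) x y :
  fev H (x *m P) (y *m P) = fev (map_mx tau P *m H *m P^T) x y.
Proof. by rewrite /form_eval map_mxM trmx_mul !mulmxA. Qed.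

Lemma fev_entry n r l (H : 'M[K]_n) (U : 'M[K]_(r, n)) (W : 'M[K]_(l, n)) i j :
  fev H (row i U) (row j W) = (map_mx tau U *m H *m W^T) i j.
Proof.
rewrite !rowE /form_eval map_mxM trmx_mul !mulmxA map_delta_mx trmx_delta -colE -!mulmxA.
by rewrite -rowE !mulmxA !mxE.
Qed.

Lemma fev_ext n (H G : 'M[K]_n) : (forall x y, fev H x y = fev G x y) -> H = G.
Proof.
move=> h; apply/matrixP => i j.
have := h (row i 1%:M) (row j 1%:M); rewrite !fev_entry map_mx1 trmx1.
by rewrite !mul1mx !mulmx1.
Qed.

Variable s : bool.
Local Notation sg := (sgn K s).

Lemma sgn_sqr : sg * sg = 1.
Proof. by rewrite /sgn -expr2 sqrr_sign. Qed.


Hypothesis tauK : involutive tau.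

Lemma map_mxK m n : cancel (map_mx tau : 'M[K]_(m, n) -> _) (map_mx tau).
Proof. by move=> A; rewrite -map_mx_comp map_mx_id. Qed.

Lemma fev_herm n (H : 'M[K]_n) x y : is_herm tau s H -> fev H x y = sg * tau (fev H y x).
Proof.
case=> hH _; have E : tau (fev H y x) = ((map_mx tau (map_mx tau y *m H *m x^T))^T) 0 0 by rewrite mxE mxE.
rewrite E !map_mxM map_mxK !trmx_mul -!map_trmx trmxK map_trmx /form_eval {1}hH.
by rewrite -scalemxAr -scalemxAl mxE mulmxA map_trmx.
Qed.

Lemma adjE m n (A : 'M[K]_(m, n)) i j : (sg *: (map_mx tau A)^T) i j = sg * tau (A j i).
Proof. by rewrite !mxE. Qed.

Lemma gram_herm m n (H : 'M[K]_n) (P : 'M[K]_(m, n)) : is_herm tau s H ->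
  map_mx tau P *m H *m P^T = sg *: (map_mx tau (map_mx tau P *m H *m P^T))^T.
Proof.
by move=> hH; apply/matrixP => i j; rewrite adjE -fev_entry (fev_herm _ _ hH) fev_entry.
Qed.

Lemma fev_nondeg n (H : 'M[K]_n) y : H \in unitmx -> (forall x, fev H x y = 0) -> y = 0.
Proof.
move=> uH h; suff : H *m y^T = 0.
  by move/(congr1 (mulmx (invmx H))); rewrite mulKmx // mulmx0 => /(congr1 trmx); rewrite trmxK trmx0.
apply/matrixP => i j; have := h (delta_mx 0 i).
by rewrite /form_eval map_delta_mx -mulmxA -rowE !mxE !ord1.
Qed.

End FormAlgebra.

Section Witt.
Variables (K : fieldType) (tau : {rmorphism K -> K}) (s : bool).
Hypothesis tauK : involutive tau.
Hypothesis n2 : (2%:R : K) != 0.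
Local Notation fev := (form_eval tau).
Local Notation sg := (sgn K s).

Definition totiso n (H : 'M[K]_n) r (U : 'M[K]_(r, n)) :=
  row_free U /\ map_mx tau U *m H *m U^T = 0.

Lemma max_nat (P : nat -> Prop) n : P 0%N -> (forall r, P r -> (r <= n)%N) ->
  exists r, P r /\ ~ P r.+1.
Proof.
move=> P0 Pn; apply: NNPP => h.
have all r : P r.
  elim: r => // r Pr; apply: NNPP => nP; apply: h; by exists r.
by have := Pn _ (all n.+1); rewrite ltnn.
Qed.

Lemma totiso_max n (H : 'M[K]_n) : exists r (U : 'M[K]_(r, n)), totiso H U /\
  forall U' : 'M[K]_(r.+1, n), ~ totiso H U'.
Proof.
have [||r [[U hU] hmax]] := @max_nat (fun r => exists U : 'M[K]_(r, n), totiso H U) n.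
- exists 0; split; first by rewrite /row_free mxrank0.
  by apply/matrixP; case.
- by move=> r [U [/eqP rU _]]; have := rank_leq_col U; rewrite rU.
by exists r, U; split=> // U' h; apply: hmax; exists U'.
Qed.

Lemma hyp_unit k : hyp_mx K s k \in unitmx.
Proof.
suff /mulmx1_unit[] : hyp_mx K s k *m (sg *: hyp_mx K s k) = 1%:M by [].
rewrite -scalemxAr /hyp_mx mulmx_block !mul0mx !mulmx0 !mul1mx !mulmx1 !addr0 !add0r.
by rewrite scale_block_mx !scaler0 scalerA sgn_sqr scale1r scalar_mx_block.
Qed.

(* Correcting a dual family W0 of U by -(1/2) tau(G) U, with G its Gram matrix, makes it isotropic. *)
Lemma dual_isotropic n (H : 'M[K]_n) r (U : 'M[K]_(r, n)) : is_herm tau s H -> totiso H U ->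
  exists W : 'M[K]_(r, n), map_mx tau (col_mx U W) *m H *m (col_mx U W)^T = hyp_mx K s r.
Proof.
move=> hH [fU UU]; have uH := hH.2.
have /row_freeP[X hX] : row_free (map_mx tau U *m H).
  by rewrite /row_free mxrankMfree ?row_free_unit // mxrank_map; apply: fU.
pose W0 := X^T; pose G := map_mx tau W0 *m H *m W0^T.
have UW0 : map_mx tau U *m H *m W0^T = 1%:M by rewrite trmxK.
have herm2 m1 m2 (A : 'M[K]_(m1, n)) (B : 'M[K]_(m2, n)) :
    map_mx tau A *m H *m B^T = sg *: (map_mx tau (map_mx tau B *m H *m A^T))^T.
  by apply/matrixP => i j; rewrite adjE -fev_entry (fev_herm tauK _ _ hH) fev_entry.
have W0U : map_mx tau W0 *m H *m U^T = sg%:M.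
  by rewrite herm2 UW0 map_mx1 trmx1 scalemx1.
have GG : G = sg *: (map_mx tau G)^T by exact: herm2.
have th : tau 2%:R^-1 = 2%:R^-1 by rewrite fmorphV rmorph_nat.
pose C := - (2%:R^-1 *: map_mx tau G).
pose W := W0 + C *m U.
have tC : map_mx tau C = - (2%:R^-1 *: G) by rewrite map_mxN map_mxZ th map_mxK.
have tW : map_mx tau W = map_mx tau W0 + map_mx tau C *m map_mx tau U by rewrite map_mxD map_mxM.
have UW : map_mx tau U *m H *m W^T = 1%:M.
  by rewrite linearD /= mulmxDr UW0 trmx_mul mulmxA UU mul0mx addr0.
have WU : map_mx tau W *m H *m U^T = sg%:M by rewrite herm2 UW map_mx1 trmx1 scalemx1.
have WW : map_mx tau W *m H *m W^T = 0.
  rewrite {2}/W linearD /= mulmxDr trmx_mul mulmxA WU mul_scalar_mx tW !mulmxDl -/G.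
  rewrite -!(mulmxA (map_mx tau C)) UW0 mulmx1 tC linearN /=.
  have -> : (2%:R^-1 *: map_mx tau G)^T = 2%:R^-1 *: (map_mx tau G)^T by exact: linearZ.
  rewrite scalerN scalerA [sg * _]mulrC -scalerA -GG -addrA -opprD -scalerDl.
  have -> : 2%:R^-1 + 2%:R^-1 = 1 :> K by field.
  by rewrite scale1r subrr.
exists W; rewrite map_col_mx tr_col_mx mul_col_mx mul_col_row UU UW WU WW /hyp_mx.
by rewrite scalemx1.
Qed.

Lemma gram_col n (H : 'M[K]_n) r1 r2 (A : 'M[K]_(r1, n)) (B : 'M[K]_(r2, n)) :
  map_mx tau A *m H *m A^T = 0 -> map_mx tau A *m H *m B^T = 0 ->
  map_mx tau B *m H *m A^T = 0 -> map_mx tau B *m H *m B^T = 0 ->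
  map_mx tau (col_mx A B) *m H *m (col_mx A B)^T = 0.
Proof.
move=> h1 h2 h3 h4.
by rewrite map_col_mx tr_col_mx mul_col_mx mul_col_row h1 h2 h3 h4 block_mx0.
Qed.

Lemma isometric_cast n N (e : N = n) (H : 'M[K]_n) (P : 'M[K]_(N, n)) (G : 'M[K]_N) :
  row_free P -> map_mx tau P *m H *m P^T = G -> isometric tau H (castmx (e, e) G).
Proof.
case: n / e H P => H P fP <-; exists P; first by rewrite -row_free_unit.
by rewrite castmx_id.
Qed.

Lemma castmx_unit n N (e : N = n) (G : 'M[K]_N) : (castmx (e, e) G \in unitmx) = (G \in unitmx).
Proof. by case: n / e; rewrite castmx_id. Qed.

(** A maximal totally isotropic U and a dual family span a hyperbolic space; an isotropic vector in
    its orthogonal complement could be added to U. *)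
Lemma aniso_kernel_exists n (H : 'M[K]_n) : is_herm tau s H ->
  exists m (A : 'M[K]_m), aniso_kernel tau s H A.
Proof.
move=> hH; have uH := hH.2.
have [r [U [[fU UU] Umax]]] := totiso_max H.
have [W SS] := dual_isotropic hH (conj fU UU).
set S := col_mx U W in SS.
(* The form conjugates its first argument, so the complement is spanned by the conjugates of the
   kernel rows. *)
have [m [Cm [mE fC CS]]] : exists m (Cm : 'M[K]_(m, n)),
    [/\ m = \rank (kermx (H *m S^T)), row_free Cm & map_mx tau Cm *m H *m S^T = 0].
  exists _, (map_mx tau (row_base (kermx (H *m S^T)))); split=> //.
    by rewrite /row_free mxrank_map; apply: row_base_free.
  by rewrite map_mxK // -mulmxA; apply/sub_kermxP; rewrite eq_row_base.
have SC : map_mx tau S *m H *m Cm^T = 0.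
  apply/matrixP => i j; rewrite -fev_entry (fev_herm tauK _ _ hH) fev_entry CS !mxE.
  by rewrite rmorph0 mulr0.
pose A := map_mx tau Cm *m H *m Cm^T; pose P := col_mx Cm S.
have PP : map_mx tau P *m H *m P^T = block_mx A 0 0 (hyp_mx K s r).
  by rewrite map_col_mx tr_col_mx mul_col_mx mul_col_row CS SC SS.
have fP : row_free P.
  apply: inj_row_free => x; rewrite -[x]hsubmxK mul_row_col => h.
  have x2 : rsubmx x = 0.
    have : map_mx tau (lsubmx x *m Cm + rsubmx x *m S) *m H *m S^T = 0 by rewrite h map_mx0 !mul0mx.
    rewrite map_mxD !map_mxM !mulmxDl -!mulmxA (mulmxA _ H) CS mulmx0 add0r (mulmxA _ H) SS.
    move/(congr1 (mulmx^~ (invmx (hyp_mx K s r)))); rewrite mulmxK ?hyp_unit // mul0mx.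
    by move/(congr1 (map_mx tau)); rewrite map_mxK // map_mx0.
  move: h; rewrite x2 mul0mx addr0 => h.
  have -> : lsubmx x = 0 by apply: (row_free_inj fC); rewrite h mul0mx.
  by rewrite row_mx0.
have hN : (m + (r + r))%N = n.
  apply/eqP; rewrite eqn_leq -{1}(eqP fP) rank_leq_col mE mxrank_ker.
  have := rank_leq_col (H *m S^T); lia.
have detA : A \in unitmx.
  have uP := isometric_cast hN fP PP; have [Q uQ QE] := uP.
  have : block_mx A 0 0 (hyp_mx K s r) \in unitmx.
    have : castmx (hN, hN) (block_mx A 0 0 (hyp_mx K s r)) \in unitmx.
      by rewrite -QE !unitmx_mul map_unitmx unitmx_tr uQ uH.
    by rewrite castmx_unit.
  by rewrite unitmxE det_ublock unitrM -!unitmxE => /andP[].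
exists m, A; split; [split|split].
- exact: gram_herm.
- exact: detA.
- move=> x hx; apply: NNPP => /eqP x0.
  apply: (Umax (col_mx (x *m Cm) U)); split.
    suff key (y : 'rV_(1 + r)) : y *m col_mx (x *m Cm) U = 0 -> y = 0 by apply: inj_row_free.
    rewrite -[y]hsubmxK; move: (lsubmx y) (rsubmx y) => a b.
    rewrite mul_row_col mulmxA => h.
    have : row_mx (a *m x) (row_mx b 0) *m P = 0 by rewrite !mul_row_col mul0mx addr0.
    rewrite -[RHS](mul0mx _ P) => /(row_free_inj fP); rewrite -[RHS]row_mx0 => /eq_row_mx[hl].
    rewrite -[RHS]row_mx0 => /eq_row_mx[-> _].
    move: hl; rewrite [a]mx11_scalar mul_scalar_mx => /eqP.
    by rewrite scaler_eq0 (negbTE x0) orbF => /eqP ->; rewrite raddf0 row_mx0.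
  have Z1 : map_mx tau Cm *m H *m U^T = 0.
    by move: CS; rewrite tr_col_mx mul_mx_row -[RHS]row_mx0 => /eq_row_mx[].
  have Z2 : map_mx tau U *m H *m Cm^T = 0.
    by move: SC; rewrite map_col_mx !mul_col_mx -[RHS]col_mx0 => /eq_col_mx[].
  apply: (gram_col (A := x *m Cm)) => //; rewrite ?map_mxM ?trmx_mul.
  - apply/matrixP => i j; rewrite !ord1 [RHS]mxE -[RHS]hx /form_eval /A !mulmxA //.
  - by rewrite -!mulmxA (mulmxA _ H) Z1 mulmx0.
  - by rewrite mulmxA Z2 mul0mx.
- by exists r, hN; apply: isometric_cast PP.
Qed.

(* U /\ M pairs trivially with U, so the pairing of U with M has rank at most l - dim (U /\ M). *)
Lemma isotropic_complement n (H : 'M[K]_n) r l (U : 'M[K]_(r, n)) (M : 'M[K]_(l, n)) :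
  is_herm tau s H -> totiso H U -> totiso H M ->
  exists W : 'M[K]_(r - l, n), [/\ (W <= U)%MS, map_mx tau W *m H *m M^T = 0
    & forall c : 'rV[K]_(r - l), (c *m W <= M)%MS -> c = 0].
Proof.
clear n2; move=> hH [fU UU] [fM MM].
pose Z := map_mx tau U *m H *m M^T.
pose UK := map_mx tau (kermx Z) *m U.
have UKM : map_mx tau UK *m H *m M^T = 0.
  by rewrite map_mxM map_mxK // -(mulmx_ker Z); move: (kermx Z) => X; rewrite /Z !mulmxA.
have rUK : \rank UK = (r - \rank Z)%N.
  by rewrite mxrankMfree // mxrank_map mxrank_ker.
have rcap : (\rank (UK :&: M) + \rank Z <= l)%N.
  have /submxP[D hD] : (UK :&: M <= M)%MS by apply: capmxSr.
  have /submxP[D' hD'] : (UK :&: M <= U)%MS.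
    by apply: submx_trans (capmxSl _ _) _; apply: submxMl.
  have ZD : Z *m D^T = 0.
    by rewrite /Z -!mulmxA -trmx_mul -hD hD' trmx_mul !mulmxA UU mul0mx.
  have : (\rank (UK :&: M) <= \rank D)%N by rewrite hD; apply: mxrankM_maxl.
  have := mulmx0_rank_max ZD; rewrite mxrank_tr; lia.
have := mxrank_cap_compl UK M; rewrite rUK.
set X := (UK :\: M)%MS => rX.
have hr : (r - l <= \rank X)%N by have := rank_leq_row Z; lia.
pose W : 'M[K]_(r - l, n) := (pid_mx (r - l) : 'M_(r - l, \rank X)) *m row_base X.
have WX : (W <= X)%MS by rewrite (submx_trans (submxMl _ _)) // eq_row_base.
have WUK : (W <= UK)%MS by apply: submx_trans WX (diffmxSl _ _).
exists W; split.
- by apply: submx_trans WUK (submxMl _ _).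
- have /submxP[D ->] := WUK; by rewrite map_mxM -!mulmxA (mulmxA (map_mx tau UK)) UKM mulmx0.
move=> c cM.
have : (c *m W <= X :&: M)%MS by rewrite sub_capmx cM (submx_trans (submxMl _ _)).
rewrite capmx_diff submx0 mulmxA => /eqP h.
have h1 : c *m (pid_mx (r - l) : 'M_(r - l, \rank X)) = 0.
  by apply: (row_free_inj (row_base_free X)); rewrite h mul0mx.
have fp : row_free (pid_mx (r - l) : 'M[K]_(r - l, \rank X)).
  by rewrite /row_free rank_pid_mx.
by apply: (row_free_inj fp); rewrite h1 mul0mx.
Qed.

End Witt.

(** * Anisotropic symmetric forms over a local field *)

Section SymmetricForms.
Variable K : fieldType.
Local Notation bf := (form_eval (idfun : {rmorphism K -> K})).
Local Notation sym B := (is_herm (idfun : {rmorphism K -> K}) false B).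
Local Notation aniso B := (anisotropic (idfun : {rmorphism K -> K}) B).

Lemma idfun_invol : involutive (idfun : {rmorphism K -> K}). Proof. by []. Qed.

Lemma sgn_false : sgn K false = 1. Proof. by rewrite /sgn expr0. Qed.

Lemma bf_sym n (B : 'M[K]_n) x y : sym B -> bf B x y = bf B y x.
Proof. by move=> hB; rewrite (fev_herm idfun_invol _ _ hB) sgn_false mul1r. Qed.

Lemma bfE n (B : 'M[K]_n) x y : bf B x y = (x *m B *m y^T) 0 0.
Proof. by rewrite /form_eval map_mx_id. Qed.

Lemma orthogonal_family n (B : 'M[K]_n) : sym B -> aniso B -> forall j, (j <= n)%N ->
  exists f : 'I_j -> 'rV[K]_n, (forall i, f i != 0) /\
    forall i i', i != i' -> bf B (f i) (f i') = 0.
Proof.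
move=> hB an; elim=> [|j IH] jn.
  by exists (fun=> 0); split=> [[]|[]].
have [f [f0 ff]] := IH (ltnW jn).
pose A := \matrix_i f i.
have [x x0 hx] : exists2 x : 'rV[K]_n, x != 0 & x *m (B *m A^T) = 0.
  have kn0 : kermx (B *m A^T) != 0.
    by rewrite -mxrank_eq0 mxrank_ker -lt0n subn_gt0; apply: leq_ltn_trans (rank_leq_col _) jn.
  by have /rowV0Pn[x /sub_kermxP hx x0] := kn0; exists x.
have xf i : bf B x (f i) = 0.
  rewrite bfE; have -> : (f i)^T = A^T *m delta_mx i 0 by rewrite -colE -tr_row rowK.
  by rewrite !mulmxA -(mulmxA x) hx mul0mx mxE.
exists (fun i => if unlift ord_max i is Some i' then f i' else x); split=> [i|i i'].
  by case: unliftP.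
case: (unliftP ord_max i) => [a ->|->]; case: (unliftP ord_max i') => [b ->|->].
- by move=> ab; apply: ff; apply: contraNneq ab => ->.
- by rewrite bf_sym.
- by [].
- by rewrite eqxx.
Qed.

Lemma orthogonal_basis n (B : 'M[K]_n) : sym B -> aniso B ->
  exists P (d : 'I_n -> K), P \in unitmx /\
    forall i j, bf B (row i P) (row j P) = if i == j then d i else 0.
Proof.
move=> hB an; have [f [f0 ff]] := orthogonal_family hB an (leqnn n).
have E i j : bf B (row i (\matrix_i f i)) (row j (\matrix_i f i)) = if i == j then bf B (f i) (f i) else 0.
  by rewrite !rowK; case: eqVneq => [->//|]; apply: ff.
exists (\matrix_i f i), (fun i => bf B (f i) (f i)); split=> //.
rewrite -row_free_unit; apply: inj_row_free => c hc; apply/rowP => i; rewrite [RHS]mxE.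
have : bf B (f i) (c *m (\matrix_i f i)) = 0 by rewrite hc fev0r.
rewrite mulmx_sum_row fev_sumr (bigD1 i) //= big1 => [|j ji]; last first.
  by rewrite fevZr rowK ff ?mulr0 // eq_sym.
rewrite fevZr rowK addr0 => /eqP; rewrite mulf_eq0 => /orP[/eqP //|/eqP/an h].
by have := f0 i; rewrite h eqxx.
Qed.

Lemma orth_value n (B P : 'M[K]_n) (d : 'I_n -> K) (y : 'rV[K]_n) :
  (forall i j, bf B (row i P) (row j P) = if i == j then d i else 0) ->
  bf B (y *m P) (y *m P) = \sum_i d i * y 0 i ^+ 2.
Proof.
move=> E; rewrite mulmx_sum_row fev_suml; apply: eq_bigr => i _.
rewrite fev_sumr (bigD1 i) //= big1 => [|j ji]; last first.
  by rewrite fevZl fevZr E eq_sym (negbTE ji) !mulr0.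
by rewrite fevZl fevZr E eqxx /=; ring.
Qed.

Lemma orth_aniso n (B P : 'M[K]_n) (d : 'I_n -> K) : aniso B -> P \in unitmx ->
  (forall i j, bf B (row i P) (row j P) = if i == j then d i else 0) ->
  forall y : 'I_n -> K, \sum_i d i * y i ^+ 2 = 0 -> forall i, y i = 0.
Proof.
move=> an uP E y hy i.
have : (\row_i y i) *m P = 0.
  apply: an; rewrite (orth_value _ E) -[RHS]hy; apply: eq_bigr => j _; by rewrite mxE.
move/(congr1 (mulmx^~ (invmx P))); rewrite mulmxK // mul0mx => /rowP/(_ i).
by rewrite !mxE.
Qed.

(** The norm form of the quaternion algebra (u, -pi), a division algebra when u is a unit with
    nonsquare residue and pi a uniformizer. *)
Definition norm_diag (u pi : K) : 'M[K]_4 :=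
  diag_mx (\row_(i < 4) nth 0 [:: 1; - u; pi; - u * pi] i).

Variable v : K -> int.
Hypothesis hd : is_discrete_valuation v.
Hypothesis hc : val_complete v.
Hypothesis h2 : odd_residue_char v.
Variables (k : finFieldType) (red : K -> k).
Hypothesis hr : residue_map v red.
Let hv := discrete_valuation hd.
Variable u : K.
Hypothesis u0 : u != 0.
Hypothesis vu : v u = 0.
Hypothesis hu : forall x : k, x ^+ 2 != red u.

Lemma quad_dim_aux n (B : 'M[K]_n) : sym B -> aniso B -> (n <= 4)%N.
Proof.
move=> hB an; have [P [d [uP E]]] := orthogonal_basis hB an.
exact: (diag_dim hd hc h2 hr u0 vu hu (orth_aniso an uP E)).
Qed.

Lemma quad_universal_aux n (B : 'M[K]_n) : sym B -> aniso B ->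
  (forall c, c != 0 -> exists x, bf B x x = c) -> (4 <= n)%N.
Proof.
move=> hB an univ; have [P [d [uP E]]] := orthogonal_basis hB an.
apply: (diag_universal hd hc h2 hr u0 vu hu (orth_aniso an uP E)) => c /univ[x hx].
exists (fun i => (x *m invmx P) 0 i); by rewrite -(orth_value _ E) mulmxKV.
Qed.

(** Each parity occurs exactly twice among the diagonal entries. By [plane_norm] the even plane is
    <1, -u> and the odd one <pi, -u pi>. *)
Lemma quad_normal (B : 'M[K]_4) (pi : K) : sym B -> aniso B -> pi != 0 -> v pi = 1 ->
  exists2 P, P \in unitmx & P *m B *m P^T = norm_diag u pi.
Proof.
move=> hB an pi0 vpi; have [P0 [d [uP E]]] := orthogonal_basis hB an.
have da := orth_aniso an uP E.
have dn := d_neq0 da.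
have c1 := card_cls hd hc h2 hr u0 vu hu da true.
have c2 := card_cls hd hc h2 hr u0 vu hu da false.
have cs := cls_sum v d.
have /eqP/cards2P[i [j [ij Ef]]] : #|cls v d false| = 2%N by lia.
have /eqP/cards2P[l [m [lm Et]]] : #|cls v d true| = 2%N by lia.
have pF a : (a \in [set i; j]) -> par v (d a) = false by rewrite -Ef; apply: cls_par.
have pT a : (a \in [set l; m]) -> par v (d a) = true by rewrite -Et; apply: cls_par.
have p1 : par v 1 = false by rewrite /par (val1 hv).
have pp : par v pi = true by rewrite /par vpi.
have pi' := pF i; have pj := pF j; have pl := pT l; have pm := pT m.
rewrite !inE !eqxx ?orbT in pi' pj pl pm.
have {}pi' := pi' isT; have {}pj := pj isT; have {}pl := pl isT; have {}pm := pm isT.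
have ne a b : par v (d a) = false -> par v (d b) = true -> (a == b) = false.
  by move=> h h'; apply/eqP => ab; move: h; rewrite ab h'.
have [x [y [x' [y' [A1 A2 A3]]]]] := plane_norm hd hc h2 hr u0 vu hu (dn i) (dn j) (oner_neq0 K)
  (etrans pi' (esym p1)) (etrans pj (esym p1)) (pair_aniso da ij).
have [z [w [z' [w' [B1 B2 B3]]]]] := plane_norm hd hc h2 hr u0 vu hu (dn l) (dn m) pi0
  (etrans pl (esym pp)) (etrans pm (esym pp)) (pair_aniso da lm).
pose g a b s t := s *: row a P0 + t *: row b P0.
have gE a b a' b' s t s' t' : bf B (g a b s t) (g a' b' s' t') =
   s * s' * (if a == a' then d a else 0) + s * t' * (if a == b' then d a else 0)
   + t * s' * (if b == a' then d b else 0) + t * t' * (if b == b' then d b else 0).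
  by rewrite /g !fevDl !fevDr !fevZl !fevZr !E /=; ring.
have ne' a b : par v (d a) = true -> par v (d b) = false -> (a == b) = false.
  by move=> h h'; rewrite eq_sym; apply: ne.
have gs a b s t s' t' : a != b -> bf B (g a b s t) (g a b s' t') = d a * s * s' + d b * t * t'.
  by move=> ab; rewrite gE !eqxx [b == a]eq_sym (negbTE ab); ring.
have gc a b a' b' s t s' t' : par v (d a) = false -> par v (d b) = false ->
    par v (d a') = true -> par v (d b') = true -> bf B (g a b s t) (g a' b' s' t') = 0.
  by move=> h1 h3 h4 h5; rewrite gE !ne // !mulr0 !addr0.
have gc' a b a' b' s t s' t' : par v (d a) = true -> par v (d b) = true ->
    par v (d a') = false -> par v (d b') = false -> bf B (g a b s t) (g a' b' s' t') = 0.
  by move=> h1 h3 h4 h5; rewrite gE !ne' // !mulr0 !addr0.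
pose P := \matrix_(r < 4) nth 0 [:: g i j x y; g i j x' y'; g l m z w; g l m z' w'] r.
have PP : P *m B *m P^T = norm_diag u pi.
  apply/matrixP => r c; have := fev_entry (idfun : {rmorphism K -> K}) B P P r c.
  rewrite map_mx_id // => <-; rewrite !rowK /norm_diag !mxE.
  case: r => -[|[|[|[|r]]]] //= ?; case: c => -[|[|[|[|c]]]] //= ?;
    rewrite ?mulr0n ?mulr1n ?(gs _ _ _ _ _ _ ij) ?(gs _ _ _ _ _ _ lm)
      ?(gc _ _ _ _ _ _ _ _ pi' pj pl pm) ?(gc' _ _ _ _ _ _ _ _ pl pm pi' pj) //;
    first [by rewrite -A1; ring | by rewrite -A2; ring | by rewrite -[RHS]mulr1 -A3; ring
         | by rewrite -B1; ring | by rewrite -B2; ring | by rewrite -B3; ring].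
exists P => //; rewrite unitmxE unitfE; apply/negP => /eqP h0.
have := congr1 determinant PP; rewrite !det_mulmx h0 !mul0r det_diag => /esym/eqP.
by rewrite !big_ord_recl big_ord0 !mxE /= !mulf_eq0 oner_eq0 oppr_eq0 (negbTE u0) (negbTE pi0).
Qed.

(** B and its multiple by c share the normal form [norm_diag u pi]. *)
Lemma quad_scale_aux (B : 'M[K]_4) (c : K) : sym B -> aniso B -> c != 0 ->
  exists2 P, P \in unitmx & P *m (c *: B) *m P^T = B.
Proof.
move=> hB an c0; have [pi [pi0 vpi]] := uniformizer_exists hd.
have [P uP hP] := quad_normal hB an pi0 vpi.
have [||Q uQ hQ] := @quad_normal (c *: B) pi _ _ pi0 vpi.
- split; last by rewrite unitmxZ ?unitfE //; case: hB.
  by rewrite {1}hB.1 !sgn_false !scale1r map_mxZ linearZ /= map_mx_id.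
- move=> x; rewrite bfE -scalemxAr -scalemxAl mxE -bfE => /eqP.
  by rewrite mulf_eq0 (negbTE c0) => /eqP/an.
exists (invmx P *m Q); first by rewrite unitmx_mul unitmx_inv uP uQ.
rewrite trmx_mul !mulmxA -(mulmxA (invmx P)) -(mulmxA _ _ Q^T) hQ -hP.
by rewrite !mulmxA mulVmx // mul1mx -mulmxA -trmx_mul mulVmx // trmx1 mulmx1.
Qed.

End SymmetricForms.

(** * Counting zeros, and extending functionals on lattices *)

HB.instance Definition _ (A B : finZmodType) := Finite.on (A * B)%type.

Section Counting.

(** On a coset of T other than T itself, translation by a t with [b z t = a] raises f by a, so the
    value a occurs exactly as often as 0. On T only 0 occurs, which makes the inequality strict. *)
Lemma isotropic_count (G Q : finZmodType) (f : G -> Q) (b : G -> G -> Q) (T : {set G}) (a : Q) :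
  a != 0 -> 0 \in T -> (forall x y, x \in T -> y \in T -> x - y \in T) ->
  (forall t, t \in T -> f t = 0) ->
  (forall z t, t \in T -> f (z + t) = f z + b z t) ->
  (forall z t t', t \in T -> t' \in T -> b z (t + t') = b z t + b z t') ->
  (forall z, z \notin T -> exists2 t, t \in T & b z t = a) ->
  (\sum_z (f z == a) < \sum_z (f z == 0%R))%N.
Proof.
move=> a0 T0 TB fT fb bD hT.
have TN x : x \in T -> - x \in T by move=> hx; rewrite -[- x]add0r TB.
have TD x y : x \in T -> y \in T -> x + y \in T by move=> hx hy; rewrite -[y]opprK TB ?TN.
(* Summing over all translates [z + T] counts each element [#|T|] times and avoids coset
   representatives. *)
have avg c : (#|T| * \sum_z (f z == c) = \sum_z \sum_(t in T) (f (z + t)%R == c))%N.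
  rewrite exchange_big /= -sum_nat_const; apply: eq_bigr => t _.
  by rewrite (reindex_inj (addIr t)).
suff : (#|T| * \sum_z (f z == a) < #|T| * \sum_z (f z == 0%R))%N by rewrite ltn_mul2l => /andP[].
rewrite !avg (bigD1 0) //= [X in (_ < X)%N](bigD1 0) //= -addSn.
apply: leq_add.
  rewrite big1 => [|t tT]; last by rewrite add0r fT // eq_sym (negbTE a0).
  by rewrite (bigD1 0) //= add0r fT // eqxx.
apply: leq_sum => z _.
have [zT|zT] := boolP (z \in T).
  rewrite big1 // => t tT; by rewrite fT ?TD // eq_sym (negbTE a0).
have [t0 t0T bt0] := hT z zT.
rewrite (reindex_inj (addIr t0)) /=.
rewrite (eq_bigl (mem T)) => [|t]; last first.
  apply/idP/idP => h; last exact: TD.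
  by have := TB _ _ h t0T; rewrite addrK.
apply: leq_sum => t tT.
by rewrite fb ?TD // bD // bt0 addrA -fb // -subr_eq0 addrK.
Qed.

Variables (k : finFieldType) (Q : finZmodType).
Hypothesis k2 : (2%:R : k) != 0.
Variable u : k.
Hypothesis u0 : u != 0.
Hypothesis hu : forall x, x ^+ 2 != u.
Variable mu : k -> Q.
Hypothesis muD : forall x y, mu (x + y) = mu x + mu y.
Variables (a : Q) (a' : k).
Hypothesis a0 : a != 0.
Hypothesis mua : mu a' = a.

Let fa (z : k * k) := mu (z.1 ^+ 2 - u * z.2 ^+ 2).
Let fh (z : k * k) := mu (z.1 ^+ 2 - z.2 ^+ 2).

Lemma sum_sq (g : k -> nat) c :
  (\sum_y g (c * y ^+ 2)%R = \sum_s #|[set y : k | (c * y ^+ 2 == s)%R]| * g s)%N.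
Proof.
rewrite (partition_big (fun y => c * y ^+ 2) xpredT) //=; apply: eq_bigr => s _.
rewrite -sum1_card big_distrl /=; apply: eq_big => [y|y /eqP ->]; first by rewrite inE.
by rewrite mul1n.
Qed.

(** For fixed x, [y ^ 2] and [u * y ^ 2] together hit every s exactly twice, so the total depends
    only on the size of the fibre of mu over c. *)
Lemma count_balance c :
  (\sum_z (fa z == c) + \sum_z (fh z == c) = #|k| * (2 * \sum_s (mu s == c)))%N.
Proof.
rewrite -(pair_bigA _ (fun x y => (fa (x, y) == c : nat))) -(pair_bigA _ (fun x y => (fh (x, y) == c : nat))).
rewrite -big_split -sum_nat_const /=; apply: eq_bigr => x _; rewrite /fa /fh /=.
pose g (s : k) : nat := mu (x ^+ 2 - s) == c.
have h1 : (\sum_y (mu (x ^+ 2 - y ^+ 2)%R == c) = \sum_y g (1 * y ^+ 2)%R)%N.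
  by apply: eq_bigr => y _; rewrite /g mul1r.
rewrite h1 (sum_sq g 1) -/(g _) (sum_sq g u) -big_split big_distrr /=.
transitivity (\sum_s 2 * g s)%N.
  apply: eq_bigr => s _; rewrite -mulnDl; congr (_ * _)%N.
  rewrite addnC; apply: etrans (count_sq k2 u0 hu s); congr (_ + _)%N.
  by apply: eq_card => y; rewrite !inE mul1r.
rewrite (reindex_inj (h := fun s => x ^+ 2 - s)) /=; last by move=> s t /addrI /oppr_inj.
by apply: eq_bigr => s _; rewrite /g subKr.
Qed.

Lemma fiber_shift : (\sum_s (mu s == a) = \sum_s (mu s == 0%R))%N.
Proof.
rewrite (reindex_inj (addIr a')) /=; apply: eq_bigr => s _.
by rewrite muD mua -subr_eq0 addrK.
Qed.

Lemma muN x : mu (- x) = - mu x.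
Proof.
have mu0 : mu 0 = 0 by apply: (addrI (mu 0)); rewrite -muD !addr0.
by apply/eqP; rewrite -addr_eq0 -muD addNr mu0.
Qed.

(* The zero counts of the anisotropic plane and of the hyperbolic plane add up to
   the average, while a Lagrangian would push each of them above it. *)
Lemma no_finite_lagrangian (T : {set k * k}) :
  0 \in T -> (forall x y, x \in T -> y \in T -> x - y \in T) ->
  (forall t, t \in T -> fa t = 0) ->
  (forall z, z \notin T -> exists2 t, t \in T & mu (2%:R * (z.1 * t.1 - u * (z.2 * t.2))) = a) -> False.
Proof.
move=> T0 TB fT hT.
have A : (\sum_z (fa z == a) < \sum_z (fa z == 0%R))%N.
  apply: (@isotropic_count _ _ fa (fun z t => mu (2%:R * (z.1 * t.1 - u * (z.2 * t.2)))) T a) => //.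
  - move=> z t tT; rewrite -[RHS]addr0 -(fT t tT) /fa -!muD; congr mu; rewrite /=; ring.
  - by move=> z t t' _ _; rewrite -muD; congr mu; rewrite /=; ring.
have B : (\sum_z (fh z == a) < \sum_z (fh z == 0%R))%N.
  apply: (@isotropic_count _ _ fh (fun z t => mu (2%:R * (z.1 * t.1 - z.2 * t.2))) [set t | t.1 == t.2] a) => //.
  - by rewrite inE.
  - by move=> x y; rewrite !inE => /eqP e1 /eqP e2; rewrite /= e1 e2.
  - by move=> t; rewrite inE /fh => /eqP ->; rewrite subrr -[0](subrr 0) muD muN subrr.
  - move=> z t; rewrite inE => /eqP e; rewrite /fh -muD; congr mu; rewrite /= e; ring.
  - by move=> z t t' _ _; rewrite -muD; congr mu; rewrite /=; ring.
  - move=> z; rewrite inE -subr_eq0 => z0; pose s := a' / (2%:R * (z.1 - z.2)).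
    exists (s, s); first by rewrite inE.
    by rewrite -mua; congr mu; rewrite /s /=; field; rewrite z0 k2.
have := count_balance a; have := count_balance 0; rewrite fiber_shift; lia.
Qed.

End Counting.

(** * Lattices and the extension of integral functionals *)

Section LatticeExtension.
Variables (K : fieldType) (v : K -> int) (n : nat).
Hypothesis hd : is_discrete_valuation v.
Let hv := discrete_valuation hd.
Variables (L : 'rV[K]_n -> Prop) (C : int).
Hypothesis LD : forall x y, L x -> L y -> L (x + y).
Hypothesis LZ : forall a x, val_ge v 0 a -> L x -> L (a *: x).
Hypothesis L_absorbs : forall x, exists2 a, a != 0 & L (a *: x).
Hypothesis L_bounded : forall x, L x -> vecge v (- C) x.

Local Notation "y '@' f" := ((y *m f) 0 0) (at level 40).

Lemma dotBr (y : 'rV[K]_n) (f g : 'cV[K]_n) : y @ (f - g) = y @ f - y @ g.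
Proof. by rewrite mulmxBr mxE [X in _ + X]mxE. Qed.
Lemma dotZr a (y : 'rV[K]_n) (f : 'cV[K]_n) : y @ (a *: f) = a * (y @ f).
Proof. by rewrite -scalemxAr mxE. Qed.
Lemma dotBl (x y : 'rV[K]_n) (f : 'cV[K]_n) : (x - y) @ f = x @ f - y @ f.
Proof. by rewrite mulmxBl mxE [X in _ + X]mxE. Qed.
Lemma dotZl a (y : 'rV[K]_n) (f : 'cV[K]_n) : (a *: y) @ f = a * (y @ f).
Proof. by rewrite -scalemxAl mxE. Qed.

(* Extend to one more vector z: the value on z is fixed by the lattice vector with
   largest z-component. *)
Lemma functional_extension_step p (W : 'M[K]_(p, n)) (f : 'cV[K]_n) :
  (forall y, L y -> (y <= W)%MS -> val_ge v 1 (y @ f)) -> ~~ row_full W ->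
  exists q (W' : 'M[K]_(q, n)) (f' : 'cV[K]_n),
    [/\ (\rank W < \rank W')%N, (W <= W')%MS, W *m f' = W *m f
      & forall y, L y -> (y <= W')%MS -> val_ge v 1 (y @ f')].
Proof.
move=> hf nW.
have [z hz] : exists z : 'rV[K]_n, ~~ (z <= W)%MS.
  apply: NNPP => /not_ex_all_not h; move/negP: nW; apply; rewrite -sub1mx.
  by apply/rV_subP => z _; apply: contraT => hz; case: (h z).
have /existsP[j hj] : [exists j, (z *m cokermx W) 0 j != 0].
  apply: contraNT hz; rewrite negb_exists submxE => /forallP h.
  by apply/eqP/rowP => j; have := h j; rewrite negbK => /eqP ->; rewrite mxE.
set c := (z *m cokermx W) 0 j in hj.
pose psi : 'cV[K]_n := c^-1 *: col j (cokermx W).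
have Wpsi : W *m psi = 0.
  by rewrite -scalemxAr colE mulmxA mulmx_coker mul0mx scaler0.
have zpsi : z @ psi = 1.
  have zc : (z *m col j (cokermx W)) 0 0 = c by rewrite colE mulmxA -colE [LHS]mxE.
  by rewrite -scalemxAr mxE zc mulVf.
have [C' [_ hC']] := vecge_mulmx hd psi.
pose W' := col_mx W z.
have dec y : (y <= W')%MS -> (y - (y @ psi) *: z <= W)%MS.
  move=> /submxP[D ->]; rewrite -[D]hsubmxK mul_row_col; set D1 := lsubmx D; set D2 := rsubmx D.
  have -> : (D1 *m W + D2 *m z) @ psi = D2 0 0.
    by rewrite mulmxDl -!mulmxA Wpsi mulmx0 add0r mxE big_ord1 zpsi mulr1.
  by rewrite {1}[D2]mx11_scalar mul_scalar_mx addrK submxMl.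
have [||z1 [[y0 [Ly0 y0W' y00 vy0]] hmin]] := @int_min (fun m => exists y, [/\ L y, (y <= W')%MS, y @ psi != 0 & v (y @ psi) = m]) (- C - C').
- have [a a0 La] := L_absorbs z; exists (v a), (a *: z); split=> //.
  + by rewrite scalemx_sub // -addsmxE addsmxSr.
  + by rewrite -scalemxAl mxE zpsi mulr1.
  + by rewrite -scalemxAl mxE zpsi mulr1.
- by move=> m [y [Ly _ y0 <-]]; have := hC' _ _ (L_bounded Ly) 0; rewrite val_geE.
pose f' := f - (y0 @ f / (y0 @ psi)) *: psi.
exists _, W', f'; split.
- have := mxrankS (_ : W + z <= W')%MS; rewrite addsmxE submx_refl => /(_ isT).
  apply: leq_trans; rewrite ltnNge; apply: contra hz => h.
  have /eqmxP/eqmx_sym E : (W == W + z)%MS by rewrite -mxrank_leqif_eq ?addsmxSl // eqn_leq h mxrankS ?addsmxSl.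
  by apply: submx_trans (addsmxSr W z) _; rewrite E.
- by rewrite -addsmxE addsmxSl.
- by rewrite mulmxBr -scalemxAr Wpsi scaler0 subr0.
move=> y Ly yW'.
pose t := (y @ psi) / (y0 @ psi).
have it : val_ge v 0 t.
  have [e0|e0] := eqVneq (y @ psi) 0; first by rewrite /t e0 mul0r val_ge0.
  rewrite val_geE ?mulf_neq0 ?invr_eq0 // (valM hv) ?invr_eq0 // (valV hv) // vy0 subr_ge0.
  by apply: hmin; exists y.
have y0f' : y0 @ f' = 0.
  by rewrite /f' dotBr dotZr divfK // subrr.
have Ly' : L (y - t *: y0) by rewrite -scaleNr; apply: LD => //; apply: LZ => //; rewrite (val_geN hv).
have psi0 : (y - t *: y0) @ psi = 0.
  by rewrite dotBl dotZl /t divfK // subrr.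
have yW : (y - t *: y0 <= W)%MS.
  have := dec (y - t *: y0); rewrite psi0 scale0r subr0; apply.
  by rewrite addmx_sub // eqmx_opp scalemx_sub.
have -> : y @ f' = (y - t *: y0) @ f.
  have : (y - t *: y0) @ f' = (y - t *: y0) @ f.
    by rewrite /f' dotBr dotZr psi0 mulr0 subr0.
  by rewrite dotBl dotZl y0f' mulr0 subr0.
exact: hf.
Qed.

(** The part of L inside the span of W is a direct summand of L, so a functional sending it into p
    extends to one sending all of L into p. Only the values of f on W matter, whence the conclusion
    [W *m f' = W *m f]. *)
Lemma functional_extension p (W : 'M[K]_(p, n)) (f : 'cV[K]_n) :
  (forall y, L y -> (y <= W)%MS -> val_ge v 1 (y @ f)) ->
  exists f' : 'cV[K]_n, W *m f' = W *m f /\ forall y, L y -> val_ge v 1 (y @ f').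
Proof.
have [m] := ubnP (n - \rank W); elim: m p W f => // m IH p W f hm hf.
have [fW|nW] := boolP (row_full W).
  by exists f; split=> // y Ly; apply: hf => //; apply: submx_full.
have [q [W' [f' [r1 /submxP[D hD] h2 h3]]]] := functional_extension_step hf nW.
have [|f'' [h4 h5]] := IH q W' f' _ h3.
  by have := rank_leq_col W'; move: r1 hm; rewrite ltnS; lia.
by exists f''; split=> //; rewrite -h2 hD -!mulmxA h4.
Qed.

End LatticeExtension.

Section LocalQuadratic.
Variable K : fieldType.
Hypothesis hK : nonarch_local_field_odd_residue K.
Local Notation bf := (form_eval (idfun : {rmorphism K -> K})).
Local Notation sym B := (is_herm (idfun : {rmorphism K -> K}) false B).
Local Notation aniso B := (anisotropic (idfun : {rmorphism K -> K}) B).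

Lemma nonsquare_unit (v : K -> int) (k : finFieldType) (red : K -> k) :
  is_discrete_valuation v -> odd_residue_char v -> residue_map v red ->
  exists u, [/\ u != 0, v u = 0 & forall x : k, x ^+ 2 != red u].
Proof.
move=> hd h2 hr; have [a ha] := nonsquare_exists (res2 hd h2 hr).
have [u [iu ru]] := res_surj hr a.
have a0 : a != 0 by have := ha 0; rewrite expr0n eq_sym.
have [u0 vu] : u != 0 /\ v u = 0 by apply: (res_unit hr iu); rewrite ru.
by exists u; split=> // x; rewrite ru.
Qed.

Lemma quad_dim n (B : 'M[K]_n) : sym B -> aniso B -> (n <= 4)%N.
Proof.
have [v [hd hc hf h2]] := hK; have [k [red hr]] := residue_map_exists (discrete_valuation hd) hf.
have [u [u0 vu hu]] := nonsquare_unit hd h2 hr.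
exact: (quad_dim_aux hd hc h2 hr u0 vu hu).
Qed.

Lemma quad_universal n (B : 'M[K]_n) : sym B -> aniso B ->
  (forall c, c != 0 -> exists x, bf B x x = c) -> (4 <= n)%N.
Proof.
have [v [hd hc hf h2]] := hK; have [k [red hr]] := residue_map_exists (discrete_valuation hd) hf.
have [u [u0 vu hu]] := nonsquare_unit hd h2 hr.
exact: (quad_universal_aux hd hc h2 hr u0 vu hu).
Qed.

Lemma quad_scale (B : 'M[K]_4) (c : K) : sym B -> aniso B -> c != 0 ->
  exists2 P, P \in unitmx & P *m (c *: B) *m P^T = B.
Proof.
have [v [hd hc hf h2]] := hK; have [k [red hr]] := residue_map_exists (discrete_valuation hd) hf.
have [u [u0 vu hu]] := nonsquare_unit hd h2 hr.
exact: (quad_scale_aux hd hc h2 hr u0 vu hu).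
Qed.

Lemma local_two_neq0 : (2%:R : K) != 0.
Proof. by have [v [_ _ _ []]] := hK. Qed.

End LocalQuadratic.

(** * Lagrangians of the hyperbolic part and the Witt index *)

Section KernelVectors.
Variables (K : fieldType) (tau : {rmorphism K -> K}) (s : bool).
Hypothesis tauK : involutive tau.
Local Notation fev := (form_eval tau).

Lemma fev_mulmx2 n p q (H : 'M[K]_n) (X : 'M[K]_(p, n)) (Y : 'M[K]_(q, n)) a b :
  fev H (a *m X) (b *m Y) = (map_mx tau a *m (map_mx tau X *m H *m Y^T) *m b^T) 0 0.
Proof. by rewrite /form_eval map_mxM trmx_mul !mulmxA. Qed.

Lemma kernel_vectors n (H : 'M[K]_n) m (A : 'M[K]_m) : aniso_kernel tau s H A ->
  exists k (C : 'M[K]_(m, n)) (M : 'M[K]_(k, n)), [/\ (m + (k + k))%N = n, totiso tau H M,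
    forall x y, fev H (x *m C) (y *m C) = fev A x y,
    map_mx tau C *m H *m M^T = 0
    & forall z : 'rV[K]_n, map_mx tau z *m H *m M^T = 0 ->
       exists x y, z = x *m C + y *m M /\ fev H z z = fev A x x].
Proof.
case=> [_ [_ [k [e [P uP hP]]]]]; exists k.
case: n / e H P uP hP => H P uP; rewrite castmx_id => hP.
pose C := usubmx P; pose S := dsubmx P; pose M := usubmx S; pose W := dsubmx S.
have PE : P = col_mx C (col_mx M W) by rewrite !vsubmxK.
have := hP; rewrite PE map_col_mx tr_col_mx mul_col_mx mul_col_row.
case/eq_block_mx => hA hCS hSC.
rewrite map_col_mx tr_col_mx mul_col_mx mul_col_row.
case/eq_block_mx => hMM hMW hWM hWW.
move: hCS; rewrite tr_col_mx mul_mx_row -[RHS]row_mx0 => /eq_row_mx[hCM hCW].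
move: hSC; rewrite map_col_mx !mul_col_mx -[RHS]col_mx0 => /eq_col_mx[hMC hWC].
have fP : row_free P by rewrite row_free_unit.
exists C, M; split=> //.
- split=> //; apply: inj_row_free => y hy.
  have : row_mx 0 (row_mx y 0) *m P = 0 by rewrite PE !mul_row_col hy !mul0mx !addr0.
  rewrite -[RHS](mul0mx _ P) => /(row_free_inj fP); rewrite -[RHS]row_mx0 => /eq_row_mx[_].
  by rewrite -[RHS]row_mx0 => /eq_row_mx[].
- by move=> x y; rewrite fev_mulmx hA.
move=> z hz.
have [c zE] : exists c, z = c *m P by exists (z *m invmx P); rewrite mulmxKV.
pose x := lsubmx c; pose y := lsubmx (rsubmx c); pose w := rsubmx (rsubmx c).
have zE' : z = x *m C + (y *m M + w *m W) by rewrite zE PE -[c]hsubmxK -[rsubmx c]hsubmxK !mul_row_col.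
have w0 : w = 0.
  move: hz; rewrite zE' !map_mxD !map_mxM !mulmxDl -!(mulmxA (map_mx tau _)).
  rewrite (mulmxA (map_mx tau C)) (mulmxA (map_mx tau M)) (mulmxA (map_mx tau W)) hCM hMM hWM !mulmx0 !add0r.
  rewrite -scalemxAr mulmx1 => /(congr1 (fun A => sgn K s *: A)).
  rewrite scalerA sgn_sqr scale1r scaler0 => /(congr1 (map_mx tau)).
  by rewrite map_mxK // map_mx0.
exists x, y; move: zE'; rewrite w0 mul0mx addr0 => zE'; split=> //.
have h1 a b : fev H (a *m C) (b *m M) = 0.
  by rewrite fev_mulmx2 hCM mulmx0 mul0mx mxE.
have h3 a b : fev H (a *m M) (b *m C) = 0.
  by rewrite fev_mulmx2 hMC mulmx0 mul0mx mxE.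
have h4 a b : fev H (a *m M) (b *m M) = 0.
  by rewrite fev_mulmx hMM /form_eval mulmx0 mul0mx mxE.
by rewrite zE' !fevDl !fevDr h1 h3 h4 !addr0 fev_mulmx hA.
Qed.

(** If U had larger rank than M, some vector of U outside M would be orthogonal to M. Being
    isotropic in C + M, with A anisotropic, it would lie in M. *)
Lemma totiso_bound n (H : 'M[K]_n) m (A : 'M[K]_m) k r (U : 'M[K]_(r, n)) :
  is_herm tau s H -> aniso_kernel tau s H A -> (m + (k + k))%N = n -> totiso tau H U -> (r <= k)%N.
Proof.
move=> hH hA kn tU; have [k' [C [M [kn' tM _ _ perp]]]] := kernel_vectors hA.
have -> : k = k' by lia.
have [W [WU WM Wc]] := isotropic_complement tauK hH tU tM.
rewrite leqNgt -subn_gt0; apply/negP => lt.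
pose i := Ordinal lt.
have [|x [y [zE zA]]] := perp (row i W).
  by rewrite rowE map_mxM -!mulmxA (mulmxA (map_mx tau W)) WM mulmx0.
have [D hD] := submxP WU.
have x0 : x = 0.
  apply: hA.2.1; rewrite -zA hD row_mul fev_mulmx tU.2.
  by rewrite /form_eval mulmx0 mul0mx mxE.
have := Wc (delta_mx 0 i); rewrite -rowE zE x0 mul0mx add0r submxMl => /(_ isT).
by move/rowP/(_ i); rewrite !mxE !eqxx => /eqP; rewrite oner_eq0.
Qed.

End KernelVectors.

(** * The transfer of the four-dimensional anisotropic form *)

(** Restriction of scalars along iota is encoded by such maps between row spaces, so that the target
    needs no module structure over F. *)
Definition semilin (F E : fieldType) (iota : F -> E) N q (e : 'rV[F]_N -> 'rV[E]_q) :=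
  (forall x y, e (x + y) = e x + e y) /\ (forall a x, e (a *: x) = iota a *: e x).

Section Semilinear.
Variables (F E : fieldType) (iota : F -> E) (N q : nat) (e : 'rV[F]_N -> 'rV[E]_q).
Hypothesis he : semilin iota e.

Lemma semilin0 : e 0 = 0.
Proof. by apply: (addrI (e 0)); rewrite -he.1 !addr0. Qed.

Lemma semilinN x : e (- x) = - e x.
Proof. by apply/eqP; rewrite -addr_eq0 -he.1 addNr semilin0. Qed.

Lemma semilinB x y : e (x - y) = e x - e y.
Proof. by rewrite he.1 semilinN. Qed.

Lemma semilin_sum (I : finType) (f : I -> 'rV[F]_N) : e (\sum_i f i) = \sum_i e (f i).
Proof. by elim/big_ind2: _ => [|? ? ? ? <- <-|//]; rewrite ?semilin0 ?he.1. Qed.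

Lemma semilin_delta x : e x = \sum_j iota (x 0 j) *: e (delta_mx 0 j).
Proof. by rewrite {1}(row_sum_delta x) semilin_sum; apply: eq_bigr => j _; rewrite he.2. Qed.

End Semilinear.

(** * Boundedness of semilinear maps and of their inverses *)

Section Bounds.
Variables (F E : fieldType) (iota : {rmorphism F -> E}) (v : F -> int) (w : E -> int).
Hypotheses (hdv : is_discrete_valuation v) (hcv : val_complete v) (hfv : finite_residue_field v).
Hypothesis hdw : is_discrete_valuation w.
Let hv := discrete_valuation hdv.
Let hw := discrete_valuation hdw.
Variable er : int.
Hypothesis er0 : 0 < er.
Hypothesis hew : forall x, x != 0 -> w (iota x) = er * v x.

Lemma val_ge_iota a x : val_ge v a x -> val_ge w (er * a) (iota x).
Proof.
have [->|x0] := eqVneq x 0; first by rewrite rmorph0 !val_ge0.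
by rewrite !val_geE ?fmorph_eq0 // hew // ler_pM2l.
Qed.

Variables (N q : nat) (e : 'rV[F]_N -> 'rV[E]_q).
Hypothesis he : semilin iota e.
Hypothesis e_inj : forall x, e x = 0 -> x = 0.

Lemma semilin_bound : exists C : int, 0 <= C /\
  forall a x, vecge v a x -> vecge w (er * a - C) (e x).
Proof.
have [C [C0 hC]] := entries_bound w (fun ij : 'I_N * 'I_q => e (delta_mx 0 ij.1) 0 ij.2).
exists C; split=> // a x hx i; rewrite (semilin_delta he) summxE.
apply: (val_ge_sum hw) => j _; rewrite mxE; apply: (val_geM hw); first exact: val_ge_iota.
exact: (hC (j, i)).
Qed.

(** Otherwise primitive vectors would have images tending to 0, and a cluster point would be a
    nonzero vector killed by e. *)
Lemma preimage_bound : exists C : int, 0 <= C /\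
  forall a x, vecge w (er * a) (e x) -> vecge v (a - C) x.
Proof.
have [kF [redF hr]] := residue_map_exists hv hfv.
have [pi [pi0 vpi]] := uniformizer_exists hdv.
suff [C [C0 hC]] : exists C : int, 0 <= C /\ forall x, vecge w 0 (e x) -> vecge v (- C) x.
  exists C; split=> // a x hx; have p0 : pi ^ (- a) != 0 by rewrite expfz_neq0.
  have := hC (pi ^ (- a) *: x); rewrite he.2 => h.
  have : vecge v (- C) (pi ^ (- a) *: x).
    apply: h; apply/(vecgeZV hdw); rewrite ?fmorph_eq0 // hew // (valXz hv) // vpi.
    by apply: vecgeW hx; lia.
  move/(vecgeZV hdv); rewrite p0 (valXz hv) // vpi => /(_ isT); apply: vecgeW; lia.
apply: NNPP => /not_ex_all_not hno.
have hx (m : nat) : exists x, vecge w (er * m%:Z) (e x) /\ primitive v x.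
  have /not_and_or[//|/not_all_ex_not[x hx]] := hno m%:Z.
  have [ex nx] := imply_to_and _ _ hx.
  have x0 : x != 0 by apply/eqP => x0; apply: nx; rewrite x0; apply: vecge0.
  have [t ht] := primitive_scale hdv pi0 vpi x0.
  have p0 : pi ^ t != 0 by rewrite expfz_neq0.
  exists (pi ^ t *: x); split=> //; rewrite he.2; apply/(vecgeZV hdw); rewrite ?fmorph_eq0 //.
  rewrite hew // (valXz hv) // vpi; apply: vecgeW ex.
  suff : m%:Z <= t by nia.
  rewrite leNgt; apply/negP => tm; apply: nx; case: ht => + _.
  move/(vecgeZV hdv); rewrite p0 (valXz hv) // vpi => /(_ isT); apply: vecgeW; lia.
pose u m := sval (constructive_indefinite_description _ (hx m)).
have uP m := svalP (constructive_indefinite_description _ (hx m)).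
have uprim m : primitive v (u m) by case: (uP m).
have ubig m : vecge w (er * m%:Z) (e (u m)) by case: (uP m).
have [l hl] := cluster_point hdv hcv hr (fun m => (uprim m).1).
have [m [_ hm]] := hl 1 0%N.
have l0 : l != 0 by apply: (primitive_cluster uprim); exists m.
move/eqP: l0; apply; apply: e_inj; apply: (@vecge_eq0 _ w) => M.
have [C [C0 hC]] := semilin_bound.
have [m' [hm' hlm]] := hl `|M + C| `|M|%N.
have -> : e l = e (u m') - e (u m' - l) by rewrite (semilinB he) subKr.
apply: (vecgeD hdw); first by apply: vecgeW (ubig m'); nia.
by apply: (vecgeN hdw); apply: vecgeW (hC _ _ hlm); nia.
Qed.

End Bounds.

Lemma bilinear_matrix (F : fieldType) N (b : 'rV[F]_N -> 'rV[F]_N -> F) :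
  (forall x y z, b (x + y) z = b x z + b y z) -> (forall x y z, b z (x + y) = b z x + b z y) ->
  (forall a x y, b (a *: x) y = a * b x y) -> (forall a x y, b x (a *: y) = a * b x y) ->
  exists G : 'M[F]_N, forall x y, b x y = form_eval (idfun : {rmorphism F -> F}) G x y.
Proof.
move=> Dl Dr Zl Zr; pose G := \matrix_(i, j) b (delta_mx 0 i) (delta_mx 0 j).
have b0l y : b 0 y = 0 by rewrite -(scale0r 0) Zl mul0r.
have b0r y : b y 0 = 0 by rewrite -(scale0r 0) Zr mul0r.
have suml y (f : 'I_N -> 'rV[F]_N) : b (\sum_i f i) y = \sum_i b (f i) y.
  by elim/big_ind2: _ => [|? ? ? ? <- <-|//]; rewrite ?b0l ?Dl.
have sumr y (f : 'I_N -> 'rV[F]_N) : b y (\sum_i f i) = \sum_i b y (f i).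
  by elim/big_ind2: _ => [|? ? ? ? <- <-|//]; rewrite ?b0r ?Dr.
exists G => x y; rewrite (row_sum_delta x) (row_sum_delta y) suml fev_suml; apply: eq_bigr => i _.
rewrite sumr fev_sumr; apply: eq_bigr => j _; rewrite Zl Zr fevZl fevZr; congr (_ * (_ * _)).
rewrite bfE; have -> : (delta_mx 0 j : 'rV[F]_N)^T = delta_mx j 0 by rewrite trmx_delta.
by rewrite -rowE -colE !mxE.
Qed.

(** Supplies the boolean predicate needed to form a finite set from an undecidable condition. *)
Definition classic_bool (P : Prop) : bool := if excluded_middle_informative P then true else false.

Lemma classic_boolP P : reflect P (classic_bool P).
Proof. by rewrite /classic_bool; case: excluded_middle_informative => h; constructor. Qed.

(** * The transfer of the normal form has no Lagrangian *)

Section NoLagrangian.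
Variables (F E : fieldType) (iota : {rmorphism F -> E}) (v : F -> int) (w : E -> int).
Hypotheses (hdv : is_discrete_valuation v) (hcv : val_complete v) (hfv : finite_residue_field v).
Hypothesis h2v : odd_residue_char v.
Hypotheses (hdw : is_discrete_valuation w) (h2w : odd_residue_char w).
Let hv := discrete_valuation hdv.
Let hw := discrete_valuation hdw.
Variable er : int.
Hypothesis er0 : 0 < er.
Hypothesis hew : forall x, x != 0 -> w (iota x) = er * v x.
Variables (kF : finFieldType) (redF : F -> kF).
Hypothesis hrF : residue_map v redF.
Variables (kE : finFieldType) (redE : E -> kE).
Hypothesis hrE : residue_map w redE.
Variables (u pi : E).
Hypotheses (u0 : u != 0) (wu : w u = 0) (hu : forall x : kE, x ^+ 2 != redE u).
Hypotheses (pi0 : pi != 0) (wpi : w pi = 1).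
Variable lam : E -> F.
Hypothesis lamD : forall x y, lam (x + y) = lam x + lam y.
Hypothesis lamZ : forall a x, lam (iota a * x) = a * lam x.
Hypothesis lam_int : forall x, val_ge w 0 x -> val_ge v 0 (lam x).
Hypothesis lam_max : forall x, val_ge w 1 x -> val_ge v 1 (lam x).
Variable x1 : E.
Hypothesis x1_int : val_ge w 0 x1.
Hypothesis lam_x1 : ~~ val_ge v 1 (lam x1).

Local Notation bF := (form_eval (idfun : {rmorphism E -> E}) (norm_diag u pi)).

Lemma norm_diagE x y : bF x y =
  x 0 0 * y 0 0 - u * (x 0 1 * y 0 1) + pi * (x 0 2%:R * y 0 2%:R) - u * pi * (x 0 3%:R * y 0 3%:R).
Proof.
rewrite bfE mul_mx_diag mxE !big_ord_recl big_ord0 !mxE /=.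
have -> : lift ord0 ord0 = 1 :> 'I_4 by apply: val_inj.
have -> : lift ord0 (lift ord0 ord0) = 2%:R :> 'I_4 by apply: val_inj.
have -> : lift ord0 (lift ord0 (lift ord0 ord0)) = 3%:R :> 'I_4 by apply: val_inj.
rewrite /=; ring.
Qed.

Lemma lamN x : lam (- x) = - lam x.
Proof.
have l0 : lam 0 = 0 by apply: (addrI (lam 0)); rewrite -lamD !addr0.
by apply/eqP; rewrite -addr_eq0 -lamD addNr l0.
Qed.

(** If [w y <= 0], then x1 is an integral multiple of y, contradicting [lam_x1]. *)
Lemma lam_unit_scale y n : (forall c, val_ge w 0 c -> val_ge v 1 (lam (c * y))) -> w y = n -> y != 0 -> 0 < n.
Proof.
move=> h wy y0; rewrite ltNge; apply/negP => n0.
have := h (x1 / y); rewrite divfK // => h'; move/negP: lam_x1; apply; apply: h'.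
have [->|x10] := eqVneq x1 0; first by rewrite mul0r val_ge0.
move: x1_int; rewrite !val_geE ?mulf_neq0 ?invr_eq0 // (valM hw) ?invr_eq0 // (valV hw) //; lia.
Qed.


(** The dual lattice, one coordinate at a time: a diagonal entry of value m leads to level [1 - m],
    hence p for the entries 1 and -u, and O for pi and -u pi. *)
Lemma coord_bound (d y : E) m : d != 0 -> w d = m ->
  (forall c, val_ge w 0 c -> val_ge v 1 (lam (c * (d * y)))) -> val_ge w (1 - m) y.
Proof.
move=> d0 wd h; have [->|y0] := eqVneq y 0; first exact: val_ge0.
have := lam_unit_scale h erefl (mulf_neq0 d0 y0).
rewrite (valM hw) // wd val_geE //; clear; lia.
Qed.

Lemma nth_coord (x : 'rV[E]_4) (P : E -> Prop) :
  P (x 0 0) -> P (x 0 1) -> P (x 0 2%:R) -> P (x 0 3%:R) -> forall i, P (x 0 i).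
Proof.
move=> h0 h1 h2 h3 [[|[|[|[|i]]]] //= hi].
- by have -> : Ordinal hi = 0 by apply: val_inj.
- by have -> : Ordinal hi = 1 by apply: val_inj.
- by have -> : Ordinal hi = 2%:R by apply: val_inj.
- by have -> : Ordinal hi = 3%:R by apply: val_inj.
Qed.

Lemma bF_delta (c : E) (y : 'rV[E]_4) i :
  bF (c *: delta_mx 0 i) y = c * ([:: 1; - u; pi; - u * pi]`_i * y 0 i).
Proof.
rewrite fevZl bfE -mulmxA -rowE mxE mul_diag_mx !mxE; congr (_ * (_ * _)).
Qed.

Variables (N : nat) (e : 'rV[F]_N -> 'rV[E]_4) (ei : 'rV[E]_4 -> 'rV[F]_N).
Hypothesis he : semilin iota e.
Hypotheses (eK : cancel e ei) (eiK : cancel ei e).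

Let b x y := lam (bF (e x) (e y)).
Let L x := vecge w 0 (e x).

Lemma lam0 : lam 0 = 0.
Proof. by rewrite -[in LHS](mulr0 (iota 0)) lamZ mul0r. Qed.

Lemma bF_int x y : vecge w 0 x -> vecge w 0 y -> val_ge w 0 (bF x y).
Proof.
move=> hx hy; rewrite norm_diagE.
have iu : val_ge w 0 u by rewrite val_geE ?wu.
have ip : val_ge w 0 pi by rewrite val_geE ?wpi.
by rewrite !(val_geB hw, val_geD hw) ?(val_geM0 hw).
Qed.

Lemma gram_exists : exists G : 'M[F]_N, G \in unitmx /\
  forall x y, b x y = form_eval (idfun : {rmorphism F -> F}) G x y.
Proof.
have [||||G hG] := @bilinear_matrix F N b.
- by move=> x y z; rewrite /b he.1 fevDl lamD.
- by move=> x y z; rewrite /b he.1 fevDr lamD.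
- by move=> a x y; rewrite /b he.2 fevZl lamZ.
- by move=> a x y; rewrite /b he.2 fevZr lamZ.
exists G; split=> //; rewrite -row_free_unit; apply: inj_row_free => x hx.
rewrite -[x]eK; have -> : e x = 0; last by rewrite -(semilin0 he) eK.
have z y : bF (e x) y = 0.
  apply/eqP; apply: contraT => n0; move/negP: lam_x1; case.
  have -> : x1 = bF (e x) (e (ei ((x1 / bF (e x) y) *: y))) by rewrite eiK fevZr divfK.
  by rewrite -/(b _ _) hG bfE hx mul0mx mxE val_ge0.
have Bu : norm_diag u pi \in unitmx.
  rewrite unitmxE det_diag !big_ord_recl big_ord0 !mxE /= unitfE.
  by rewrite !mulf_eq0 !oner_eq0 !oppr_eq0 (negbTE u0) (negbTE pi0).
have symB : is_herm (idfun : {rmorphism E -> E}) false (norm_diag u pi).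
  by split=> //; rewrite sgn_false scale1r map_mx_id // tr_diag_mx.
by apply: (@fev_nondeg _ (idfun : {rmorphism E -> E}) _ _ _ Bu) => y; rewrite (bf_sym _ _ symB) z.
Qed.

Let lift (a : kE) : E := sval (constructive_indefinite_description _ (res_surj hrE a)).
Let lift_int a : val_ge w 0 (lift a).
Proof. by rewrite /lift; case: constructive_indefinite_description => x []. Qed.
Let redE_lift a : redE (lift a) = a.
Proof. by rewrite /lift; case: constructive_indefinite_description => x []. Qed.
Let mu (a : kE) : kF := redF (lam (lift a)).

Lemma mu_red x : val_ge w 0 x -> mu (redE x) = redF (lam x).
Proof.
move=> ix; apply/eqP; rewrite (res_eq hv hrF) ?lam_int // -lamN -lamD; apply: lam_max.
by rewrite -(res_eq hw hrE) // redE_lift.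
Qed.

Lemma mu_add x y : mu (x + y) = mu x + mu y.
Proof.
rewrite -[x]redE_lift -[y]redE_lift -(resD hrE) // !mu_red ?(val_geD hw) // lamD.
by rewrite (resD hrF) // lam_int.
Qed.

Lemma no_lagrangian r (J : 'M[F]_(r, N)) : row_free J -> (r + r)%N = N ->
  (forall x, (x <= J)%MS -> b x x = 0) -> False.
Proof.
move=> fJ rN hJ.
have n2F : (2%:R : F) != 0 by case: h2v.
have [G [uG hG]] := gram_exists.
have bsym x y : b x y = b y x.
  by rewrite /b !norm_diagE; congr lam; ring.
have bDl x y z : b (x + y) z = b x z + b y z by rewrite !hG fevDl.
have bDr x y z : b z (x + y) = b z x + b z y by rewrite !hG fevDr.
have bZl a x z : b (a *: x) z = a * b x z by rewrite !hG fevZl.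
have bJ x y : (x <= J)%MS -> (y <= J)%MS -> b x y = 0.
  move=> hx hy; have := hJ (x + y); rewrite addmx_sub // => /(_ isT).
  rewrite bDl !bDr.
  rewrite (hJ x) // (hJ y) // add0r addr0 [b y x]bsym -mulr2n -mulr_natl => /eqP.
  by rewrite mulf_eq0 (negbTE n2F) => /eqP.
have [C [C0 hC]] := preimage_bound hdv hcv hfv hdw er0 hew he (fun x (h : e x = 0) =>
   etrans (esym (eK x)) (etrans (congr1 ei h) (etrans (congr1 ei (esym (semilin0 he))) (eK 0)))).
have LD x y : L x -> L y -> L (x + y) by move=> hx hy; rewrite /L he.1; apply: (vecgeD hdw).
have LZ a x : val_ge v 0 a -> L x -> L (a *: x).
  move=> ha hx; rewrite /L he.2; apply: (vecgeZ0 hdw) => //.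
  by have := val_ge_iota er0 hew ha; rewrite mulr0.
have Lbd x : L x -> vecge v (- C) x.
  by move=> hx; have := hC 0 x; rewrite mulr0 sub0r; apply.
have Labs x : exists2 a, a != 0 & L (a *: x).
  have [C' hC'] := vecge_lower w (e x).
  have [p [p0 vp]] := uniformizer_exists hdv.
  exists (p ^ `|C'|); first by rewrite expfz_neq0.
  rewrite /L he.2; apply/(vecgeZV hdw); first by rewrite fmorph_eq0 expfz_neq0.
  rewrite hew ?expfz_neq0 // (valXz hv) // vp; apply: vecgeW hC'; clear -er0; nia.
(* The reduction of the lattice vectors in J, keeping the first two coordinates; the other two lie
   in the radical of the reduced form. *)
pose T := [set z : kE * kE | classic_bool (exists x, [/\ L x, (x <= J)%MS,
  redE (e x 0 0) = z.1 & redE (e x 0 1) = z.2])].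
have iu : val_ge w 0 u by rewrite val_geE ?wu.
have ip : val_ge w 0 pi by rewrite val_geE ?wpi.
have i2 : val_ge w 0 (2%:R : E) by apply: (val_ge_nat hw).
apply: (@no_finite_lagrangian kE kF (res2 hdw h2w hrE) (redE u) _ hu mu mu_add
   (redF (lam x1)) (redE x1) _ _ T).
- by have [] := unit_res hrE u0 wu.
- by rewrite (res_eq0 hrF) ?lam_int.
- by rewrite mu_red.
- rewrite inE; apply/classic_boolP; exists 0; rewrite /L (semilin0 he) !mxE (res0 hrE) sub0mx; split=> //.
  exact: vecge0.
- move=> z z'; rewrite !inE => /classic_boolP[x [Lx xJ e1 e2]] /classic_boolP[x' [Lx' xJ' e1' e2']].
  apply/classic_boolP; exists (x - x'); split.
  + by rewrite -scaleN1r; apply: LD => //; apply: LZ => //; rewrite (val_geN hv) (val_ge1 hv).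
  + by rewrite addmx_sub // eqmx_opp.
  + by rewrite (semilinB he) mxE [X in _ + X]mxE (resB hw hrE) ?e1 ?e1'.
  + by rewrite (semilinB he) mxE [X in _ + X]mxE (resB hw hrE) ?e2 ?e2'.
(* The terms carrying pi take values in p_E, which lam sends into p_F, so they disappear in the
   reduction. *)
- move=> z; rewrite inE => /classic_boolP[x [Lx xJ <- <-]] /=.
  have := hJ x xJ; rewrite /b norm_diagE -addrA lamD => /eqP; rewrite addr_eq0 => /eqP hx.
  rewrite -!(resX hw hrE) // -(resM hrE) ?(val_geX hw) // -(resB hw hrE) ?(val_geM0 hw) ?(val_geX hw) //.
  rewrite mu_red; last by rewrite (val_geB hw) ?(val_geM0 hw) ?(val_geX hw).
  rewrite !expr2 hx; apply/eqP; rewrite (res_eq0 hrF) ?(val_geN hv); first apply: lam_max.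
    have -> (p q : E) : pi * p - u * pi * q = (p - u * q) * pi by ring.
    apply: (val_geM0 hw); last by rewrite val_geE ?wpi.
    by rewrite (val_geB hw) ?(val_geM0 hw).
  by apply: lam_int; rewrite (val_geB hw) ?(val_geM0 hw).
move=> z zT.
pose Z : 'rV[E]_4 := \row_i (if i == 0 then lift z.1 else if i == 1 then lift z.2 else 0).
have LZZ : L (ei Z) by rewrite /L eiK => i; rewrite mxE; do 2?[case: ifP => // _]; rewrite ?val_ge0.
(* If [b y (ei Z)] were in p for all lattice vectors y of J, this functional would extend to L and
   be represented by some [ys] in the dual lattice. Then [ei Z - ys] would be a lattice vector of J
   reducing to z. *)
have [y [Ly yJ hy]] : exists y, [/\ L y, (y <= J)%MS & ~~ val_ge v 1 (b y (ei Z))].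
  apply: NNPP => /not_ex_all_not hno; move/negP: zT; apply; rewrite inE; apply/classic_boolP.
  have hyp y : L y -> (y <= J)%MS -> val_ge v 1 ((y *m (G *m (ei Z)^T)) 0 0).
    move=> Ly yJ; rewrite mulmxA -bfE -hG; apply: NNPP => h; apply: (hno y); split=> //.
    exact/negP.
  have [f' [hf1 hf2]] := functional_extension hdv LD LZ Labs Lbd hyp.
  pose ys := (invmx G *m f')^T.
  have bys x : b x ys = (x *m f') 0 0.
    by rewrite hG bfE trmxK -mulmxA (mulmxA G) mulmxV // mul1mx.
  pose x := ei Z - ys.
  (* x is orthogonal to J, and J is its own orthogonal complement because [r + r = N]. *)
  have xJ : (x <= J)%MS.
    have JGx : J *m G *m x^T = 0.
      rewrite linearB /= mulmxBr trmxK -(mulmxA J G (_ *m _)) (mulmxA G) mulmxV // mul1mx.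
      by rewrite hf1 mulmxA subrr.
    have JGJ : J *m G *m J^T = 0.
      apply/matrixP => i j; have := fev_entry (idfun : {rmorphism F -> F}) G J J i j.
      by rewrite map_mx_id // => <-; rewrite -hG bJ ?row_sub // mxE.
    have h1 : (x <= kermx (J *m G)^T)%MS.
      by apply/sub_kermxP; rewrite -[LHS]trmxK trmx_mul trmxK JGx trmx0.
    have h3 : (J <= kermx (J *m G)^T)%MS.
      by apply/sub_kermxP; rewrite -[LHS]trmxK trmx_mul trmxK JGJ trmx0.
    apply: submx_trans h1 _; rewrite -(geq_leqif (mxrank_leqif_sup h3)) mxrank_ker mxrank_tr.
    rewrite mxrankMfree; last by rewrite row_free_unit.
    by rewrite (eqP fJ) leq_subLR rN.
  have key (i : 'I_4) (c : E) : val_ge w 0 c -> val_ge v 1 (lam (bF (c *: delta_mx 0 i) (e ys))).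
    move=> ic; have := bys (ei (c *: delta_mx 0 i)); rewrite /b eiK => ->.
    by apply: hf2; rewrite /L eiK => j; rewrite !mxE (val_geM0 hw) // (val_ge_nat hw).
  have crd (i : 'I_4) m : [:: 1; - u; pi; - u * pi]`_i != 0 -> w [:: 1; - u; pi; - u * pi]`_i = m ->
      val_ge w (1 - m) (e ys 0 i).
    move=> d0 wd; apply: (coord_bound d0 wd) => c ic; rewrite -bF_delta; exact: key.
  have y0 : val_ge w 1 (e ys 0 0) by apply: (crd 0 0); rewrite /= ?oner_neq0 ?(val1 hw).
  have y1 : val_ge w 1 (e ys 0 1) by apply: (crd 1 0); rewrite /= ?oppr_eq0 ?(valN hw).
  have y2 : val_ge w 0 (e ys 0 2%:R) by apply: (crd 2%:R 1).
  have y3 : val_ge w 0 (e ys 0 3%:R).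
    by apply: (crd 3%:R 1); rewrite /= ?mulf_neq0 ?oppr_eq0 // (valM hw) ?oppr_eq0 // (valN hw) wu wpi.
  have ex i : e x 0 i = Z 0 i - e ys 0 i by rewrite (semilinB he) eiK !mxE.
  exists x; split=> //.
  + move=> i; rewrite ex; apply: (val_geB hw); first by have := LZZ i; rewrite eiK.
    apply: (@nth_coord (e ys) (val_ge w 0)) => //; [exact: val_geW y0 | exact: val_geW y1].
  + rewrite ex mxE /=; apply/eqP; rewrite -[X in _ == X]redE_lift (res_eq hw hrE) ?lift_int //.
      by rewrite addrAC subrr sub0r (val_geN hw).
    by apply: (val_geB hw); [apply: lift_int | apply: val_geW y0].
  + rewrite ex mxE /=; apply/eqP; rewrite -[X in _ == X]redE_lift (res_eq hw hrE) ?lift_int //.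
      by rewrite addrAC subrr sub0r (val_geN hw).
    by apply: (val_geB hw); [apply: lift_int | apply: val_geW y1].
set be := b y (ei Z) in hy.
have ibe : val_ge v 0 be by apply: lam_int; apply: bF_int.
have [be0 vbe] : be != 0 /\ v be = 0 by apply: (res_unit hrF ibe); rewrite (res_eq0 hrF).
have d0 : 2%:R * be != 0 by rewrite mulf_neq0.
have id : val_ge v 0 (lam x1 / (2%:R * be)).
  rewrite mulrC (val_geMV hv) ?invr_eq0 // (valV hv) // (valM hv) // vbe; case: h2v => _ ->.
  exact: lam_int.
(* The factor is chosen so that twice the pairing of [sF *: y] with [ei Z], the polar form of the
   reduction, is exactly [lam x1]. *)
set sF := lam x1 / _ in id.
have Ly' : L (sF *: y) by apply: LZ.
exists (redE (e (sF *: y) 0 0), redE (e (sF *: y) 0 1)).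
  by rewrite inE; apply/classic_boolP; exists (sF *: y); rewrite scalemx_sub.
have r2 : (2%:R : kE) = redE 2%:R by rewrite -[2%:R]/(1 + 1) (resD hrE) ?(val_ge1 hw) // (res1 hrE).
rewrite -[z.1]redE_lift -[z.2]redE_lift r2 /=.
have i3 := val_geM0 hw (lift_int z.1) (Ly' 0).
have i4 := val_geM0 hw (lift_int z.2) (Ly' 1).
have i5 := val_geM0 hw iu i4.
have i6 := val_geB hw i3 i5.
have i7 := val_geM0 hw i2 i6.
rewrite -(resM hrE) // -(resM hrE) // -(resM hrE iu i4) -(resB hw hrE) // -(resM hrE) // mu_red //.
congr redF; rewrite mulr_natl mulr2n lamD.
have -> : lift z.1 * e (sF *: y) 0 0 - u * (lift z.2 * e (sF *: y) 0 1) = bF (e (sF *: y)) (e (ei Z)).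
  have Z0 : Z 0 0 = lift z.1 by rewrite mxE.
  have Z1 : Z 0 1 = lift z.2 by rewrite mxE.
  have Z2 : Z 0 2%:R = 0 by rewrite mxE.
  have Z3 : Z 0 3%:R = 0 by rewrite mxE.
  by rewrite norm_diagE eiK Z0 Z1 Z2 Z3 !mulr0 addr0 subr0 ![lift _ * _]mulrC.
rewrite -/(b _ _) bZl -/be -mulrDl -[sF + sF]mulr2n -mulr_natl /sF.
by field; rewrite be0 n2F.
Qed.

End NoLagrangian.

(** * The transfer of any four-dimensional anisotropic form *)

Section TraceForm.
Variables (F E : fieldType) (iota : {rmorphism F -> E}).
Hypotheses (hF : nonarch_local_field_odd_residue F) (hE : nonarch_local_field_odd_residue E).
Variables (N : nat) (e : 'rV[F]_N -> 'rV[E]_4) (ei : 'rV[E]_4 -> 'rV[F]_N).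
Hypothesis he : semilin iota e.
Hypotheses (eK : cancel e ei) (eiK : cancel ei e).
Variable lam : E -> F.
Hypothesis lamD : forall x y, lam (x + y) = lam x + lam y.
Hypothesis lamZ : forall a x, lam (iota a * x) = a * lam x.
Hypothesis lam_neq0 : exists x, lam x != 0.

Local Notation bE := (form_eval (idfun : {rmorphism E -> E})).
Local Notation bF := (form_eval (idfun : {rmorphism F -> F})).

Lemma e_inj0 x : e x = 0 -> x = 0.
Proof. by rewrite -(semilin0 he) => /(can_inj eK). Qed.

Lemma ei_semilin : (forall x y, ei (x + y) = ei x + ei y) /\ (forall a x, ei (iota a *: x) = a *: ei x).
Proof.
by split=> [x y|a x]; apply: (can_inj eK); rewrite ?he.1 ?he.2 !eiK.
Qed.

(* c p_E is the largest fractional ideal that lam sends into p_F. *)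
Lemma lam_normalize (v : F -> int) (w : E -> int) (er : int) :
  is_discrete_valuation v -> val_complete v -> finite_residue_field v -> is_discrete_valuation w ->
  0 < er -> (forall x, x != 0 -> w (iota x) = er * v x) ->
  exists c, [/\ c != 0, forall x, val_ge w 0 x -> val_ge v 0 (lam (c * x)),
    forall x, val_ge w 1 x -> val_ge v 1 (lam (c * x))
    & exists x1, val_ge w 0 x1 /\ ~~ val_ge v 1 (lam (c * x1))].
Proof.
move=> hdv hcv hfv hdw er0 hew.
have hv := discrete_valuation hdv; have hw := discrete_valuation hdw.
have [piF [pF0 vpF]] := uniformizer_exists hdv; have [piE [pE0 wpE]] := uniformizer_exists hdw.
have [C [C0 hC]] := preimage_bound hdv hcv hfv hdw er0 hew he e_inj0.
pose P j := forall x, val_ge w j x -> val_ge v 1 (lam x).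
have [eiD eiZ] := ei_semilin.
have [C' [C'0 hC']] := entries_bound v (fun i => lam (e (delta_mx 0 i) 0 0)).
have bnd : P (er * (1 + C + C')).
  move=> x hx; pose y := ei (x *: delta_mx 0 0).
  have hy : vecge v (1 + C') y.
    have := hC (1 + C + C') y; rewrite /y eiK addrAC addrK; apply=> i.
    by rewrite !mxE [x * _]mulrC addrAC; apply: (val_geM0 hw) => //; apply: (val_ge_nat hw).
  have -> : x = e y 0 0 by rewrite /y eiK !mxE mulr1.
  rewrite (semilin_delta he) summxE.
  have lsum (f : 'I_N -> E) : lam (\sum_i f i) = \sum_i lam (f i).
    have l0 : lam 0 = 0 by apply: (addrI (lam 0)); rewrite -lamD !addr0.
    by elim/big_ind2: _ => [|? ? ? ? <- <-|//]; rewrite ?l0 ?lamD.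
  rewrite lsum; apply: (val_ge_sum hv) => i _; rewrite mxE lamZ.
  have -> : (1 : int) = (1 + C') + (- C') by rewrite addrK.
  exact: (val_geM hv).
have [x0 lx0] := lam_neq0.
have x00 : x0 != 0.
  apply: contraNneq lx0 => ->; apply/eqP; have := lamZ 0 0; by rewrite mulr0 mul0r.
(* x0 divided by a suitable power of [piF] has exactly this lower bound as its value, and its image
   under lam has value at most 0, so no smaller level is sent into p. *)
have [||j0 [Pj0 hmin]] := @int_min P (w x0 - er * `|v (lam x0)|).
- by exists (er * (1 + C + C')).
- move=> j Pj; rewrite leNgt; apply/negP => jl.
  have := Pj (iota (piF ^ (- `|v (lam x0)|)) * x0).
  have p0 : piF ^ (- `|v (lam x0)|) != 0 by rewrite expfz_neq0.
  rewrite lamZ val_geE ?mulf_neq0 ?fmorph_eq0 // (valM hw) ?fmorph_eq0 // hew // (valXz hv) // vpF.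
  rewrite val_geE ?mulf_neq0 // (valM hv) // (valXz hv) // vpF.
  have -> : er * (1 * - `|v (lam x0)|) + w x0 = w x0 - er * `|v (lam x0)| by ring.
  move/(_ (ltW jl)); clear; lia.
pose c := piE ^ (j0 - 1).
have c0 : c != 0 by rewrite expfz_neq0.
have wc : w c = j0 - 1 by rewrite (valXz hw) // wpE mul1r.
have max x : val_ge w 1 x -> val_ge v 1 (lam (c * x)).
  move=> hx; apply: Pj0; have -> : j0 = (j0 - 1) + 1 by rewrite subrK.
  by apply: (val_geM hw) => //; rewrite val_geE ?wc.
exists c; split=> //.
- move=> x hx; have h : val_ge v 1 (lam (c * (iota piF * x))).
    apply: max; rewrite (val_geMV hw) ?fmorph_eq0 // hew // vpF mulr1; apply: val_geW hx.
    by clear -er0; lia.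
  move: h; rewrite mulrCA lamZ (val_geMV hv) // vpF subrr //.
- apply: NNPP => hno; have : P (j0 - 1).
    move=> x hx; have -> : x = c * (x / c) by rewrite mulrCA mulfV // mulr1.
    apply: NNPP => h; apply: hno; exists (x / c); split; last exact/negP.
    rewrite mulrC (val_geMV hw) ?invr_eq0 // (valV hw) // wc opprK add0r //.
  move/hmin; clear; lia.
Qed.

Variable B : 'M[E]_4.
Hypothesis hB : is_herm (idfun : {rmorphism E -> E}) false B.
Hypothesis anB : anisotropic (idfun : {rmorphism E -> E}) B.

Let b x y := lam (bE B (e x) (e y)).

(** Replacing lam by [lam (c * x)] and B by its multiple by [c^-1] leaves the transfer unchanged, so
    lam may be taken normalised; a change of basis then puts the form into normal form. *)
Lemma trace_not_lagrangian r (J : 'M[F]_(r, N)) : row_free J -> (r + r)%N = N ->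
  (forall x, (x <= J)%MS -> b x x = 0) -> False.
Proof.
move=> fJ rN hJ.
have [v [hdv hcv hfv h2v]] := hF; have [w [hdw hcw hfw h2w]] := hE.
have hv := discrete_valuation hdv; have hw := discrete_valuation hdw.
have [kF [redF hrF]] := residue_map_exists hv hfv.
have [kE [redE hrE]] := residue_map_exists hw hfw.
have [er [er0 hew]] := val_hom iota hdv hcv hfv h2v hdw hfw.
have [u [u0 wu hu]] := nonsquare_unit hdw h2w hrE.
have [pi [pi0 wpi]] := uniformizer_exists hdw.
have [c [c0 li lm [x1 [ix1 lx1]]]] := lam_normalize hdv hcv hfv hdw er0 hew.
have [||P uP hP] := @quad_normal E w hdw hcw h2w kE redE hrE u u0 wu hu (c^-1 *: B) pi _ _ pi0 wpi.
- split; last by rewrite unitmxZ ?unitfE ?invr_eq0 //; case: hB.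
  by rewrite {1}hB.1 !sgn_false !scale1r map_mxZ linearZ /= map_mx_id.
- move=> x; rewrite bfE -scalemxAr -scalemxAl mxE -bfE => /eqP.
  by rewrite mulf_eq0 invr_eq0 (negbTE c0) => /eqP/anB.
have bP x y : bE B (x *m P) (y *m P) = c * bE (norm_diag u pi) x y.
  rewrite fev_mulmx map_mx_id // -hP !bfE -scalemxAr -scalemxAl -scalemxAr -scalemxAl [in RHS]mxE.
  by rewrite mulrA mulfV // mul1r.
pose e' x := e x *m invmx P; pose ei' y := ei (y *m P).
apply: (@no_lagrangian F E iota v w hdv hcv hfv h2v hdw h2w er er0 hew kF redF hrF kE redE hrE
  u pi u0 wu hu pi0 wpi (fun x => lam (c * x)) _ _ li lm x1 ix1 lx1 N e' ei' _ _ _ r J fJ rN).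
- by move=> x y; rewrite mulrDr lamD.
- by move=> a x; rewrite mulrCA lamZ.
- by split=> [x y|a x]; rewrite /e' ?he.1 ?he.2 ?mulmxDl ?scalemxAl.
- by move=> x; rewrite /ei' /e' mulmxKV.
- by move=> y; rewrite /ei' /e' eiK mulmxK.
by move=> x xJ; rewrite -bP /e' mulmxKV //; exact: hJ.
Qed.

Lemma trace_gram : exists G : 'M[F]_N, is_herm (idfun : {rmorphism F -> F}) false G /\
  forall x y, b x y = bF G x y.
Proof.
have [||||G hG] := @bilinear_matrix F N b.
- by move=> x y z; rewrite /b he.1 fevDl lamD.
- by move=> x y z; rewrite /b he.1 fevDr lamD.
- by move=> a x y; rewrite /b he.2 fevZl lamZ.
- by move=> a x y; rewrite /b he.2 fevZr lamZ.
exists G; split=> //; split.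
  rewrite sgn_false scale1r map_mx_id //; apply: (@fev_ext _ (idfun : {rmorphism F -> F})) => x y.
  rewrite -hG /b (bf_sym _ _ hB) -/(b y x) hG !bfE -[in RHS](trmxK x) -trmx_mul -trmx_mul mulmxA.
  by rewrite [RHS]mxE.
have [x0 lx0] := lam_neq0.
rewrite -row_free_unit; apply: inj_row_free => x hx; apply: e_inj0.
apply: (@fev_nondeg _ (idfun : {rmorphism E -> E}) _ _ _ hB.2) => y; rewrite (bf_sym _ _ hB).
apply/eqP; apply: contraT => n0; case/eqP: lx0.
have -> : x0 = bE B (e x) (e (ei ((x0 / bE B (e x) y) *: y))) by rewrite eiK fevZr divfK.
by rewrite -/(b _ _) hG bfE hx mul0mx mxE.
Qed.

(* The anisotropic kernel is nonzero, and universal because cB is isometric to B. *)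
Lemma trace_totiso_bound r (J : 'M[F]_(r, N)) : row_free J ->
  (forall x, (x <= J)%MS -> b x x = 0) -> (r + r + 4 <= N)%N.
Proof.
move=> fJ hJ.
have n2 := local_two_neq0 hF.
have idK := @idfun_invol F.
have [G [hG bG]] := trace_gram.
have [p [A hA]] := aniso_kernel_exists idK n2 hG.
have [k [C [M [pN tM hC hCM perp]]]] := kernel_vectors idK hA.
have tJ : totiso (idfun : {rmorphism F -> F}) G J.
  split=> //; apply/matrixP => i j; rewrite -fev_entry -bG [RHS]mxE.
  have bs x y : b x y = b y x by rewrite /b (bf_sym _ _ hB).
  have hi := hJ _ (row_sub i J); have hj := hJ _ (row_sub j J).
  have := hJ (row i J + row j J); rewrite addmx_sub ?row_sub // => /(_ isT).
  rewrite !bG fevDl !fevDr -!bG hi hj add0r addr0 (bs (row j J)) -mulr2n -mulr_natl => /eqP.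
  by rewrite mulf_eq0 (negbTE n2) => /eqP.
have rk : (r <= k)%N by apply: (totiso_bound idK hG hA pN tJ).
suff p4 : (4 <= p)%N by clear -rk pN p4; lia.
have tMb x : (x <= M)%MS -> b x x = 0.
  by move=> /submxP[D ->]; rewrite bG fev_mulmx tM.2 bfE mulmx0 mul0mx mxE.
have p0 : (0 < p)%N.
  rewrite lt0n; apply/negP => /eqP p0; apply: (trace_not_lagrangian tM.1 _ tMb).
  by rewrite -pN p0.
pose x0 : 'rV[F]_p := delta_mx 0 (Ordinal p0).
have a00 : bF A x0 x0 != 0.
  apply/eqP => /hA.2.1 /rowP/(_ (Ordinal p0)); rewrite !mxE !eqxx => /eqP.
  by rewrite oner_eq0.
set a0 := bF A x0 x0 in a00.
apply: (quad_universal hF hA.1 hA.2.1) => a an0; apply: NNPP => /not_ex_all_not hno.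
have cc0 : iota (a0 / a) != 0 by rewrite fmorph_eq0 mulf_neq0 ?invr_eq0.
have [P uP hP] := quad_scale hE hB anB cc0.
(* The isometry between B and its multiple, read over F, is a similitude of the transferred form
   with factor [a / a0]; it carries a vector of value a0 to one of value a. *)
pose sg x := ei (e x *m P).
have bsg x y : b (sg x) (sg y) = a / a0 * b x y.
  rewrite /b /sg !eiK -lamZ -{2}hP; congr lam; rewrite fev_mulmx map_mx_id //.
  rewrite !bfE -scalemxAr -scalemxAl -scalemxAr -scalemxAl [in RHS]mxE mulrA -rmorphM.
  have -> : a / a0 * (a0 / a) = 1 by field; rewrite a00 an0.
  by rewrite rmorph1 mul1r.
have [eiD eiZ] := ei_semilin.
have sgD x y : sg (x + y) = sg x + sg y by rewrite /sg he.1 mulmxDl eiD.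
have sgZ c x : sg (c *: x) = c *: sg x by rewrite /sg he.2 -scalemxAl eiZ.
have sg_inj x : sg x = 0 -> x = 0.
  move=> h; have := congr1 e h; rewrite /sg eiK (semilin0 he) => h'.
  by apply: e_inj0; rewrite -(mulmxK uP (e x)) h' mul0mx.
have sgl : semilin idfun sg by [].
pose S := \matrix_i sg (delta_mx 0 i).
have sgS x : sg x = x *m S.
  rewrite (semilin_delta sgl) mulmx_sum_row; apply: eq_bigr => i _; by rewrite rowK.
have Mv x y : bF G (x *m M) (y *m M) = 0 by rewrite fev_mulmx tM.2 bfE mulmx0 mul0mx mxE.
have [y0 [y0v y0M]] : exists y0, bF G y0 y0 = a0 /\ forall x, bF G y0 (x *m M) = 0.
  exists (x0 *m C); split=> [|x]; first by rewrite hC.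
  by rewrite fev_mulmx2 hCM mulmx0 mul0mx mxE.
have GS x y : bF G (x *m S) (y *m S) = a / a0 * bF G x y by rewrite -!sgS -!bG bsg.
(* The image of [y0] under sg has value a but need not be orthogonal to M. After adjoining <-a>, the
   images of M and of [y0], the latter completed by 1, span a totally isotropic space of rank
   [k + 1]; so it contains a vector orthogonal to M and outside M. *)
pose Gp : 'M[F]_(N + 1) := block_mx G 0 0 (- a)%:M.
have hGp : is_herm (idfun : {rmorphism F -> F}) false Gp.
  split; last by rewrite unitmxE det_ublock unitrM -unitmxE hG.2 det_scalar1 unitfE oppr_eq0.
  rewrite sgn_false scale1r map_mx_id // tr_block_mx !trmx0 tr_scalar_mx.
  by have := hG.1; rewrite sgn_false scale1r map_mx_id // => <-.
have Gpv x t y t' : bF Gp (row_mx x t) (row_mx y t') = bF G x y - a * (t 0 0 * t' 0 0).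
  rewrite !bfE mul_row_block !mulmx0 addr0 add0r tr_row_mx mul_row_col mxE; congr (_ + _).
  by rewrite mul_mx_scalar -scalemxAl mxE mulNr mxE big_ord1 mxE.
pose U : 'M[F]_(k + 1, N + 1) := block_mx (M *m S) 0 (y0 *m S) 1%:M.
have fS : row_free S.
  by apply: inj_row_free => x; rewrite -sgS; apply: sg_inj.
have tU : totiso (idfun : {rmorphism F -> F}) Gp U.
  split.
    apply: inj_row_free => x; rewrite -[x]hsubmxK mul_row_block mulmx0 add0r mulmx1 -[RHS]row_mx0.
    case/eq_row_mx => h ht; rewrite ht mul0mx addr0 mulmxA in h.
    have : lsubmx x *m M = 0 by apply: (row_free_inj fS); rewrite h mul0mx.
    by rewrite -[RHS](mul0mx _ M) => /(row_free_inj tM.1) ->; rewrite ht row_mx0.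
  apply: (@fev_ext _ (idfun : {rmorphism F -> F})) => x y.
  rewrite -fev_mulmx -[x]hsubmxK -[y]hsubmxK !mul_row_block !mulmx0 !add0r !mulmx1 Gpv.
  set x2 := rsubmx x; set y2 := rsubmx y.
  rewrite !mulmxA -!mulmxDl GS {1}[x2]mx11_scalar {1}[y2]mx11_scalar !mul_scalar_mx.
  rewrite fevDl !fevDr !fevZl !fevZr Mv y0M y0v (bf_sym _ y0 hG) y0M /=.
  rewrite bfE mulmx0 mul0mx [RHS]mxE; by field.
pose Mp : 'M[F]_(k, N + 1) := row_mx M 0.
have tMp : totiso (idfun : {rmorphism F -> F}) Gp Mp.
  split.
    apply: inj_row_free => x; rewrite mul_mx_row mulmx0 -[RHS]row_mx0 => /eq_row_mx[h _].
    by apply: (row_free_inj tM.1); rewrite h mul0mx.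
  apply: (@fev_ext _ (idfun : {rmorphism F -> F})) => x y.
  rewrite -fev_mulmx !mul_mx_row !mulmx0 Gpv Mv mxE !mulr0 subr0.
  by rewrite bfE mulmx0 mul0mx mxE.
have [W [WU WM Wc]] := isotropic_complement idK hGp tU tMp.
have k1 : (0 < k + 1 - k)%N by rewrite addKn.
pose i := Ordinal k1.
have Wi0 : ~ (row i W <= Mp)%MS.
  rewrite rowE => /Wc /rowP/(_ i); rewrite !mxE !eqxx => /eqP; by rewrite oner_eq0.
have WiM : forall x, bF Gp (row i W) (x *m Mp) = 0.
  by move=> x; rewrite rowE fev_mulmx2 WM mulmx0 mul0mx mxE.
have Wiso : bF Gp (row i W) (row i W) = 0.
  by have [D ->] := submxP WU; rewrite row_mul fev_mulmx tU.2 bfE mulmx0 mul0mx mxE.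
move: Wi0 WiM Wiso; rewrite -[row i W]hsubmxK; set z := lsubmx _; set t := rsubmx _ => nz zM ziso.
have [|x [y [zE zA]]] := perp z.
  apply/rowP => j; have := zM (delta_mx 0 j); rewrite mul_mx_row mulmx0 Gpv.
  have -> : (0 : 'rV[F]_1) 0 0 = 0 by rewrite mxE.
  rewrite !mulr0 subr0 bfE trmx_mul mulmxA trmx_delta -colE => h.
  rewrite map_mx_id // [RHS]mxE; apply: etrans h; by rewrite [RHS]mxE.
(* The vector found satisfies [A(x, x) = a * t ^ 2]; by anisotropy of A, [t = 0] would put it into
   M. *)
rewrite Gpv zA in ziso.
have [t0|t0] := eqVneq (t 0 0) 0.
  move: ziso; rewrite t0 mul0r mulr0 subr0 => /hA.2.1 x00; apply: nz.
  have -> : t = 0 by rewrite [t]mx11_scalar t0 raddf0.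
  by rewrite zE x00 mul0mx add0r; apply/submxP; exists y; rewrite mul_mx_row mulmx0.
apply: (hno ((t 0 0)^-1 *: x)); rewrite fevZl fevZr /=.
move/eqP: ziso; rewrite subr_eq0 => /eqP ->; by field.
Qed.

End TraceForm.

(** * Hermitian forms and the fixed field *)

Section HermitianBridge.
Variables (K : fieldType) (tau : {rmorphism K -> K}).
Hypothesis tauK : involutive tau.
Hypothesis hK : nonarch_local_field_odd_residue K.
Local Notation K0 := (fixf tau).
Local Notation iota := (@fixval K tau).
Local Notation bf := (form_eval (idfun : {rmorphism K0 -> K0})).
Local Notation fev := (form_eval tau).
Variables (c : nat) (dl : 'I_c -> K) (dec : 'I_c -> K -> K0).
Hypothesis decK : forall x, x = \sum_i dl i * iota (dec i x).
Hypothesis Kdec : forall (y : 'I_c -> K0) i, dec i (\sum_j dl j * iota (y j)) = y i.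

Definition fix_join n (x : 'rV[K0]_(c * n)) : 'rV[K]_n :=
  \row_j \sum_i dl i * iota (vec_mx x i j).
Definition fix_split n (y : 'rV[K]_n) : 'rV[K0]_(c * n) :=
  mxvec (\matrix_(i, j) dec i (y 0 j)).

Lemma fix_splitK n : cancel (@fix_split n) (@fix_join n).
Proof.
move=> y; apply/rowP => j; rewrite mxE [RHS](decK (y 0 j)); apply: eq_bigr => i _.
by rewrite /fix_split mxvecK mxE.
Qed.

Lemma fix_joinK n : cancel (@fix_join n) (@fix_split n).
Proof.
move=> x; rewrite /fix_split -[RHS]vec_mxK; congr mxvec; apply/matrixP => i j.
by rewrite [LHS]mxE /fix_join [X in dec i X]mxE (Kdec (fun i => vec_mx x i j)).
Qed.

Lemma fix_join_semilin n : semilin iota (@fix_join n).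
Proof.
split=> [x y|a x]; apply/rowP => j; rewrite !mxE.
  rewrite -big_split /=; apply: eq_bigr => i _.
  by rewrite linearD mxE rmorphD mulrDr.
rewrite mulr_sumr; apply: eq_bigr => i _.
by rewrite linearZ /= mxE rmorphM /= mulrCA.
Qed.

Variables (s : bool) (theta : K).
Hypothesis theta0 : theta != 0.
Hypothesis tau_theta : tau theta = sgn K s * theta.

Lemma theta_value n (H : 'M[K]_n) x y : is_herm tau s H ->
  tau (theta * fev H x y) = theta * fev H y x.
Proof.
move=> hH; rewrite rmorphM /= tau_theta (fev_herm tauK y x hH); ring.
Qed.

(** The form is the tau-invariant part of theta h. As theta h(x, x) is itself invariant, the
    diagonal values are unchanged and anisotropy passes down. *)
Lemma fixed_form n (H : 'M[K]_n) : is_herm tau s H -> anisotropic tau H ->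
  exists B : 'M[K0]_(c * n), [/\ is_herm (idfun : {rmorphism K0 -> K0}) false B,
    anisotropic (idfun : {rmorphism K0 -> K0}) B
    & forall x, iota (bf B x x) = theta * fev H (fix_join x) (fix_join x)].
Proof.
move=> hH an.
have n2 := local_two_neq0 hK.
have [eD eZ] := @fix_join_semilin n.
pose b' x y := 2%:R^-1 * (theta * fev H (fix_join x) (fix_join y) + theta * fev H (fix_join y) (fix_join x)).
have fb x y : tau (b' x y) = b' x y.
  rewrite /b' rmorphM rmorphD /= !theta_value // fmorphV rmorph_nat; by rewrite addrC.
pose b x y := tofix tau (b' x y).
have bE x y : iota (b x y) = b' x y by rewrite tofixK.
have [||||B hB] := @bilinear_matrix _ _ b.
- move=> x y z; apply: fixval_inj; rewrite rmorphD /= !bE /b' eD !fevDl !fevDr; ring.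
- move=> x y z; apply: fixval_inj; rewrite rmorphD /= !bE /b' eD !fevDl !fevDr; ring.
- move=> a x y; apply: fixval_inj; rewrite rmorphM /= !bE /b' eZ !fevZl !fevZr fix_val; ring.
- move=> a x y; apply: fixval_inj; rewrite rmorphM /= !bE /b' eZ !fevZl !fevZr fix_val; ring.
have bv x : iota (bf B x x) = theta * fev H (fix_join x) (fix_join x).
  by rewrite -hB bE /b'; field.
have anB : anisotropic (idfun : {rmorphism K0 -> K0}) B.
  move=> x hx; have := bv x; rewrite hx rmorph0 => /esym/eqP.
  rewrite mulf_eq0 (negbTE theta0) => /eqP/an h.
  by rewrite -[x]fix_joinK h -(semilin0 (@fix_join_semilin n)) fix_joinK.
exists B; split=> //; split.
  rewrite sgn_false scale1r map_mx_id //; apply: (@fev_ext _ (idfun : {rmorphism K0 -> K0})) => x y.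
  have -> : bf B^T x y = bf B y x.
    by rewrite !bfE -[in LHS](trmxK x) -trmx_mul -trmx_mul mulmxA [LHS]mxE.
  by rewrite -!hB; apply: fixval_inj; rewrite !bE /b' addrC.
rewrite -row_free_unit; apply: inj_row_free => x hx; apply: anB.
by rewrite bfE hx mul0mx mxE.
Qed.

Lemma herm_dim n (H : 'M[K]_n) : is_herm tau s H -> anisotropic tau H -> (c * n <= 4)%N.
Proof.
move=> hH an; have [B [hB anB _]] := fixed_form hH an.
exact: (quad_dim (fixed_local tauK hK) hB anB).
Qed.

(* A maximal A is universal: otherwise A _|_ <-b> would be a larger anisotropic form. *)
Lemma herm_max n (H : 'M[K]_n) : is_herm tau s H -> anisotropic tau H ->
  (forall n' (H' : 'M[K]_n'), is_herm tau s H' -> anisotropic tau H' -> (n' <= n)%N) ->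
  (c * n = 4)%N.
Proof.
move=> hH an hmax; have [B [hB anB hv]] := fixed_form hH an.
apply/eqP; rewrite eqn_leq (herm_dim hH an) /=.
apply: (quad_universal (fixed_local tauK hK) hB anB) => b b0.
have ib0 : iota b != 0 by rewrite fmorph_eq0.
(* The factor is such that an isotropic vector (x, t) of the enlarged form satisfies theta h(x, x) =
   b t tau(t). *)
pose d := - (theta^-1 * iota b).
have d0 : d != 0 by rewrite oppr_eq0 mulf_neq0 ?invr_eq0.
have sgn0 : sgn K s != 0 by rewrite /sgn signr_eq0.
have td : tau d = sgn K s * d.
  rewrite /d rmorphN rmorphM fmorphV /= tau_theta fix_val invfM.
  have -> : (sgn K s)^-1 = sgn K s by apply: (mulfI sgn0); rewrite mulfV // sgn_sqr.
  ring.
pose H' : 'M[K]_(n + 1) := block_mx H 0 0 d%:M.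
have hH' : is_herm tau s H'.
  split; last by rewrite unitmxE det_ublock unitrM -unitmxE hH.2 det_scalar1 unitfE.
  rewrite map_block_mx !map_mx0 map_scalar_mx tr_block_mx !trmx0 tr_scalar_mx scale_block_mx !scaler0.
  by rewrite -hH.1 /= td scale_scalar_mx mulrA sgn_sqr mul1r.
have fH' x t : fev H' (row_mx x t) (row_mx x t) = fev H x x + d * (tau (t 0 0) * t 0 0).
  rewrite /form_eval map_row_mx mul_row_block !mulmx0 addr0 add0r tr_row_mx mul_row_col mxE; congr (_ + _).
  by rewrite mul_mx_scalar -scalemxAl mxE mxE big_ord1 !mxE.
have nan : ~ anisotropic tau H' by move=> /(hmax _ _ hH'); rewrite addn1 ltnn.
have [z hnz] := not_all_ex_not _ _ nan; have [hz nz] := imply_to_and _ _ hnz; clear hnz.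
move: hz nz; rewrite -[z]hsubmxK; move: (lsubmx z) (rsubmx z) => x t; rewrite fH' => hz nz.
have t0 : t 0 0 != 0.
  apply/eqP => t0; apply: nz; have -> : t = 0 by rewrite [t]mx11_scalar t0 raddf0.
  by move: hz; rewrite t0 mulr0 mulr0 addr0 => /an ->; rewrite row_mx0.
exists (fix_split ((t 0 0)^-1 *: x)); apply: fixval_inj; rewrite hv fix_splitK fevZl fevZr fmorphV.
move/eqP: hz; rewrite addr_eq0 => /eqP ->; rewrite /d; field.
by rewrite theta0 t0 fmorph_eq0 t0.
Qed.

Lemma aniso_self n (H : 'M[K]_n) : is_herm tau s H -> anisotropic tau H -> aniso_kernel tau s H H.
Proof.
move=> hH an; split=> //; split=> //; exists 0%N.
have e : (n + (0 + 0))%N = n by rewrite !addn0.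
exists e; apply: (isometric_cast e (P := col_mx 1%:M (0 : 'M_(0 + 0, n)))).
  apply: inj_row_free => x; rewrite -[x]hsubmxK mul_row_col mulmx1 mulmx0 addr0 => ->.
  have -> : rsubmx x = 0 by apply/rowP; case.
  by rewrite row_mx0.
rewrite map_col_mx map_mx1 map_mx0 tr_col_mx trmx1 trmx0 mul_col_mx mul_col_row !mul1mx !mul0mx !mulmx0 mulmx1.
by congr block_mx; apply/matrixP; case.
Qed.

End HermitianBridge.

(** * The trace form *)

Section TraceCoordinates.
Variables (F : fieldType) (rho : {rmorphism F -> F}) (s : bool).
Variables (E : fieldExtType F) (rho' : {rmorphism E -> E}).
Hypothesis rhoK : involutive rho.
Hypothesis rhoK' : involutive rho'.
Hypothesis rho_ext : forall a : F, rho' (a%:A) = (rho a)%:A.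
Variable lam : E -> F.
Hypothesis lam_lin : forall (a : F) (x y : E), lam (a *: x + y) = a * lam x + lam y.
Hypothesis lam_neq0 : exists x : E, lam x != 0.
Hypothesis lam_rho : forall x : E, lam (rho' x) = rho (lam x).

Local Notation d := (\dim {:E}).
Local Notation bs := (vbasis {:E}).
Local Notation index n := #|{: 'I_n * 'I_d}|.
Local Notation T := (trace_form rho' lam).

Definition ext_join n (u : 'rV[F]_(index n)) : 'rV[E]_n :=
  \row_i \sum_t u 0 (enum_rank (i, t)) *: tnth bs t.
Definition ext_split n (y : 'rV[E]_n) : 'rV[F]_(index n) :=
  \row_k coord bs (enum_val k).2 (y 0 (enum_val k).1).

Lemma ext_splitK n : cancel (@ext_split n) (@ext_join n).
Proof.
move=> y; apply/rowP => i; rewrite mxE [RHS](coord_vbasis (memvf (y 0 i))).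
by apply: eq_bigr => t _; rewrite mxE enum_rankK (tnth_nth 0).
Qed.

Lemma ext_joinK n : cancel (@ext_join n) (@ext_split n).
Proof.
move=> u; apply/rowP => k; rewrite !mxE.
under eq_bigr do rewrite (tnth_nth 0).
rewrite (coord_sum_free (fun t => u 0 (enum_rank ((enum_val k).1, t)))) ?(basis_free (vbasisP _)) //.
by rewrite -surjective_pairing enum_valK.
Qed.

Lemma ext_join_semilin n : semilin (in_alg E) (@ext_join n).
Proof.
split=> [x y|a x]; apply/rowP => i; rewrite !mxE.
  by rewrite -big_split /=; apply: eq_bigr => t _; rewrite mxE scalerDl.
by rewrite mulr_algl scaler_sumr; apply: eq_bigr => t _; rewrite mxE scalerA.
Qed.

Lemma ext_join_delta n k :
  @ext_join n (delta_mx 0 k) = tnth bs (enum_val k).2 *: delta_mx 0 (enum_val k).1.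
Proof.
rewrite -[RHS]ext_splitK; congr ext_join; apply/rowP => l; rewrite !mxE /=.
rewrite -(inj_eq enum_val_inj); case: (enum_val k) (enum_val l) => i t [j r] /=.
rewrite xpair_eqE; case: eqVneq => _ /=; last by rewrite mulr0 linear0.
by rewrite mulr1 (tnth_nth 0) coord_free ?(basis_free (vbasisP _)) // eq_sym.
Qed.

Lemma lam_zero : lam 0 = 0.
Proof. by apply: (addrI (lam 0)); have := lam_lin 1 0 0; rewrite scaler0 addr0 mul1r => <-; rewrite addr0. Qed.

Lemma lam_add x y : lam (x + y) = lam x + lam y.
Proof. by have := lam_lin 1 x y; rewrite scale1r mul1r. Qed.

Lemma lam_scale a x : lam (a%:A * x) = a * lam x.
Proof. by rewrite mulr_algl; have := lam_lin a x 0; rewrite addr0 lam_zero addr0. Qed.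

Lemma lam_sum (I : finType) (f : I -> E) : lam (\sum_i f i) = \sum_i lam (f i).
Proof. by elim/big_ind2: _ => [|? ? ? ? <- <-|//]; rewrite ?lam_zero ?lam_add. Qed.

Lemma fev_delta (K : fieldType) (tau : {rmorphism K -> K}) n (H : 'M[K]_n) i j :
  form_eval tau H (delta_mx 0 i) (delta_mx 0 j) = H i j.
Proof.
by rewrite -[delta_mx 0 i]mulmx1 -[delta_mx 0 j]mulmx1 -!rowE fev_entry map_mx1 trmx1 mulmx1 mul1mx.
Qed.

Lemma trace_form_eval n (H : 'M[E]_n) x y :
  form_eval rho (T H) x y = lam (form_eval rho' H (ext_join x) (ext_join y)).
Proof.
have hs := @ext_join_semilin n.
rewrite (semilin_delta hs x) (semilin_delta hs y) {1}(row_sum_delta x) {1}(row_sum_delta y).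
rewrite !fev_suml lam_sum; apply: eq_bigr => k _.
rewrite !fev_sumr lam_sum; apply: eq_bigr => l _.
rewrite !fevZl !fevZr fev_delta rho_ext !lam_scale !ext_join_delta fevZl fevZr fev_delta mxE.
by congr (_ * (_ * lam _)); ring.
Qed.

Lemma sgn_alg : sgn E s = (sgn F s)%:A.
Proof. by rewrite /sgn; case: s; rewrite ?expr1 ?expr0 ?scaleN1r ?scale1r. Qed.

Lemma trace_form_herm n (H : 'M[E]_n) : is_herm rho' s H -> is_herm rho s (T H).
Proof.
move=> hH.
have sw x y : form_eval rho (T H) x y = sgn F s * rho (form_eval rho (T H) y x).
  by rewrite !trace_form_eval (fev_herm rhoK' _ _ hH) sgn_alg lam_scale lam_rho.
split; first by apply/matrixP => i j; rewrite adjE -[LHS](fev_delta rho) sw fev_delta.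
have [x0 lx0] := lam_neq0.
rewrite -row_free_unit; apply: inj_row_free => x hx.
suff h : map_mx rho x = 0 by rewrite -[x](map_mxK rhoK) h map_mx0.
set z := map_mx rho x.
have zy y : form_eval rho (T H) z y = 0.
  by rewrite /form_eval map_mxK // hx mul0mx mxE.
have zy' y : form_eval rho' H (ext_join z) y = 0.
  apply/eqP; apply: contraT => n0; case/eqP: lx0.
  have -> : x0 = form_eval rho' H (ext_join z) (ext_join (ext_split ((x0 / form_eval rho' H (ext_join z) y) *: y))).
    by rewrite ext_splitK fevZr divfK.
  by rewrite -trace_form_eval zy.
have e0 : ext_join z = 0.
  apply: (fev_nondeg (tau := rho') hH.2) => y; by rewrite (fev_herm rhoK' _ _ hH) zy' rmorph0 mulr0.
by rewrite -[z]ext_joinK e0 -(semilin0 (@ext_join_semilin n)) ext_joinK.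
Qed.

Hypothesis hF : nonarch_local_field_odd_residue F.

Let hE : nonarch_local_field_odd_residue E := extension_local E hF.

(** * Descent of the trace form to the fixed fields *)

Definition fix_incl (a : fixf rho) : fixf rho' := tofix rho' (fixval a)%:A.

Lemma fix_inclE a : fixval (fix_incl a) = (fixval a)%:A.
Proof. by rewrite /fix_incl tofixK // rho_ext fix_val. Qed.

Lemma fix_incl_nmod : nmod_morphism fix_incl.
Proof.
split=> [|x y]; apply: fixval_inj; rewrite ?rmorph0 fix_inclE ?rmorph0 ?scale0r //.
by rewrite !rmorphD /= !fix_inclE scalerDl.
Qed.

Lemma fix_incl_monoid : monoid_morphism fix_incl.
Proof.
split=> [|x y]; apply: fixval_inj; rewrite ?rmorph1 fix_inclE ?rmorph1 ?scale1r //.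
by rewrite !rmorphM /= !fix_inclE -in_algE rmorphM.
Qed.

HB.instance Definition _ := GRing.isNmodMorphism.Build _ _ fix_incl fix_incl_nmod.
HB.instance Definition _ := GRing.isMonoidMorphism.Build _ _ fix_incl fix_incl_monoid.

Section Bound.
Variables (cF : nat) (dlF : 'I_cF -> F) (decF : 'I_cF -> F -> fixf rho).
Hypothesis decFK : forall x, x = \sum_i dlF i * fixval (decF i x).
Hypothesis KdecF : forall (y : 'I_cF -> fixf rho) i, decF i (\sum_j dlF j * fixval (y j)) = y i.
Variables (cE : nat) (dlE : 'I_cE -> E) (decE : 'I_cE -> E -> fixf rho').
Hypothesis decEK : forall x, x = \sum_i dlE i * fixval (decE i x).
Hypothesis KdecE : forall (y : 'I_cE -> fixf rho') i, decE i (\sum_j dlE j * fixval (y j)) = y i.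
Variable theta : F.
Hypothesis theta0 : theta != 0.
Hypothesis rho_theta : rho theta = sgn F s * theta.

Lemma theta_alg0 : theta%:A != 0 :> E.
Proof. by rewrite scaler_eq0 negb_or theta0 oner_eq0. Qed.

Lemma rho_theta_alg : rho' theta%:A = sgn E s * theta%:A.
Proof. by rewrite rho_ext rho_theta sgn_alg -!in_algE rmorphM. Qed.

Lemma fixval_lam (x : fixf rho') : fixval (tofix rho (lam (fixval x))) = lam (fixval x).
Proof. by rewrite tofixK // -lam_rho fix_val. Qed.

(** If [lam y = 1], then [y + rho' y] is fixed and lam sends it to 2, which is nonzero. *)
Lemma lam_fixed_neq0 : exists x : fixf rho', tofix rho (lam (fixval x)) != 0.
Proof.
have [x lx] := lam_neq0; pose y := (lam x)^-1%:A * x.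
have ly : lam y = 1 by rewrite lam_scale mulVf.
have ty : rho' (y + rho' y) = y + rho' y by rewrite rmorphD /= rhoK' addrC.
exists (tofix rho' (y + rho' y)).
rewrite -(fmorph_eq0 (@fixval F rho)) /= fixval_lam tofixK // lam_add lam_rho ly rmorph1.
exact: local_two_neq0.
Qed.

(** Over the fixed fields J has rank [cF * r] and theta A becomes a four-dimensional quadratic form.
    As theta lies in F, it moves out of lam, so J remains isotropic and [trace_totiso_bound]
    applies. *)
Lemma trace_form_bound m (A : 'M[E]_m) r (J : 'M[F]_(r, index m)) :
  is_herm rho' s A -> anisotropic rho' A -> (cE * m = 4)%N ->
  row_free J -> (forall x, (x <= J)%MS -> form_eval rho (T A) x x = 0) ->
  (cF * (r + r) + 4 <= cF * index m)%N.
Proof.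
move=> hA anA cm fJ hJ.
have [B [hB anB hv]] := fixed_form rhoK' hE KdecE theta_alg0 rho_theta_alg hA anA.
pose joinF n := @fix_join F rho cF dlF n; pose splitF n := @fix_split F rho cF decF n.
pose joinE n := @fix_join E rho' cE dlE n; pose splitE n := @fix_split E rho' cE decE n.
have jF n : semilin (@fixval F rho) (@joinF n) by apply: fix_join_semilin.
have jE n : semilin (@fixval E rho') (@joinE n) by apply: fix_join_semilin.
have jFK n : cancel (@joinF n) (@splitF n) by apply: fix_joinK.
have sFK n : cancel (@splitF n) (@joinF n) by apply: fix_splitK.
have jEK n : cancel (@joinE n) (@splitE n) by apply: fix_joinK.
have sEK n : cancel (@splitE n) (@joinE n) by apply: fix_splitK.
have js := @ext_join_semilin m.
pose e x := splitE m (ext_join (joinF _ x)).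
pose ei y := splitF _ (ext_split (joinE m y)).
have he : semilin fix_incl e.
  split=> [x y|a x]; apply: (can_inj (jEK _)).
    by rewrite (jE _).1 !sEK (jF _).1 js.1.
  by rewrite (jE _).2 !sEK (jF _).2 js.2 fix_inclE.
have eK : cancel e ei by move=> x; rewrite /ei /e sEK ext_joinK jFK.
have eiK : cancel ei e by move=> y; rewrite /ei /e sFK ext_splitK jEK.
pose lam0 (x : fixf rho') : fixf rho := tofix rho (lam (fixval x)).
have lam0D x y : lam0 (x + y) = lam0 x + lam0 y.
  by apply: fixval_inj; rewrite rmorphD /= !fixval_lam rmorphD lam_add.
have lam0Z a x : lam0 (fix_incl a * x) = a * lam0 x.
  by apply: fixval_inj; rewrite rmorphM /= !fixval_lam rmorphM /= fix_inclE lam_scale.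
pose g (x : 'rV[fixf rho]_(cF * r)) := splitF _ (joinF r x *m J).
have hg : semilin idfun g.
  split=> [x y|a x]; apply: (can_inj (jFK _)).
    by rewrite (jF _).1 !sFK (jF _).1 mulmxDl.
  by rewrite (jF _).2 !sFK (jF _).2 scalemxAl.
pose J0 := \matrix_i g (delta_mx 0 i).
have gE x : x *m J0 = g x.
  by rewrite (semilin_delta hg) mulmx_sum_row; apply: eq_bigr => i _; rewrite rowK.
have fJ0 : row_free J0.
  apply: inj_row_free => x; rewrite gE => h.
  have : joinF r x *m J = 0 by rewrite -(sFK _ (_ *m J)) -/(g x) h (semilin0 (jF _)).
  rewrite -[RHS](mul0mx _ J) => /(row_free_inj fJ) h'.
  by rewrite -[x]jFK h' -(semilin0 (jF r)) jFK.
have hJ0 x : (x <= J0)%MS -> lam0 (form_eval (idfun : {rmorphism fixf rho' -> fixf rho'}) B (e x) (e x)) = 0.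
  move=> /submxP[D ->]; rewrite gE; apply: fixval_inj; rewrite fixval_lam hv rmorph0 lam_scale.
  rewrite -/(joinE m _) /e sEK -trace_form_eval /g sFK hJ ?mulr0 //; exact: submxMl.
(* The bound is available for size literally 4; generalising the size lets [cE * m = 4] be
   substituted in the types. *)
have gen q : q = 4%N -> forall (e : 'rV[fixf rho]_(cF * index m) -> 'rV[fixf rho']_q)
    (ei : 'rV[fixf rho']_q -> 'rV[fixf rho]_(cF * index m)) (B : 'M[fixf rho']_q),
    semilin fix_incl e -> cancel e ei -> cancel ei e ->
    is_herm (idfun : {rmorphism fixf rho' -> fixf rho'}) false B ->
    anisotropic (idfun : {rmorphism fixf rho' -> fixf rho'}) B ->
    (forall x, (x <= J0)%MS -> lam0 (form_eval (idfun : {rmorphism fixf rho' -> fixf rho'}) B (e x) (e x)) = 0) ->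
    (cF * r + cF * r + 4 <= cF * index m)%N.
  move=> -> e1 ei1 B1 h1 h2 h3 h4 h5 h6.
  exact: (trace_totiso_bound (fixed_local rhoK hF) (fixed_local rhoK' hE) h1 h2 h3
    lam0D lam0Z lam_fixed_neq0 h4 h5 fJ0 h6).
by rewrite mulnDr; apply: (gen _ cm e ei B).
Qed.

End Bound.

Lemma antifixed_exists (K : fieldType) (tau : {rmorphism K -> K}) :
  involutive tau -> ~ (tau =1 id) -> exists2 d, d != 0 & tau d = - d.
Proof.
move=> tK hno; have [a ha] := not_all_ex_not _ _ hno.
exists (a - tau a); first by rewrite subr_eq0 eq_sym; apply/eqP.
by rewrite rmorphB /= tK opprB.
Qed.

(** h(x, x) = - h(x, x) makes every vector isotropic. *)
Lemma skew_aniso_dim (K : fieldType) (tau : {rmorphism K -> K}) m (A : 'M[K]_m) :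
  (2%:R : K) != 0 -> tau =1 id -> is_herm tau true A -> anisotropic tau A -> m = 0%N.
Proof.
move=> n2 tid hA an; have tK : involutive tau by move=> x; rewrite !tid.
case: m A hA an => // m A hA an.
have := an (delta_mx 0 ord0); have := fev_herm tK (delta_mx 0 ord0) (delta_mx 0 ord0) hA.
rewrite tid /sgn expr1 mulN1r => /eqP; rewrite -addr_eq0 -mulr2n -mulr_natl mulf_eq0 (negbTE n2).
move=> /eqP h /(_ h) /rowP/(_ ord0); rewrite !mxE !eqxx => /eqP; by rewrite oner_eq0.
Qed.

Lemma card_index n : index n = (n * d)%N.
Proof. by rewrite card_prod !card_ord. Qed.

(** The hyperbolic part of H is used only through its Lagrangian [ME]: the Lagrangian M of the
    hyperbolic part of the trace form is cut down to vectors orthogonal to [ME] and projected to the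
    anisotropic part A, where [trace_form_bound] controls the rank. Counting gives [4 <= cF * p]. *)
Lemma in_X_trace n (H : 'M[E]_n) : in_X rho' s H -> in_X rho s (T H).
Proof.
case=> hH [m [A [hA Amax]]].
have n2F := local_two_neq0 hF; have n2E := local_two_neq0 hE.
have hT := trace_form_herm hH; split=> //.
have [p [B hB]] := aniso_kernel_exists rhoK n2F hT.
exists p, B; split=> // n' H' hH' m' A' hA'.
have [cF [dlF [decF [cF0 decFK KdecF]]]] := fix_basis rhoK n2F.
have [cE [dlE [decE [cE0 decEK KdecE]]]] := fix_basis rhoK' n2E.
(* In this case rho' may still be nontrivial and F contains no theta, but over F only the zero space
   is anisotropic. *)
case: (classic (s = true /\ rho =1 id)) => [[s1 rid]|hns].
  have -> // : m' = 0%N; subst s.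
  exact: (skew_aniso_dim n2F rid hA'.1 hA'.2.1).
have [th th0 rth] : exists2 th, th != 0 & rho th = sgn F s * th.
  rewrite /sgn; case: (s) hns => hns; last by exists 1; rewrite ?oner_neq0 // rmorph1 expr0 mulr1.
  have [|th th0 hth] := antifixed_exists rhoK (_ : ~ rho =1 id); first by move=> h; apply: hns.
  by exists th; rewrite // expr1 mulN1r.
have cm' := herm_dim rhoK hF KdecF th0 rth hA'.1 hA'.2.1.
have cm : (cE * m = 4)%N.
  apply: (herm_max rhoK' hE decEK KdecE (theta_alg0 th0) (rho_theta_alg rth) hA.1 hA.2.1).
  by move=> n1 H1 hH1 an1; apply: (Amax _ _ hH1); apply: aniso_self.
suff hp : (4 <= cF * p)%N by rewrite -(leq_pmul2l cF0); apply: leq_trans hp.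
have [k [C [M [pN tM _ _ _]]]] := kernel_vectors rhoK hB.
have [l [CE [ME [mN tME hCE hCME perp]]]] := kernel_vectors rhoK' hA.
have js q := @ext_join_semilin q.
pose g (u : 'rV[F]_(index l)) := ext_split (ext_join u *m ME).
have hg : semilin idfun g.
  split=> [x y|a x]; apply: (can_inj (@ext_joinK _)).
    by rewrite (js _).1 !ext_splitK (js _).1 mulmxDl.
  by rewrite (js _).2 !ext_splitK (js _).2 scalemxAl.
pose MF := \matrix_i g (delta_mx 0 i).
have gE x : x *m MF = g x.
  by rewrite (semilin_delta hg) mulmx_sum_row; apply: eq_bigr => i _; rewrite rowK.
have MEv x y : form_eval rho' H (x *m ME) (y *m ME) = 0.
  by rewrite fev_mulmx tME.2 /form_eval mulmx0 mul0mx mxE.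
have tMF : totiso rho (T H) MF.
  split; last first.
    apply/matrixP => i j; rewrite -fev_entry !rowE !gE trace_form_eval !ext_splitK MEv lam_zero.
    by rewrite mxE.
  apply: inj_row_free => x; rewrite gE => h.
  have : ext_join x *m ME = 0 by rewrite -(ext_splitK (_ *m ME)) -/(g x) h (semilin0 (js _)).
  rewrite -[RHS](mul0mx _ ME) => /(row_free_inj tME.1) h'.
  by rewrite -[x]ext_joinK h' -(semilin0 (js _)) ext_joinK.
(* If k is at most the rank of [MF], the truncated difference is 0 and W is empty; the final
   inequality covers this case too. *)
have [W [WM WMF Wc]] := isotropic_complement rhoK hT tM tMF.
have [x0 lx0] := lam_neq0.
have Wperp c : map_mx rho' (ext_join (c *m W)) *m H *m ME^T = 0.
  apply/rowP => j; rewrite [RHS]mxE.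
  have -> : (map_mx rho' (ext_join (c *m W)) *m H *m ME^T) 0 j =
            form_eval rho' H (ext_join (c *m W)) (delta_mx 0 j *m ME).
    by rewrite /form_eval trmx_mul mulmxA trmx_delta -colE [RHS]mxE.
  (* Rows of [ME] may be scaled by all of E, so orthogonality after applying lam forces
     orthogonality for h itself. *)
  set z := form_eval _ _ _ _; apply/eqP; apply: contraT => z0; case/eqP: lx0.
  pose y : 'rV[E]_l := (x0 / z) *: delta_mx 0 j.
  have -> : x0 = form_eval rho' H (ext_join (c *m W)) (ext_join (ext_split y *m MF)).
    by rewrite gE !ext_splitK -scalemxAl fevZr -/z divfK.
  by rewrite -trace_form_eval fev_mulmx2 WMF mulmx0 mul0mx mxE.
have /fin_all_exists[xs hxs] : forall i, exists x : 'rV[E]_m, exists y, ext_join (row i W) = x *m CE + y *m ME.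
  move=> i; have [x [y [h _]]] := perp _ (Wperp (delta_mx 0 i)).
  by exists x, y; rewrite rowE.
have /fin_all_exists[ys hys] := hxs.
(* The components along [CE]: those along [ME] do not change the value of the form, and since W
   meets [MF] trivially, dropping them loses no rank. *)
pose J := \matrix_i ext_split (xs i); pose Y := \matrix_i ext_split (ys i).
have eJ c : ext_join (c *m W) = ext_join (c *m J) *m CE + ext_join (c *m Y) *m ME.
  have sm q r (Z : 'M[F]_(r, index q)) (c' : 'rV[F]_r) :
      ext_join (c' *m Z) = \sum_i (c' 0 i)%:A *: ext_join (row i Z).
    rewrite mulmx_sum_row (semilin_sum (js _)); apply: eq_bigr => i _; exact: (js _).2.
  rewrite !sm !mulmx_suml -big_split; apply: eq_bigr => i _ /=.
  by rewrite hys !rowK !ext_splitK scalerDr !scalemxAl.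
have eJv c : form_eval rho' H (ext_join (c *m W)) (ext_join (c *m W)) =
    form_eval rho' A (ext_join (c *m J)) (ext_join (c *m J)).
  have CM x y : form_eval rho' H (x *m CE) (y *m ME) = 0.
    by rewrite fev_mulmx2 hCME mulmx0 mul0mx mxE.
  rewrite eJ !fevDl !fevDr CM MEv hCE (fev_herm rhoK' _ (_ *m CE) hH) CM rmorph0 mulr0.
  by rewrite !addr0.
have fJ : row_free J.
  apply: inj_row_free => c hc; apply: Wc.
  have h : c *m W = (c *m Y) *m MF.
    by rewrite gE -[LHS]ext_joinK eJ hc (semilin0 (js _)) mul0mx add0r.
  by rewrite h submxMl.
have hJ x : (x <= J)%MS -> form_eval rho (T A) x x = 0.
  move=> /submxP[c ->]; rewrite trace_form_eval -eJv -trace_form_eval.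
  have [D ->] := submxP WM; rewrite mulmxA fev_mulmx tM.2.
  by rewrite /form_eval mulmx0 mul0mx mxE.
have := trace_form_bound decFK KdecF decEK KdecE th0 rth hA.1 hA.2.1 cm fJ hJ.
move: pN; rewrite !card_index -mN => pN.
clear - cF0 pN; nia.
Qed.

End TraceCoordinates.

Theorem theorem4p3
  (F : fieldType) (hF : nonarch_local_field_odd_residue F)
  (rho : {rmorphism F -> F}) (hrho : involutive rho)
  (s : bool)
  (E : fieldExtType F)
  (rho' : {rmorphism E -> E}) (hrho' : involutive rho')
  (hext : forall a : F, rho' (a%:A) = (rho a)%:A)
  (lam : E -> F)
  (hlin : forall (a : F) (x y : E), lam (a *: x + y) = a * lam x + lam y)
  (hnz : exists x : E, lam x != 0)
  (hcomm : forall x : E, lam (rho' x) = rho (lam x))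
  (n : nat) (H : 'M[E]_n) (hX : in_X rho' s H) :
  in_X rho s (trace_form rho' lam H).
Proof.
exact: (in_X_trace hrho hrho' hext hlin hnz hcomm hF hX).
Qed.
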